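(* Let $\Bbbk$ be a commutative unital ring, and let $\underline{\mathcal{A}ss}$ be the non-$\Sigma$ cyclic operad for associative algebras in $\Bbbk$-modules, i.e. the $\Bbbk$-linear span of the terminal non-$\Sigma$ cyclic operad $\underline *_C$ in sets. Then its non-$\Sigma$ modular envelope $\underline{\mathrm{Mod}}(\underline{\mathcal{A}ss})$ is the $\Bbbk$-linear span of the terminal (geometric) non-$\Sigma$ modular operad $\underline *_M$ in the category of sets. Explicitly, $$\underline{\mathrm{Mod}}(\underline{\mathcal{A}ss})(\mathsf S;g)=\Bbbk$$ for each multicyclically ordered set $\mathsf S$ and each $g\in\mathbb N$ such that $(\mathsf S,g)$ is geometric (the component being $0$ if $(\mathsf S,g)$ is not geometric), and on these components $\Bbbk$ all structure operations are either the identities of $\Bbbk$ or the canonical isomorphisms $\Bbbk\otimes\Bbbk\xrightarrow{\ \cong\ }\Bbbk$.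
   Context: Conventions: $\mathbb N=\{0,1,2,\dots\}$. $(\mathtt M,\otimes,1)$ is either $(\mathrm{Set},\times,* )$ or the category of $\Bbbk$-modules with $\otimes=\otimes_\Bbbk$; $\tau$ is its symmetry and $0$ its initial object. $\mathrm{Span}$ is the free $\Bbbk$-module functor from sets to $\Bbbk$-modules, applied componentwise to operads. No operadic units and no stability conditions are required. **Cyclically ordered sets.** All cyclic orders are total cyclic orders on finite sets. A total cyclic order on a finite set $C$ may be given by a linear order on $C$, two linear orders representing the same cyclic order iff they differ by a cyclic rotation. The empty set has a unique cyclic order. Isomorphisms are bijections preserving the cyclic order; $\mathrm{Cyc}$ is the category of cyclically ordered finite sets and isomorphisms. *Merging.* If $C',C''$ are disjoint cyclically ordered sets, $u\in C'$, $v\in C''$, with cyclic orders represented by $a_1<\dots<a_k<u$ and $v<b_1<\dots<b_l$, then $(C'\cup C'')\setminus\{u,v\}$ has the cyclic order represented by $a_1<\dots<a_k<b_1<\dots<b_l$ ($k=l=0$ allowed). **Multicyclically ordered sets.** A multicyclic order on a finite set $S$ is a disjoint decomposition $\mathsf S=C_1\cup\dots\cup C_b$ of $S$ into $b>0$ possibly empty cyclically ordered sets (the order of listing of the components is immaterial). An isomorphism $\mathsf S'\to\mathsf S''$ is a pair consisting of a bijection $\sigma$ of underlying sets and a bijection $u$ of the sets indexing the components such that $\sigma$ restricts to isomorphisms of cyclically ordered sets $C'_i\to C''_{u(i)}$. $\mathrm{MultCyc}$ is the category of multicyclically ordered sets and their isomorphisms. $\mathrm{Cyc}\subset\mathrm{MultCyc}$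 as the objects with $b=1$. - For $\mathsf S',\mathsf S''$ with disjoint underlying sets, $u\in C'_i$, $v\in C''_j$: $\mathsf S'\cup\mathsf S''\setminus\{u,v\}$ has as components all components of $\mathsf S'$ and $\mathsf S''$ other than $C'_i,C''_j$, together with the merged component $(C'_i\cup C''_j)\setminus\{u,v\}$. - For distinct $u\in C_i$, $v\in C_j$ in the same $\mathsf S$: if $i\ne j$, $\mathsf S\setminus\{u,v\}$ is obtained by replacing $C_i,C_j$ by the merged component $(C_i\cup C_j)\setminus\{u,v\}$. If $i=j$, it is obtained by replacing $C_i$ by the two components $I_1,I_2$, the (possibly empty) open intervals of $C_i$ between $u$ and $v$ and between $v$ and $u$, with induced cyclic orders. A pair $(\mathsf S,g)$ with $\mathsf S=C_1\cup\dots\cup C_b$, $g\in\mathbb N$, is *geometric* if $\tfrac12(g-b+1)\in\mathbb N$. **Non-$\Sigma$ modular operads.** A non-$\Sigma$ modular module is a functor $\mathrm{MultCyc}\times\mathbb N\to\mathtt M$ ($\mathbb N$ discrete). A non-$\Sigma$ modular operad is a non-$\Sigma$ modular module $\underline P$, $(\mathsf S,g)\mapsto\underline P(\mathsf S;g)$, with compositions $${}_u\circ_v:\underline P(\mathsf S';g')\otimes\underline P(\mathsf S'';g'')\to\underline P(\mathsf S'\cup\mathsf S''\setminus\{u,v\};g'+g'')$$ for disjoint $\mathsf S',\mathsf S''$, $u\in S'$, $v\in S''$, and contractions $$\xi_{uv}=\xi_{vu}:\underline P(\mathsf S;g)\to\underline P(\mathsf S\setminus\{u,v\};g+1)$$ for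 distinct $u,v\in S$, satisfying: (i) ${}_u\circ_v={}_v\circ_u\,\tau$. (ii) ${}_a\circ_b(\mathrm{id}\otimes{}_c\circ_d)={}_c\circ_d({}_a\circ_b\otimes\mathrm{id})$ on $\underline P(\mathsf S_1;g_1)\otimes\underline P(\mathsf S_2;g_2)\otimes\underline P(\mathsf S_3;g_3)$, for $\mathsf S_1,\mathsf S_2,\mathsf S_3$ mutually disjoint, $a\in S_1$, $b\neq c\in S_2$, $d\in S_3$. (iii) $\xi_{ab}\xi_{cd}=\xi_{cd}\xi_{ab}$ for mutually distinct $a,b,c,d\in S$. (iv) $\xi_{ab}\,{}_c\circ_d=\xi_{cd}\,{}_a\circ_b$ on $\underline P(\mathsf S';g')\otimes\underline P(\mathsf S'';g'')$, for distinct $a,c\in S'$ and distinct $b,d\in S''$. (v) ${}_a\circ_b(\xi_{cd}\otimes\mathrm{id})=\xi_{cd}\,{}_a\circ_b$ on $\underline P(\mathsf S';g')\otimes\underline P(\mathsf S'';g'')$, for mutually distinct $a,c,d\in S'$ and $b\in S''$. (vi) $\underline P(\rho|_{S'\setminus\{u\}}\cup\sigma|_{S''\setminus\{v\}})\,{}_u\circ_v={}_{\rho(u)}\circ_{\sigma(v)}(\underline P(\rho)\otimes\underline P(\sigma))$ for isomorphisms $\rho,\sigma$ out of $\mathsf S',\mathsf S''$ with disjoint targets. (vii) $\underline P(\rho|_{S\setminus\{u,v\}})\,\xi_{uv}=\xi_{\rho(u)\rho(v)}\,\underline P(\rho)$ for an isomorphism $\rho$ out of $\mathsf S$. Morphisms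 are natural transformations commuting with all ${}_u\circ_v$ and $\xi_{uv}$. All non-$\Sigma$ modular operads are assumed *geometric*: $\underline P(\mathsf S;g)\ne0$ implies $(\mathsf S,g)$ geometric. The terminal (geometric) non-$\Sigma$ modular operad $\underline *_M$ in $\mathrm{Set}$ has $\underline *_M(\mathsf S;g)$ a one-point set for every geometric $(\mathsf S,g)$ and $\emptyset$ otherwise. **Non-$\Sigma$ cyclic operads.** These are functors $\underline P:\mathrm{Cyc}\to\mathtt M$ with compositions ${}_u\circ_v:\underline P(C')\otimes\underline P(C'')\to\underline P((C'\cup C'')\setminus\{u,v\})$ (target with the merged cyclic order) for disjoint $C',C''$ and $u\in C'$, $v\in C''$, satisfying the analogs of (i), (ii) and (vi) (no genus, no contractions). The terminal one in $\mathrm{Set}$, $\underline *_C$, has $\underline *_C(C)$ a one-point set for every $C\in\mathrm{Cyc}$ (including $C=\emptyset$). **Non-$\Sigma$ modular envelope.** $\underline{\mathrm{Mod}}$ is the left adjoint of the forgetful functor $\underline\Box$ from (geometric) non-$\Sigma$ modular operads to non-$\Sigma$ cyclic operads (here in $\Bbbk$-modules), $(\underline\Box\,\underline P)(C)=\underline P(C;0)$ for $C\in\mathrm{Cyc}$, with the operations ${}_u\circ_v$. *)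

(* Defs.v *)
From HB Require Import structures.
From mathcomp Require Import all_boot all_order all_algebra.
From mathcomp Require Import boolp classical_sets functions cardinality fsbigop.
From mathcomp Require Import zify.

Set Implicit Arguments.
Unset Strict Implicit.
Unset Printing Implicit Defensive.

Import GRing.Theory.

(* A multicyclically ordered finite subset of the universe [K] of labels, with
   components indexed by [cpnt].  The duplicate-free sequence [cyc i] is one of
   the linear orders representing the cyclic order of the component [i]; two
   sequences represent the same cyclic order iff they differ by a rotation, and
   isomorphisms ([iso] below) only see sequences up to rotation. *)
Record mcyc (K : eqType) := MCyc {
  cpnt : finType;
  cyc : cpnt -> seq K;
  cpnt_gt0 : 0 < #|cpnt|;
  cyc_uniq : forall i, uniq (cyc i);
  cyc_disj : forall i j x, x \in cyc i -> x \in cyc j -> i = j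
}.

Section Mcyc.
Context (K : eqType).
Implicit Types S T : mcyc K.

Definition lab S : {pred K} := [pred x | [exists i : cpnt S, x \in cyc i]].

Definition mdisj S T := [forall i : cpnt S, ~~ has (mem (lab T)) (cyc i)].

(* (g - b + 1) / 2 is a natural number. *)
Definition geometric S (g : nat) := (#|cpnt S| <= g.+1) && ~~ odd (g.+1 - #|cpnt S|).

(* If [x, a_1, .., a_k] represents the cyclic order of the component of [x], this
   is [a_1, .., a_k]. *)
Definition after S (x : K) : seq K :=
  if [pick i : cpnt S | x \in cyc i] is Some i
  then behead (rot (index x (cyc i)) (cyc i)) else [::].

Lemma labP S x : reflect (exists i : cpnt S, x \in cyc i) (x \in lab S).
Proof. exact: existsP. Qed.

Lemma afterP S (i : cpnt S) x : x \in cyc i -> perm_eq (x :: after S x) (cyc i).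
Proof.
move=> xi; rewrite /after; case: pickP => [j xj|/(_ i)]; last by rewrite xi.
rewrite (cyc_disj xi xj) rot_index //=.
by rewrite -(rot_index xj) perm_rot.
Qed.

Lemma after_rot S (i : cpnt S) n x l : rot n (cyc i) = x :: l -> after S x = l.
Proof.
move=> E; have xi : x \in cyc i by rewrite -(mem_rot n) E mem_head.
rewrite /after; case: pickP => [j xj|/(_ i)]; last by rewrite xi.
have {j xj} <- := cyc_disj xi xj.
have [n_lt|n_ge] := ltnP n (size (cyc i)).
  have -> : index x (cyc i) = n; last by rewrite E.
  move: E; rewrite /rot (drop_nth x) //= => -[nx _].
  by rewrite -nx index_uniq // cyc_uniq.
by move: E; rewrite rot_oversize // => ->; rewrite /= eqxx rot0.
Qed.

Lemma after_notin S x : x \notin lab S -> after S x = [::].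
Proof.
move=> xS; rewrite /after; case: pickP => // i xi.
by case/labP: xS; exists i.
Qed.

Lemma after_cat S x y p q :
  after S x = p ++ y :: q -> after S y = q ++ x :: p.
Proof.
have [/labP[i xi]|/after_notin->] := boolP (x \in lab S); last by case: p.
have [n l E] := rot_to xi; rewrite (after_rot E) => lE; rewrite {}lE in E.
have : rot (size (x :: p)) (rot n (cyc i)) = y :: q ++ x :: p.
  by rewrite E -cat_cons rot_size_cat.
by rewrite rot_rot_add; apply: after_rot.
Qed.

Lemma mem_after S (i : cpnt S) x y :
  x \in cyc i -> (y \in after S x) = (y != x) && (y \in cyc i).
Proof.
move=> xi; have h := afterP xi; rewrite -(perm_mem h) inE.
have : uniq (x :: after S x) by rewrite (perm_uniq h) cyc_uniq.
by case/andP=> /negP nx _; case: eqP => //= ->; apply/negP.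
Qed.

Lemma after_uniq S x : uniq (after S x).
Proof.
have [/labP[i xi]|/after_notin->//] := boolP (x \in lab S).
by have := cyc_uniq i; rewrite -(perm_uniq (afterP xi)) => /andP[].
Qed.

Lemma after_sub S x y : y \in after S x -> exists2 i : cpnt S, x \in cyc i & y \in cyc i.
Proof.
have [/labP[i xi]|/after_notin->//] := boolP (x \in lab S).
by rewrite (mem_after _ xi) => /andP[_ yi]; exists i.
Qed.

(* What is read from [u] onwards after [u] and [v] have been glued together: the
   open interval from [u] to [v] if they lie in the same component, a sequence
   representing the merged component otherwise. *)
Definition walk S (u v : K) : seq K :=
  if v \in after S u then take (index v (after S u)) (after S u)
  else after S u ++ after S v.

Lemma mem_walk S u v x : x \in walk S u v ->
  exists i : cpnt S, (x \in cyc i) && ((u \in cyc i) || (v \in cyc i)).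
Proof.
rewrite /walk; case: ifP => _.
  by move=> /mem_take/after_sub[i ui xi]; exists i; rewrite ui xi.
rewrite mem_cat => /orP[]/after_sub[i ui xi]; exists i; rewrite ui xi //.
by rewrite orbT.
Qed.

Lemma walk_uniq S u v : u != v -> uniq (walk S u v).
Proof.
move=> uv; rewrite /walk; case: ifPn => [_|nv].
  exact/take_uniq/after_uniq.
rewrite cat_uniq !after_uniq andbT /=; apply/hasP => -[x xT xS].
have [i ui xi] := after_sub xS; have [j vj xj] := after_sub xT.
rewrite -(cyc_disj xi xj) in vj.
by rewrite (mem_after _ ui) vj (eq_sym v) uv in nv.
Qed.

Lemma walk_split S u v : v \in after S u ->
  [/\ u \in after S v & forall x, x \in walk S u v -> x \in walk S v u -> False].
Proof.
move=> vu; have uniqE := after_uniq S u.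
move E : (after S u) vu => l vu; case/splitPr: vu E => p q E.
have F := after_cat E; rewrite /walk E F !mem_cat !inE !eqxx !orbT /=.
have uniqF := after_uniq S v; rewrite F in uniqF; rewrite E in uniqE.
split=> // x.
have nv : v \notin p by move: uniqE; rewrite uniq_catC /= mem_cat => /andP[/norP[]].
have nu : u \notin q by move: uniqF; rewrite uniq_catC /= mem_cat => /andP[/norP[]].
rewrite !index_cat (negbTE nv) (negbTE nu) /= !eqxx !addn0 !take_size_cat //.
move: uniqE; rewrite cat_uniq /= => /and3P[_ /norP[_ /hasPn h] _] xp xq.
by move: (h _ xq); rewrite /= xp.
Qed.

(* A gap of a multicyclic order is an arc of one of its circles between two
   consecutive labels: [inr x] is the gap following the label [x], and [inl i],
   for an empty component [i], is the whole circle [i].  Gaps serve to identify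
   the components, including the empty ones, of the objects obtained by different
   sequences of operations. *)
Definition gap S : Type := (cpnt S + K)%type.

Definition is_gap S (p : gap S) : bool :=
  match p with inl i => nilp (cyc i) | inr x => x \in lab S end.

(* The gap preceding the head of [s], when [s] represents the component [i]. *)
Definition start_gap S (i : cpnt S) (s : seq K) : gap S :=
  if s is x :: s' then inr (last x s') else inl i.

Section Merge.
Context (S T : mcyc K) (d : mdisj S T) (u v : K).

(* [None] is the merged component. *)
Definition merge_index (c : option (cpnt S + cpnt T)) : bool :=
  match c with
  | Some (inl i) => u \notin cyc i
  | Some (inr j) => v \notin cyc j
  | None => true
  end.
Definition merge_cpnt : finType := {c | merge_index c}.

Definition merge_cyc (c : merge_cpnt) : seq K :=
  match val c with
  | Some (inl i) => cyc i
  | Some (inr j) => cyc j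
  | None => after S u ++ after T v
  end.

Lemma mdisjP i j x : x \in @cyc _ S i -> x \in @cyc _ T j -> False.
Proof.
move=> xi xj; move/forallP: d => /(_ i) /hasP; apply; exists x => //.
by apply/labP; exists j.
Qed.

Lemma merge_gt0 : 0 < #|merge_cpnt|.
Proof. by apply/card_gt0P; exists (exist _ None isT). Qed.

Lemma merge_uniq c : uniq (merge_cyc c).
Proof.
rewrite /merge_cyc; case: (val c) => [[i|j]|]; rewrite ?cyc_uniq //.
rewrite cat_uniq !after_uniq andbT /=; apply/hasP => -[x xT xS].
have [i _ xi] := after_sub xS; have [j _ xj] := after_sub xT.
exact: mdisjP xi xj.
Qed.

Lemma merge_disj c c' x : x \in merge_cyc c -> x \in merge_cyc c' -> c = c'.
Proof.
move=> xc xc'; apply: val_inj; move: xc xc'; rewrite /merge_cyc.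
case: c => [[[i|j]|] /= hc]; case: c' => [[[i'|j']|] /= hc'] => //.
- by move=> xi /(cyc_disj xi) ->.
- by move=> xi /(mdisjP xi).
- move=> xi; rewrite mem_cat => /orP[/after_sub[l ul xl]|/after_sub[l _ /(mdisjP xi)//]].
  by move: hc; rewrite (cyc_disj xi xl) ul.
- by move=> xi /mdisjP /(_ xi).
- by move=> xi /(cyc_disj xi) ->.
- move=> xi; rewrite mem_cat => /orP[/after_sub[l _ /mdisjP/(_ xi)//]|/after_sub[l ul xl]].
  by move: hc; rewrite (cyc_disj xi xl) ul.
- rewrite mem_cat => /orP[/after_sub[l ul xl]|/after_sub[l _ h]] xi.
    by move: hc'; rewrite (cyc_disj xi xl) ul.
  by case: (mdisjP xi h).
- rewrite mem_cat => /orP[/after_sub[l _ h]|/after_sub[l ul xl]] xi.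
    by case: (mdisjP h xi).
  by move: hc'; rewrite (cyc_disj xi xl) ul.
Qed.

Definition mcmerge : mcyc K := MCyc merge_gt0 merge_uniq merge_disj.

Definition merged : cpnt mcmerge := exist merge_index None isT.

(* The gaps following [u] and preceding [v] become one gap, and so do the gaps
   following [v] and preceding [u]. *)
Definition gapl (p : gap S) : gap mcmerge :=
  match p with
  | inl i => inl (insubd merged (Some (inl i)))
  | inr x => if x == u then start_gap merged (after S u ++ after T v) else inr x
  end.

Definition gapr (p : gap T) : gap mcmerge :=
  match p with
  | inl j => inl (insubd merged (Some (inr j)))
  | inr x => if x == v then start_gap merged (after T v ++ after S u) else inr x
  end.

End Merge.

Section Contract.
Context (S : mcyc K) (u v : K) (uv : u != v).

(* The new components are [inr false] and, if [u] and [v] lie in the same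
   component, [inr true]: the intervals following [u] and [v] respectively.  If
   they lie in different components, [inr false] is the merged component. *)
Definition contract_index (c : cpnt S + bool) : bool :=
  match c with
  | inl i => (u \notin cyc i) && (v \notin cyc i)
  | inr b => b ==> (v \in after S u)
  end.
Definition contract_cpnt : finType := {c | contract_index c}.

Definition contract_cyc (c : contract_cpnt) : seq K :=
  match val c with
  | inl i => cyc i
  | inr b => if b then walk S v u else walk S u v
  end.

Lemma contract_gt0 : 0 < #|contract_cpnt|.
Proof. by apply/card_gt0P; exists (exist _ (inr false) isT). Qed.

Lemma contract_uniq c : uniq (contract_cyc c).
Proof.
rewrite /contract_cyc; case: (val c) => [i|[]]; rewrite ?cyc_uniq //.
  by apply: walk_uniq; rewrite eq_sym.
exact: walk_uniq.
Qed.

Lemma contract_disj c c' x :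
  x \in contract_cyc c -> x \in contract_cyc c' -> c = c'.
Proof.
have W (b : bool) : x \in (if b then walk S v u else walk S u v) ->
    exists i : cpnt S, (x \in cyc i) && ((u \in cyc i) || (v \in cyc i)).
  by case: b => /mem_walk // [i h]; exists i; rewrite [_ || _]orbC.
move=> xc xc'; apply: val_inj; move: xc xc'; rewrite /contract_cyc.
case: c => [[i|b] /= hc]; case: c' => [[i'|b'] /= hc'].
- by move=> xi /(cyc_disj xi) ->.
- move=> xi /W[j /andP[xj]]; move: hc; rewrite (cyc_disj xi xj).
  by case/andP=> /negbTE-> /negbTE->.
- move=> /W[j /andP[xj]] + xi; move: hc'; rewrite (cyc_disj xi xj).
  by case/andP=> /negbTE-> /negbTE->.
case: b b' hc hc' => [] [] //= h1 h2.
  by move=> xvu xuv; have [_ /(_ x xuv xvu)] := walk_split h1.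
by move=> xuv xvu; have [_ /(_ x xuv xvu)] := walk_split h2.
Qed.

Definition mccontract : mcyc K := MCyc contract_gt0 contract_uniq contract_disj.

Definition contracted : cpnt mccontract := exist contract_index (inr false) isT.

Definition gapx (p : gap S) : gap mccontract :=
  match p with
  | inl i => inl (insubd contracted (inl i))
  | inr x =>
      if x == u then start_gap contracted (walk S u v)
      else if x == v then
        start_gap (insubd contracted (inr true) : cpnt mccontract) (walk S v u)
      else inr x
  end.

End Contract.

Lemma mem_cycE S (i j : cpnt S) x : x \in cyc i -> (x \in cyc j) = (j == i).
Proof.
by move=> xi; apply/idP/eqP => [xj|->//]; apply: cyc_disj xj xi.
Qed.

Lemma card_merge S T (d : mdisj S T) u v : u \in lab S -> v \in lab T ->
  #|cpnt (mcmerge d u v)|.+1 = #|cpnt S| + #|cpnt T|.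
Proof.
move=> /labP[i ui] /labP[j vj]; rewrite /= card_sig.
have := cardC (merge_index (S := S) (T := T) u v).
rewrite card_option card_sum.
rewrite (_ : #|[predC _]| = #|pred2 (Some (inl i)) (Some (inr j) : option (cpnt S + cpnt T))|).
  rewrite card2 addn2 => -[] [] //.
apply: eq_card => c; rewrite !inE /= /in_mem /=; case: c => [[i'|j']|] //=.
  by rewrite negbK (mem_cycE _ ui) orbF.
by rewrite negbK (mem_cycE _ vj).
Qed.

Lemma card_contract S u v (uv : u != v) : u \in lab S -> v \in lab S ->
  #|cpnt (mccontract S uv)| =
    if v \in after S u then #|cpnt S|.+1 else #|cpnt S|.-1.
Proof.
move=> /labP[i ui] /labP[j vj]; rewrite /= card_sig.
have := cardC (contract_index (S := S) u v).
rewrite card_sum card_bool (mem_after _ ui) (eq_sym v) uv /= (mem_cycE _ vj).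
have C (s : seq (cpnt S + bool)) : uniq s ->
    (forall c, (c \in s) = ~~ contract_index u v c) ->
    #|[predC contract_index (S := S) u v]| = size s.
  by move=> us h; rewrite -(card_uniqP us); apply: eq_card => c; rewrite h.
case: eqVneq => ij; [rewrite (C [:: inl i])|rewrite (C [:: inl i; inl j; inr true])] => //.
- by rewrite /= addn1 addn2 => -[].
- case=> [l|b]; rewrite !inE /=.
    by rewrite (mem_cycE _ ui) (mem_cycE _ vj) ij negb_and !negbK orbb.
  by rewrite (mem_after _ ui) (mem_cycE _ vj) ij eqxx (eq_sym v) uv implybT.
- by rewrite /= addn3 addn2 => -[<-].
- by rewrite /= !inE orbF andbT; apply: contraNneq ij => -[->].
- case=> [l|b]; rewrite !inE /=.
    by rewrite (mem_cycE _ ui) (mem_cycE _ vj) orbF negb_and !negbK.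
  by rewrite (mem_after _ ui) (mem_cycE _ vj) (negbTE ij) andbF implybF negbK; case: b.
Qed.

Lemma lab_merge S T (d : mdisj S T) u v x : u \in lab S -> v \in lab T ->
  (x \in lab (mcmerge d u v)) = (x != u) && (x \in lab S) || (x != v) && (x \in lab T).
Proof.
move=> /labP[i ui] /labP[j vj]; apply/labP/orP => [[[[[l|l]|] hl]]|].
- rewrite /= /merge_cyc /= => xl; left; rewrite (introT (labP _ _)) ?andbT; last by exists l.
  by apply: contraNneq hl => <-.
- rewrite /= /merge_cyc /= => xl; right; rewrite (introT (labP _ _)) ?andbT; last by exists l.
  by apply: contraNneq hl => <-.
- rewrite /= /merge_cyc /= mem_cat (mem_after _ ui) (mem_after _ vj) => /orP[]/andP[xu xl]; [left|right]; rewrite xu; apply/labP; [by exists i|by exists j].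
case=> /andP[xu /labP[l xl]].
  have [E|E] := eqVneq l i.
    by exists (merged d u v); rewrite /= /merge_cyc /= mem_cat (mem_after _ ui) xu -E xl.
  have h : merge_index u v (Some (inl l) : option (cpnt S + cpnt T)) by rewrite /= (mem_cycE _ ui).
  by exists (exist (fun c => is_true (merge_index u v c)) _ h).
have [E|E] := eqVneq l j.
  by exists (merged d u v); rewrite /= /merge_cyc /= mem_cat (mem_after _ vj) xu -E xl orbT.
have h : merge_index u v (Some (inr l) : option (cpnt S + cpnt T)) by rewrite /= (mem_cycE _ vj).
by exists (exist (fun c => is_true (merge_index u v c)) _ h).
Qed.

Lemma lab_contract S u v (uv : u != v) x : u \in lab S -> v \in lab S ->
  (x \in lab (mccontract S uv)) = [&& x != u, x != v & x \in lab S].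
Proof.
move=> /labP[i ui] /labP[j vj]; have vu : (v == u) = false by rewrite eq_sym (negbTE uv).
have nv y : y \in after S u = (y != u) && (y \in cyc i) by rewrite (mem_after _ ui).
have nu y : y \in after S v = (y != v) && (y \in cyc j) by rewrite (mem_after _ vj).
have [ij|ij] := boolP (v \in after S u).
  have Ei : i = j by move: ij; rewrite nv (mem_cycE _ vj) => /andP[_ /eqP].
  have [p [q E]] : exists p q, after S u = p ++ v :: q.
    by case/splitPr: ij => p q; exists p, q.
  have F := after_cat E.
  have uE := after_uniq S u; have uF := after_uniq S v; rewrite E in uE; rewrite F in uF.
  have vp : v \notin p by move: uE; rewrite uniq_catC /= mem_cat => /andP[/norP[]].
  have uq : u \notin q by move: uF; rewrite uniq_catC /= mem_cat => /andP[/norP[]].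
  have W1 : walk S u v = p by rewrite /walk ij E index_cat (negbTE vp) /= eqxx addn0 take_size_cat.
  have W2 : walk S v u = q.
    by rewrite /walk F mem_cat mem_head orbT index_cat (negbTE uq) /= eqxx addn0 take_size_cat.
  have M y : (y \in p) || (y \in q) = [&& y != u, y != v & y \in cyc i].
    have := nv y; rewrite E mem_cat inE => H; case: (eqVneq y v) H => [->|yv] /=; last first.
      by move=> ->.
    move=> _; rewrite andbF (negbTE vp) /=; apply/negP => vq.
    by move: uE; rewrite cat_uniq /= vq !andbF.
  apply/labP/and3P => [[[[l|b] hl]]|[xu xv /labP[l xl]]].
  - rewrite /= /contract_cyc /= => xl; case/andP: hl => ul vl; split; last by apply/labP; exists l.
      by apply: contraNneq ul => <-.
    by apply: contraNneq vl => <-.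
  - rewrite /= /contract_cyc /= W1 W2 => xl.
    have : (x \in p) || (x \in q) by case: (b) xl => ->; rewrite ?orbT.
    by rewrite M => /and3P[-> -> xi]; split=> //; apply/labP; exists i.
  have [El|El] := eqVneq l i.
    have := M x; rewrite xu xv -El xl => /orP[xp|xq].
      by exists (contracted S uv); rewrite /= /contract_cyc /= W1.
    have h : contract_index u v (inr true : cpnt S + bool) by [].
    by exists (exist (fun c => is_true (contract_index u v c)) _ h); rewrite /= /contract_cyc /= W2.
  have h : contract_index u v (inl l : cpnt S + bool).
    by rewrite /= (mem_cycE _ ui) (mem_cycE _ vj) -Ei El.
  by exists (exist (fun c => is_true (contract_index u v c)) _ h).
have W : walk S u v = after S u ++ after S v by rewrite /walk (negbTE ij).
have nij : j != i by move: ij; rewrite nv vu (mem_cycE _ vj) eq_sym.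
apply/labP/and3P => [[[[l|[]] hl]]|[xu xv /labP[l xl]]].
- rewrite /= /contract_cyc /= => xl; case/andP: hl => ul vl; split; last by apply/labP; exists l.
    by apply: contraNneq ul => <-.
  by apply: contraNneq vl => <-.
- by case/negP: ij; exact: hl.
- rewrite /= /contract_cyc /= W mem_cat nv nu => /orP[]/andP[xu xi].
    split=> //; last by apply/labP; exists i.
    by apply: contraNneq ij => E; rewrite nv vu -E xi.
  split=> //; last by apply/labP; exists j.
  by apply: contra nij => /eqP E; rewrite -(mem_cycE _ ui) -E.
have [El|El] := eqVneq l i.
  by exists (contracted S uv); rewrite /= /contract_cyc /= W mem_cat nv xu -El xl.
have [El'|El'] := eqVneq l j.
  by exists (contracted S uv); rewrite /= /contract_cyc /= W mem_cat nu xv -El' xl orbT.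
have h : contract_index u v (inl l : cpnt S + bool).
  by rewrite /= (mem_cycE _ ui) (mem_cycE _ vj) El.
by exists (exist (fun c => is_true (contract_index u v c)) _ h).
Qed.

Lemma geometric_merge S T (d : mdisj S T) u v g h : u \in lab S -> v \in lab T ->
  geometric S g -> geometric T h -> geometric (mcmerge d u v) (g + h).
Proof.
move=> uS vT; have := card_merge d uS vT; rewrite /geometric.
have := cpnt_gt0 S; have := cpnt_gt0 T.
lia.
Qed.

Lemma geometric_contract S u v (uv : u != v) g : u \in lab S -> v \in lab S ->
  geometric S g -> geometric (mccontract S uv) g.+1.
Proof.
move=> uS vS; have := card_contract uv uS vS; rewrite /geometric.
have := cpnt_gt0 S; case: ifP => _; lia.
Qed.

Definition is_rot (s t : seq K) : Prop := exists n, t = rot n s.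

(* [on_lab] is only relevant on [lab S] (see [iso_eq]); the two fields force it to
   restrict to a bijection from [lab S] onto [lab T], since the sequences are
   duplicate-free and disjoint. *)
Record iso S T := Iso {
  on_lab : K -> K;
  on_comp : cpnt S -> cpnt T;
  on_comp_bij : bijective on_comp;
  iso_rot : forall i, is_rot (map on_lab (cyc i)) (cyc (on_comp i))
}.

Definition iso_eq S T (r r' : iso S T) : Prop :=
  {in lab S, on_lab r =1 on_lab r'} /\ on_comp r =1 on_comp r'.

Lemma id_iso_rot S (i : cpnt S) : is_rot (map id (cyc i)) (cyc i).
Proof. by exists 0; rewrite map_id rot0. Qed.

Definition id_iso S : iso S S := Iso (Bijective (fun _ => erefl) (fun _ => erefl)) (@id_iso_rot S).

Lemma comp_iso_rot S T U (r' : iso T U) (r : iso S T) i :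
  is_rot (map (on_lab r' \o on_lab r) (cyc i)) (cyc (on_comp r' (on_comp r i))).
Proof.
have [n nE] := iso_rot r i; have [m mE] := iso_rot r' (on_comp r i).
by exists (rot_add (map (on_lab r' \o on_lab r) (cyc i)) n m);
  rewrite mE nE map_rot -rot_rot_add -map_comp.
Qed.

Definition comp_iso S T U (r' : iso T U) (r : iso S T) : iso S U :=
  Iso (bij_comp (on_comp_bij r') (on_comp_bij r)) (comp_iso_rot r' r).

Definition act_gap S T (r : iso S T) (p : gap S) : gap T :=
  match p with inl i => inl (on_comp r i) | inr x => inr (on_lab r x) end.

(* The two sides of each operad axiom live over objects [T] and [T'] which are the
   same multicyclically ordered set up to the names of the components.  They are
   identified along the isomorphism [r] compatible with the maps [t] and [t'] from
   the gaps of the inputs to those of [T] and [T'].  Every gap of [T] comes from a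
   gap of an input, and surviving labels are followed by the same gap, so that [r]
   is the identity on labels and is unique up to [iso_eq].  In the equivariance
   axioms [t'] is precomposed with the given isomorphisms of the inputs, and [r] is
   the isomorphism which they induce by restriction to the surviving labels. *)
Definition same_gaps S T T' (r : iso T T') (t : gap S -> gap T) (t' : gap S -> gap T') : Prop :=
  forall p, is_gap p -> act_gap r (t p) = t' p.

Lemma geometric_iso S T g h : iso S T -> g = h -> geometric S g -> geometric T h.
Proof. by move=> r <-; rewrite /geometric (bij_eq_card (on_comp_bij r)). Qed.

(* Cyclically ordered sets, as the multicyclically ordered sets with b = 1. *)
Record cycl := Cycl { cycl_mcyc :> mcyc K; cycl_comp : #|cpnt cycl_mcyc| == 1 }.

Lemma cmerge_cpnt (C D : cycl) (d : mdisj C D) u v :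
  u \in lab C -> v \in lab D -> #|cpnt (mcmerge d u v)| == 1.
Proof.
move=> uC vD; rewrite -eqSS (card_merge d uC vD).
by rewrite (eqP (cycl_comp C)) (eqP (cycl_comp D)).
Qed.

Definition cmerge (C D : cycl) (d : mdisj C D) u v
  (uC : u \in lab C) (vD : v \in lab D) : cycl := Cycl (cmerge_cpnt d uC vD).

(* [mact] makes [P] a functor on pairs (S, g), the set of genera being discrete.
   For modules, a map out of a tensor product is encoded as a bilinear map, so
   that the axioms below, which are equalities between such maps, make sense for
   sets and for modules alike. *)
Record modop_ops (P : mcyc K -> nat -> Type) := ModopOps {
  mact : forall S T g h, iso S T -> g = h -> P S g -> P T h;
  mcomp : forall S T (d : mdisj S T) u v, u \in lab S -> v \in lab T ->
    forall g h, P S g -> P T h -> P (mcmerge d u v) (g + h);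
  mxi : forall S u v (uv : u != v), u \in lab S -> v \in lab S ->
    forall g, P S g -> P (mccontract S uv) g.+1
}.

Record modop_axioms (P : mcyc K -> nat -> Type) (O : modop_ops P) : Prop := {
  mact_ext : forall S T g h (r r' : iso S T) (e e' : g = h) x,
    iso_eq r r' -> mact O r e x = mact O r' e' x;
  mact_id : forall S g (x : P S g), mact O (id_iso S) erefl x = x;
  mact_comp : forall S T U g h l (r : iso S T) (r' : iso T U)
      (e : g = h) (e' : h = l) x,
    mact O (comp_iso r' r) (etrans e e') x = mact O r' e' (mact O r e x);
  mcompC : forall S T (d : mdisj S T) (d' : mdisj T S) u v
      (uS : u \in lab S) (vT : v \in lab T) g h (x : P S g) (y : P T h)
      (r : iso (mcmerge d u v) (mcmerge d' v u)) (e : g + h = h + g),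
    same_gaps r (gapl d u v) (gapr d' v u) ->
    same_gaps r (gapr d u v) (gapl d' v u) ->
    mact O r e (mcomp O d uS vT x y) = mcomp O d' vT uS y x;
  mcompA : forall S1 S2 S3 (d12 : mdisj S1 S2) (d23 : mdisj S2 S3)
      (d13 : mdisj S1 S3) a b c d (aS : a \in lab S1) (bS : b \in lab S2)
      (cS : c \in lab S2) (dS : d \in lab S3),
    b != c ->
    forall (d1 : mdisj S1 (mcmerge d23 c d)) (d3 : mdisj (mcmerge d12 a b) S3)
      (bS' : b \in lab (mcmerge d23 c d)) (cS' : c \in lab (mcmerge d12 a b))
      g1 g2 g3 (x : P S1 g1) (y : P S2 g2) (z : P S3 g3)
      (r : iso (mcmerge d1 a b) (mcmerge d3 c d))
      (e : g1 + (g2 + g3) = g1 + g2 + g3),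
    same_gaps r (gapl d1 a b) (gapl d3 c d \o gapl d12 a b) ->
    same_gaps r (gapr d1 a b \o gapl d23 c d) (gapl d3 c d \o gapr d12 a b) ->
    same_gaps r (gapr d1 a b \o gapr d23 c d) (gapr d3 c d) ->
    mact O r e (mcomp O d1 aS bS' x (mcomp O d23 cS dS y z)) =
    mcomp O d3 cS' dS (mcomp O d12 aS bS x y) z;
  mxi_sym : forall S u v (uv : u != v) (vu : v != u)
      (uS : u \in lab S) (vS : v \in lab S) g (x : P S g)
      (r : iso (mccontract S uv) (mccontract S vu)),
    same_gaps r (gapx uv) (gapx vu) ->
    mact O r erefl (mxi O uv uS vS x) = mxi O vu vS uS x;
  mxiC : forall S a b c d (aS : a \in lab S) (bS : b \in lab S)
      (cS : c \in lab S) (dS : d \in lab S) (ab : a != b) (cd : c != d),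
    uniq [:: a; b; c; d] ->
    forall (aS' : a \in lab (mccontract S cd)) (bS' : b \in lab (mccontract S cd))
      (cS' : c \in lab (mccontract S ab)) (dS' : d \in lab (mccontract S ab))
      g (x : P S g)
      (r : iso (mccontract (mccontract S cd) ab) (mccontract (mccontract S ab) cd)),
    same_gaps r (gapx ab \o gapx cd) (gapx cd \o gapx ab) ->
    mact O r erefl (mxi O ab aS' bS' (mxi O cd cS dS x)) =
    mxi O cd cS' dS' (mxi O ab aS bS x);
  mxi_mcomp : forall S T (d : mdisj S T) a b c d'
      (aS : a \in lab S) (bT : b \in lab T)
      (cS : c \in lab S) (dT : d' \in lab T) (ab : a != b) (cd : c != d'),
    a != c -> b != d' ->
    forall (aM : a \in lab (mcmerge d c d')) (bM : b \in lab (mcmerge d c d'))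
      (cM : c \in lab (mcmerge d a b)) (dM : d' \in lab (mcmerge d a b))
      g h (x : P S g) (y : P T h)
      (r : iso (mccontract (mcmerge d c d') ab) (mccontract (mcmerge d a b) cd)),
    same_gaps r (gapx ab \o gapl d c d') (gapx cd \o gapl d a b) ->
    same_gaps r (gapx ab \o gapr d c d') (gapx cd \o gapr d a b) ->
    mact O r erefl (mxi O ab aM bM (mcomp O d cS dT x y)) =
    mxi O cd cM dM (mcomp O d aS bT x y);
  mcomp_mxi : forall S T (e : mdisj S T) a b c d (aS : a \in lab S)
      (bT : b \in lab T) (cS : c \in lab S) (dS : d \in lab S) (cd : c != d),
    a != c -> a != d ->
    forall (e' : mdisj (mccontract S cd) T) (aS' : a \in lab (mccontract S cd))
      (cM : c \in lab (mcmerge e a b)) (dM : d \in lab (mcmerge e a b))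
      g h (x : P S g) (y : P T h)
      (r : iso (mcmerge e' a b) (mccontract (mcmerge e a b) cd))
      (i : g.+1 + h = (g + h).+1),
    same_gaps r (gapl e' a b \o gapx cd) (gapx cd \o gapl e a b) ->
    same_gaps r (gapr e' a b) (gapx cd \o gapr e a b) ->
    mact O r i (mcomp O e' aS' bT (mxi O cd cS dS x) y) =
    mxi O cd cM dM (mcomp O e aS bT x y);
  mcomp_act : forall S T S' T' (d : mdisj S T) (d' : mdisj S' T')
      (r : iso S S') (s : iso T T') u v (uS : u \in lab S) (vT : v \in lab T)
      (uS' : on_lab r u \in lab S') (vT' : on_lab s v \in lab T')
      g h (x : P S g) (y : P T h)
      (t : iso (mcmerge d u v) (mcmerge d' (on_lab r u) (on_lab s v))),
    same_gaps t (gapl d u v) (gapl d' (on_lab r u) (on_lab s v) \o act_gap r) ->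
    same_gaps t (gapr d u v) (gapr d' (on_lab r u) (on_lab s v) \o act_gap s) ->
    mact O t erefl (mcomp O d uS vT x y) =
    mcomp O d' uS' vT' (mact O r erefl x) (mact O s erefl y);
  mxi_act : forall S S' (r : iso S S') u v (uv : u != v)
      (uv' : on_lab r u != on_lab r v) (uS : u \in lab S) (vS : v \in lab S)
      (uS' : on_lab r u \in lab S') (vS' : on_lab r v \in lab S')
      g (x : P S g) (t : iso (mccontract S uv) (mccontract S' uv')),
    same_gaps t (gapx uv) (gapx uv' \o act_gap r) ->
    mact O t erefl (mxi O uv uS vS x) = mxi O uv' uS' vS' (mact O r erefl x)
}.

Record modop := Modop {
  mcar : mcyc K -> nat -> Type;
  mop :> modop_ops mcar;
  modop_ax : modop_axioms mop;
  mgeom : forall S g, mcar S g -> geometric S g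
}.

Record cycop_ops (P : cycl -> Type) := CycopOps {
  cact : forall C D : cycl, iso C D -> P C -> P D;
  ccomp : forall (C D : cycl) (d : mdisj C D) u v
    (uC : u \in lab C) (vD : v \in lab D), P C -> P D -> P (cmerge d uC vD)
}.

Record cycop_axioms (P : cycl -> Type) (O : cycop_ops P) : Prop := {
  cact_ext : forall (C D : cycl) (r r' : iso C D) x,
    iso_eq r r' -> cact O r x = cact O r' x;
  cact_id : forall (C : cycl) (x : P C), cact O (id_iso C) x = x;
  cact_comp : forall (C D E : cycl) (r : iso C D) (r' : iso D E) x,
    cact O (comp_iso r' r : iso C E) x = cact O r' (cact O r x);
  ccompC : forall (C D : cycl) (d : mdisj C D) (d' : mdisj D C) u v
      (uC : u \in lab C) (vD : v \in lab D) (x : P C) (y : P D)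
      (r : iso (cmerge d uC vD) (cmerge d' vD uC)),
    same_gaps r (gapl d u v) (gapr d' v u) ->
    same_gaps r (gapr d u v) (gapl d' v u) ->
    cact O r (ccomp O d uC vD x y) = ccomp O d' vD uC y x;
  ccompA : forall (S1 S2 S3 : cycl) (d12 : mdisj S1 S2) (d23 : mdisj S2 S3)
      (d13 : mdisj S1 S3) a b c d (aS : a \in lab S1) (bS : b \in lab S2)
      (cS : c \in lab S2) (dS : d \in lab S3),
    b != c ->
    forall (d1 : mdisj S1 (cmerge d23 cS dS)) (d3 : mdisj (cmerge d12 aS bS) S3)
      (bS' : b \in lab (cmerge d23 cS dS)) (cS' : c \in lab (cmerge d12 aS bS))
      (x : P S1) (y : P S2) (z : P S3)
      (r : iso (cmerge d1 aS bS') (cmerge d3 cS' dS)),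
    same_gaps r (gapl d1 a b) (gapl d3 c d \o gapl d12 a b) ->
    same_gaps r (gapr d1 a b \o gapl d23 c d) (gapl d3 c d \o gapr d12 a b) ->
    same_gaps r (gapr d1 a b \o gapr d23 c d) (gapr d3 c d) ->
    cact O r (ccomp O d1 aS bS' x (ccomp O d23 cS dS y z)) =
    ccomp O d3 cS' dS (ccomp O d12 aS bS x y) z;
  ccomp_act : forall (C D C' D' : cycl) (d : mdisj C D) (d' : mdisj C' D')
      (r : iso C C') (s : iso D D') u v (uC : u \in lab C) (vD : v \in lab D)
      (uC' : on_lab r u \in lab C') (vD' : on_lab s v \in lab D')
      (x : P C) (y : P D) (t : iso (cmerge d uC vD) (cmerge d' uC' vD')),
    same_gaps t (gapl d u v) (gapl d' (on_lab r u) (on_lab s v) \o act_gap r) ->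
    same_gaps t (gapr d u v) (gapr d' (on_lab r u) (on_lab s v) \o act_gap s) ->
    cact O t (ccomp O d uC vD x y) =
    ccomp O d' uC' vD' (cact O r x) (cact O s y)
}.

Record cycop := Cycop {
  ccar : cycl -> Type;
  cop :> cycop_ops ccar;
  cycop_ax : cycop_axioms cop
}.

Lemma unit_sig_eq (b : bool) (x y : {_ : unit | b}) : x = y.
Proof. by apply: val_inj; case: (val x); case: (val y). Qed.

(* One point if (S, g) is geometric, empty otherwise. *)
Definition term_car S g := {_ : unit | geometric S g}.

Definition term_ops : modop_ops term_car := {|
  mact S T g h r e x := exist _ tt (geometric_iso r e (svalP x));
  mcomp S T d u v uS vT g h x y :=
    exist _ tt (geometric_merge d uS vT (svalP x) (svalP y));
  mxi S u v uv uS vS g x := exist _ tt (geometric_contract uv uS vS (svalP x))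
|}.

Lemma term_axioms : modop_axioms term_ops.
Proof. by split=> *; apply: unit_sig_eq. Qed.

Definition term_mod : modop := Modop term_axioms (fun S g x => svalP x).

Definition cterm_ops : cycop_ops (fun=> unit) :=
  {| cact C D r x := tt; ccomp C D d u v uC vD x y := tt |}.

Lemma cterm_axioms : cycop_axioms cterm_ops.
Proof.
have U (a b : unit) : a = b by case: a b => -[].
by split=> *; apply: U.
Qed.

Definition term_cyc : cycop := Cycop cterm_axioms.

End Mcyc.

Local Open Scope ring_scope.
Local Open Scope classical_set_scope.

(* The free module on [X], realized as finitely supported functions. *)
Section FreeModule.
Context (k : comPzRingType) (X : Type).

Definition fin_supp : {pred ({classic X} -> k^o)} :=
  fun f => `[< finite_set [set x | f x != 0] >].

Lemma fin_supp_submod : submod_closed fin_supp.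
Proof.
split; first by apply/asboolP; rewrite (_ : [set _ | _] = set0) //;
  apply/seteqP; split=> x //=; rewrite eqxx.
move=> a f g /asboolP hf /asboolP hg; apply/asboolP.
apply: (@sub_finite_set _ _ ([set x | f x != 0] `|` [set x | g x != 0])).
  move=> x /=; case: (eqVneq (f x) 0) => [f0 h|]; [right|by left].
  by apply: contraNneq h => g0; apply/eqP; rewrite -[LHS]/(a * f x + g x) f0 g0 mulr0 addr0.
by rewrite finite_setU.
Qed.
HB.instance Definition _ :=
  GRing.isSubmodClosed.Build k ({classic X} -> k^o) fin_supp fin_supp_submod.

Record freemod := FreeMod { coef : {classic X} -> k^o; coef_fin : coef \in fin_supp }.
HB.instance Definition _ := [isSub for coef].
HB.instance Definition _ := gen_eqMixin freemod.
HB.instance Definition _ := gen_choiceMixin freemod.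
HB.instance Definition _ := [SubChoice_isSubLmodule of freemod by <:].

Lemma fbasis_subproof (x : X) :
  (fun y : {classic X} => (y == x :> {classic X})%:R : k^o) \in fin_supp.
Proof.
apply/asboolP; apply: (@sub_finite_set _ _ [set (x : {classic X})]) => //.
by move=> y /=; case: (eqVneq y (x : {classic X})) => // _; rewrite mulr0n eqxx.
Qed.
Definition fbasis (x : X) : freemod := FreeMod (fbasis_subproof x).

Definition flift (V : lmodType k) (f : X -> V) (s : freemod) : V :=
  \sum_(x \in [set: {classic X}]) coef s x *: f x.

Lemma fliftE V f s (r : seq {classic X}) : uniq r ->
  (forall x, coef s x != 0 -> x \in r) -> @flift V f s = \sum_(x <- r) coef s x *: f x.
Proof.
move=> ur h; rewrite /flift (fsbigE r) //.
  by rewrite big_mkcond /=; apply: eq_bigr => x _; rewrite in_setT.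
move=> x _ xr; case: (eqVneq (coef s x) 0) => [->|/h]; first by rewrite scale0r.
by rewrite (negbTE xr).
Qed.

Lemma fin_suppP (s : freemod) : exists2 r : seq {classic X}, uniq r &
   forall x, (coef s x != 0) -> x \in r.
Proof.
case: s => f /= /asboolP /finite_seqP [r hr]; exists (undup r); rewrite ?undup_uniq//.
by move=> x hx; rewrite mem_undup; have : [set x | f x != 0] x by []; rewrite hr.
Qed.

Lemma flift_lincomb (V : lmodType k) f a (s t u : freemod) :
    (forall x, coef u x = a * coef s x + coef t x) ->
  @flift V f u = a *: flift f s + flift f t.
Proof.
move=> uE; have [r ur hr] := fin_suppP s; have [q uq hq] := fin_suppP t.
pose w := undup (r ++ q).
have uw : uniq w by rewrite undup_uniq.
have h1 : forall x, coef s x != 0 -> x \in w.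
  by move=> x /hr; rewrite mem_undup mem_cat => ->.
have h2 : forall x, coef t x != 0 -> x \in w.
  by move=> x /hq; rewrite mem_undup mem_cat orbC => ->.
have h3 : forall x, coef u x != 0 -> x \in w.
  move=> x; rewrite uE; case: (eqVneq (coef s x) 0) => [->|/h1 //].
  by rewrite mulr0 add0r => /h2.
rewrite (fliftE _ uw h1) (fliftE _ uw h2) (fliftE _ uw h3).
rewrite scaler_sumr -big_split /=; apply: eq_bigr => x _.
by rewrite uE scalerDl scalerA.
Qed.

Lemma flift_linear (V : lmodType k) f : linear (@flift V f).
Proof. by move=> a s t; apply: flift_lincomb. Qed.

Lemma flift_basis (V : lmodType k) f x : @flift V f (fbasis x) = f x.
Proof.
rewrite (@fliftE _ _ _ [:: (x : {classic X})]) //=.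
  by rewrite big_seq1 eqxx scale1r.
move=> y; rewrite inE; case: (eqVneq y (x : {classic X})) => // _.
by rewrite mulr0n eqxx.
Qed.

Lemma freemod_ext (V : lmodType k) (f g : freemod -> V) : linear f -> linear g ->
  (forall x, f (fbasis x) = g (fbasis x)) -> f =1 g.
Proof.
move=> lf lg fg s; have [r ur hr] := fin_suppP s.
have sE : s = \sum_(x <- r) coef s x *: fbasis x.
  apply/val_inj/funext => y.
  have -> : val (\sum_(x <- r) coef s x *: fbasis x) y
            = \sum_(x <- r) coef s x * (y == x)%:R.
    by elim/big_rec2: _ => // x u v _ <-.
  have [yr|yr] := boolP (y \in r).
    rewrite (bigD1_seq y) //= eqxx mulr1 big1 ?addr0 // => x.
    by rewrite eq_sym => /negbTE ->; rewrite mulr0.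
  rewrite big_seq big1; last first.
    move=> x xr; case: eqVneq => [E|]; last by rewrite mulr0.
    by rewrite E xr in yr.
  by apply/eqP; apply: contraNT yr => /hr.
have f0 (h : freemod -> V) : linear h -> h 0 = 0.
  move=> lh; have := lh (-1) 0 0; rewrite scaler0 addr0 scaleN1r.
  by rewrite addNr.
rewrite {}sE; elim: {hr ur} r => [|x r IH]; first by rewrite !big_nil !f0.
by rewrite !big_cons lf lg fg IH.
Qed.
End FreeModule.


Section Linear.
Context (k : comPzRingType) (K : eqType).

Record lmodop := Lmodop {
  lmcar : mcyc K -> nat -> lmodType k;
  lmop :> modop_ops (fun S g => lmcar S g : Type);
  lmodop_ax : modop_axioms lmop;
  lmact_lin : forall S T g h (r : iso S T) (e : g = h),
    linear (mact lmop r e : lmcar S g -> lmcar T h);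
  lmcomp_linl : forall S T (d : mdisj S T) u v (uS : u \in lab S)
      (vT : v \in lab T) g h (y : lmcar T h),
    linear (fun x : lmcar S g =>
      mcomp lmop d uS vT x y : lmcar (mcmerge d u v) (g + h)%N);
  lmcomp_linr : forall S T (d : mdisj S T) u v (uS : u \in lab S)
      (vT : v \in lab T) g h (x : lmcar S g),
    linear (fun y : lmcar T h =>
      mcomp lmop d uS vT x y : lmcar (mcmerge d u v) (g + h)%N);
  lmxi_lin : forall S u v (uv : u != v) (uS : u \in lab S) (vS : v \in lab S) g,
    linear (@mxi _ _ lmop S u v uv uS vS g : lmcar S g -> lmcar (mccontract S uv) g.+1);
  lmgeom : forall S g (x : lmcar S g), x != 0 -> geometric S g
}.

Record lcycop := Lcycop {
  lccar : cycl K -> lmodType k;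
  lcop :> cycop_ops (fun C => lccar C : Type);
  lcycop_ax : cycop_axioms lcop;
  lcact_lin : forall (C D : cycl K) (r : iso C D),
    linear (cact lcop r : lccar C -> lccar D);
  lccomp_linl : forall (C D : cycl K) (d : mdisj C D) u v (uC : u \in lab C)
      (vD : v \in lab D) (y : lccar D),
    linear (fun x : lccar C => ccomp lcop d uC vD x y : lccar (cmerge d uC vD));
  lccomp_linr : forall (C D : cycl K) (d : mdisj C D) u v (uC : u \in lab C)
      (vD : v \in lab D) (x : lccar C),
    linear (fun y : lccar D => ccomp lcop d uC vD x y : lccar (cmerge d uC vD))
}.

Record mod_mor (P Q : lmodop) := ModMor {
  mfun :> forall S g, {linear lmcar P S g -> lmcar Q S g};
  mfun_act : forall S T g h (r : iso S T) (e : g = h) x,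
    mfun T h (mact P r e x) = mact Q r e (mfun S g x);
  mfun_comp : forall S T (d : mdisj S T) u v (uS : u \in lab S)
      (vT : v \in lab T) g h x y,
    mfun _ _ (mcomp P d uS vT x y) =
    mcomp Q d uS vT (mfun S g x) (mfun T h y);
  mfun_xi : forall S u v (uv : u != v) (uS : u \in lab S) (vS : v \in lab S) g x,
    mfun _ _ (mxi P uv uS vS x) = mxi Q uv uS vS (mfun S g x)
}.

Record cyc_mor (P Q : lcycop) := CycMor {
  cfun :> forall C, {linear lccar P C -> lccar Q C};
  cfun_act : forall (C D : cycl K) (r : iso C D) x,
    cfun D (cact P r x) = cact Q r (cfun C x);
  cfun_comp : forall (C D : cycl K) (d : mdisj C D) u v (uC : u \in lab C)
      (vD : v \in lab D) x y,
    cfun _ (ccomp P d uC vD x y) = ccomp Q d uC vD (cfun C x) (cfun D y)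
}.

Definition mod_iso (P Q : lmodop) : Prop :=
  exists F : mod_mor P Q, forall S g, bijective (F S g).

Section Box.
Context (P : lmodop).

Definition box_ops : cycop_ops (fun C : cycl K => lmcar P C 0%N : Type) := {|
  cact C D r := mact P r erefl;
  ccomp C D d u v uC vD x y := mcomp P d uC vD x y
|}.

Lemma box_axioms : cycop_axioms box_ops.
Proof.
have A := lmodop_ax P; split=> /=.
- by move=> *; apply: (mact_ext A).
- by move=> *; apply: (mact_id A).
- by move=> C D E r r' x; rewrite -(mact_comp A).
- move=> C D d d' u v uC vD x y r.
  exact: (@mcompC _ _ _ A C D d d' u v uC vD 0%N 0%N x y r erefl).
- move=> S1 S2 S3 d12 d23 d13 a b c d aS bS cS dS bc d1 d3 bS' cS' x y z r.
  exact: (@mcompA _ _ _ A S1 S2 S3 d12 d23 d13 a b c d aS bS cS dS bc d1 d3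
           bS' cS' 0%N 0%N 0%N x y z r erefl).
- move=> C D C' D' d d' r s u v uC vD uC' vD' x y t.
  exact: (@mcomp_act _ _ _ A C D C' D' d d' r s u v uC vD uC' vD' 0%N 0%N).
Qed.

Definition box : lcycop := {|
  lccar C := lmcar P C 0%N;
  lcop := box_ops;
  lcycop_ax := box_axioms;
  lcact_lin C D r := @lmact_lin P C D 0%N 0%N r erefl;
  lccomp_linl C D d u v uC vD := @lmcomp_linl P C D d u v uC vD 0%N 0%N;
  lccomp_linr C D d u v uC vD := @lmcomp_linr P C D d u v uC vD 0%N 0%N
|}.

End Box.

(* [eta] is a universal arrow from [A] to the forgetful functor [box]: [E], with
   unit [eta], is the value at [A] of the left adjoint of [box]. *)
Definition is_mod_envelope (A : lcycop) (E : lmodop) (eta : cyc_mor A (box E)) : Prop :=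
  forall (Q : lmodop) (f : cyc_mor A (box Q)),
    (exists F : mod_mor E Q,
       forall (C : cycl K) (x : lccar A C), F C 0%N (eta C x) = f C x) /\
    (forall F G : mod_mor E Q,
       (forall (C : cycl K) (x : lccar A C), F C 0%N (eta C x) = f C x) ->
       (forall (C : cycl K) (x : lccar A C), G C 0%N (eta C x) = f C x) ->
       forall S g x, F S g x = G S g x).

Lemma linear_comp_fun (U V W : lmodType k) (f : V -> W) (g : U -> V) :
  linear f -> linear g -> linear (fun x => f (g x)).
Proof. by move=> lf lg a x y; rewrite lg lf. Qed.

Section SpanBilinear.
Context (X Y Z : Type) (m : X -> Y -> Z).

Definition span2 (s : freemod k X) (t : freemod k Y) : freemod k Z :=
  flift (fun x => flift (fun y => fbasis k (m x y)) t) s.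

Lemma span2_linl t : linear (fun s => span2 s t).
Proof. exact: flift_linear. Qed.

Lemma span2_linr s : linear (span2 s).
Proof.
move=> a t t'; rewrite /span2; have [r ur hr] := fin_suppP s.
rewrite !(fliftE _ ur hr) scaler_sumr -big_split /=; apply: eq_bigr => x _.
by rewrite flift_linear scalerDr !scalerA mulrC.
Qed.

Lemma span2_basis x y : span2 (fbasis k x) (fbasis k y) = fbasis k (m x y).
Proof. by rewrite /span2 !flift_basis. Qed.

End SpanBilinear.

Lemma freemod_ext2 X Y (V : lmodType k) (f g : freemod k X -> freemod k Y -> V) :
  (forall t, linear (f^~ t)) -> (forall s, linear (f s)) ->
  (forall t, linear (g^~ t)) -> (forall s, linear (g s)) ->
  (forall x y, f (fbasis k x) (fbasis k y) = g (fbasis k x) (fbasis k y)) ->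
  forall s t, f s t = g s t.
Proof.
move=> fl fr gl gr fg s t; apply: (freemod_ext (fl t) (gl t)) => x.
exact: (freemod_ext (fr _) (gr _)).
Qed.

Definition span1 X Y (m : X -> Y) : freemod k X -> freemod k Y :=
  flift (fun x => fbasis k (m x)).

Lemma span1_lin X Y (m : X -> Y) : linear (span1 m).
Proof. exact: flift_linear. Qed.

Lemma span1_basis X Y (m : X -> Y) x : span1 m (fbasis k x) = fbasis k (m x).
Proof. by rewrite /span1 flift_basis. Qed.

Lemma span1_eq X Y (m m' : X -> Y) s : m =1 m' -> span1 m s = span1 m' s.
Proof. by move=> E; apply: freemod_ext s => [||x]; rewrite ?span1_basis ?E //; apply: span1_lin. Qed.

Lemma span1_id X (m : X -> X) s : m =1 id -> span1 m s = s.
Proof.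
move=> E; apply: (@freemod_ext _ _ _ _ id) => [||x]; rewrite ?span1_basis ?E //.
exact: span1_lin.
Qed.

Lemma span1_comp X Y Z (m : X -> Y) (n : Y -> Z) s :
  span1 n (span1 m s) = span1 (n \o m) s.
Proof.
apply: (freemod_ext (f := fun s => span1 n (span1 m s))) => [||x].
- by apply: linear_comp_fun; apply: span1_lin.
- exact: span1_lin.
- by rewrite !span1_basis.
Qed.

Lemma span12 X Y Z W (m : X -> Y -> Z) (n : Z -> W) s t :
  span1 n (span2 m s t) = span2 (fun x y => n (m x y)) s t.
Proof.
apply: (freemod_ext2 (f := fun s t => span1 n (span2 m s t))) => [{}t|{}s|||x y].
- by apply: linear_comp_fun; [apply: span1_lin|apply: span2_linl].
- by apply: linear_comp_fun; [apply: span1_lin|apply: span2_linr].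
- exact: span2_linl.
- exact: span2_linr.
- by rewrite !(span2_basis, span1_basis).
Qed.

Lemma span21 X X' Y Y' Z (m : X' -> Y' -> Z) (p : X -> X') (q : Y -> Y') s t :
  span2 m (span1 p s) (span1 q t) = span2 (fun x y => m (p x) (q y)) s t.
Proof.
apply: (freemod_ext2 (f := fun s t => span2 m (span1 p s) (span1 q t))) => [{}t|{}s|||x y].
- apply: (linear_comp_fun (f := fun s => span2 m s _)); [apply: span2_linl|apply: span1_lin].
- by apply: linear_comp_fun; [apply: span2_linr|apply: span1_lin].
- exact: span2_linl.
- exact: span2_linr.
- by rewrite !(span2_basis, span1_basis).
Qed.

Lemma span21l X X' Y Z (m : X' -> Y -> Z) (p : X -> X') s t :
  span2 m (span1 p s) t = span2 (fun x y => m (p x) y) s t.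
Proof. by rewrite -[t in LHS](@span1_id _ id) // span21. Qed.

Lemma span2_eq X Y Z (m m' : X -> Y -> Z) s t :
  (forall x y, m x y = m' x y) -> span2 m s t = span2 m' s t.
Proof.
move=> E; apply: freemod_ext2 => *; rewrite ?span2_basis ?E //.
all: by [apply: span2_linl|apply: span2_linr].
Qed.

Lemma span2C X Y Z (m : X -> Y -> Z) (n : Y -> X -> Z) s t :
  (forall x y, m x y = n y x) -> span2 m s t = span2 n t s.
Proof.
move=> E; apply: (freemod_ext2 (g := fun s t => span2 n t s)) => *; rewrite ?span2_basis ?E //.
all: by [apply: span2_linl|apply: span2_linr].
Qed.

Lemma span2A X Y Z XY YZ W (m : X -> YZ -> W) (n : Y -> Z -> YZ)
    (p : XY -> Z -> W) (q : X -> Y -> XY) s t w :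
  (forall x y z, m x (n y z) = p (q x y) z) ->
  span2 m s (span2 n t w) = span2 p (span2 q s t) w.
Proof.
move=> E; apply: (freemod_ext2 (f := fun s t => span2 m s (span2 n t w))
                            (g := fun s t => span2 p (span2 q s t) w)) => [{}t|{}s|{}t|{}s|x y].
- exact: span2_linl.
- apply: linear_comp_fun; [exact: span2_linr|exact: span2_linl].
- apply: (linear_comp_fun (f := fun s => span2 p s _)); [exact: span2_linl|exact: span2_linl].
- apply: (linear_comp_fun (f := fun s => span2 p s _)); [exact: span2_linl|exact: span2_linr].
rewrite span2_basis; apply: (freemod_ext (f := fun w => span2 m _ (span2 n _ w))) => [||z].
- apply: linear_comp_fun; exact: span2_linr.
- exact: span2_linr.
- by rewrite !span2_basis E.
Qed.

Section SpanMod.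
Context (P : modop K).

Definition span_mops : modop_ops (fun S g => freemod k (mcar P S g)) := {|
  mact S T g h r e := span1 (mact P r e);
  mcomp S T d u v uS vT g h := span2 (@mcomp _ _ P S T d u v uS vT g h);
  mxi S u v uv uS vS g := span1 (@mxi _ _ P S u v uv uS vS g)
|}.

Lemma span_mod_axioms : modop_axioms span_mops.
Proof.
have A := modop_ax P; split=> /=.
- by move=> *; apply: span1_eq => x; apply: (mact_ext A).
- by move=> *; apply: span1_id => x; apply: (mact_id A).
- by move=> *; rewrite span1_comp; apply: span1_eq => x; apply: (mact_comp A).
- by move=> *; rewrite span12; apply: span2C => x y; apply: (mcompC A).
- move=> S1 S2 S3 d12 d23 d13 a b c d aS bS cS dS bc d1 d3 bS' cS' g1 g2 g3 x y z r e h1 h2 h3.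
  rewrite span12; apply: span2A => {}x {}y {}z; exact: (mcompA A).
- by move=> *; rewrite span1_comp; apply: span1_eq => x; apply: (mxi_sym A).
- by move=> *; rewrite !span1_comp; apply: span1_eq => x; apply: (mxiC A).
- by move=> *; rewrite !span12; apply: span2_eq => x y; apply: (mxi_mcomp A).
- by move=> *; rewrite !span12 span21l; apply: span2_eq => x y; apply: (mcomp_mxi A).
- by move=> *; rewrite span12 span21; apply: span2_eq => x y; apply: (mcomp_act A).
- by move=> *; rewrite !span1_comp; apply: span1_eq => x; apply: (mxi_act A).
Qed.

Lemma span_mgeom S g (x : freemod k (mcar P S g)) : x != 0 -> geometric S g.
Proof.
apply: contraNT => ng; apply/eqP.
suff E : forall y : mcar P S g, fbasis k y = 0.
  apply: (@freemod_ext _ _ _ (fun x => x) (fun=> 0)) => // a y z.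
  by rewrite scaler0 addr0.
by move=> y; case/negP: ng; apply: mgeom y.
Qed.

Definition span_modop : lmodop := {|
  lmcar S g := freemod k (mcar P S g);
  lmop := span_mops;
  lmodop_ax := span_mod_axioms;
  lmact_lin S T g h r e := span1_lin _;
  lmcomp_linl S T d u v uS vT g h y := span2_linl _ y;
  lmcomp_linr S T d u v uS vT g h x := span2_linr _ x;
  lmxi_lin S u v uv uS vS g := span1_lin _;
  lmgeom := span_mgeom
|}.

End SpanMod.

Section SpanCyc.
Context (P : cycop K).

Definition span_cops : cycop_ops (fun C => freemod k (ccar P C)) := {|
  cact C D r := span1 (cact P r);
  ccomp C D d u v uC vD := span2 (ccomp P d uC vD)
|}.

Lemma span_cyc_axioms : cycop_axioms span_cops.
Proof.
have A := cycop_ax P; split=> /=.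
- by move=> *; apply: span1_eq => x; apply: (cact_ext A).
- by move=> *; apply: span1_id => x; apply: (cact_id A).
- by move=> *; rewrite span1_comp; apply: span1_eq => x; apply: (cact_comp A).
- by move=> *; rewrite span12; apply: span2C => x y; apply: (ccompC A).
- move=> S1 S2 S3 d12 d23 d13 a b c d aS bS cS dS bc d1 d3 bS' cS' x y z r h1 h2 h3.
  rewrite span12; apply: span2A => {}x {}y {}z; exact: (ccompA A).
- by move=> *; rewrite span12 span21; apply: span2_eq => x y; apply: (ccomp_act A).
Qed.

Definition span_cycop : lcycop := {|
  lccar C := freemod k (ccar P C);
  lcop := span_cops;
  lcycop_ax := span_cyc_axioms;
  lcact_lin C D r := span1_lin _;
  lccomp_linl C D d u v uC vD y := span2_linl _ y;
  lccomp_linr C D d u v uC vD x := span2_linr _ x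
|}.

End SpanCyc.

End Linear.

(* Main.v *)
Require Import Defs.
From HB Require Import structures.
From mathcomp Require Import all_boot all_order all_algebra fingroup perm.
From mathcomp Require Import boolp classical_sets functions cardinality.
From mathcomp Require Import zify.
Import GRing.Theory.

(** Think of a pair (S, g) as the type of a compact oriented surface whose boundary
    circles are the components of S, carrying the labels of S, and whose first Betti
    number is g.  The pair is geometric iff a connected surface of this type exists.
    A composition glues two surfaces, and a contraction glues a surface to itself,
    along boundary intervals marked by the two labels.

    A morphism from the span of the terminal cyclic operad to the genus zero part of
    an operad Q is a family of elements m C of Q, one for each disc C, which is
    stable under isomorphisms and compositions.  Call an element of Q good if it is
    obtained from the m C by contractions and isomorphisms.  The theorem amounts to
    three facts:
    - each geometric component of Q contains a good element ([good_exists]);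
    - it contains only one ([good_unique]);
    - good elements are stable under compositions ([good_comp]).
    Sending the generator of the geometric component (S, g) of the span of the
    terminal modular operad to the good element of Q is then a morphism, and the only
    one which extends the given family since these generators are themselves good
    ([good_pt]).  The rest is formal: two universal arrows are isomorphic.

    Existence and uniqueness are proved by induction on g.  A good element over
    (S, g + 1) is the value of a chord, an arc between two boundary points which does
    not disconnect the surface: cut along it, take the good element of the cut
    surface, and glue back by a contraction.  A chord always exists.  Two disjoint
    chords have the same value ([chord_indep]):
    - if cutting along both leaves the surface connected, because contractions
      commute ([disjoint_chords]);
    - if the surface is an annulus, because both chords cut it into two discs, and
      contraction commutes with composition ([annulus_chords]);
    - otherwise cutting along either of them leaves several boundary circles, and
      there is a third chord which joins different circles in both cut surfaces; by
      the first case it has the same value as each of the two.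

    The operad axioms are available only along isomorphisms which match the gaps of
    the objects, hence also their empty components.  To produce them, objects are
    presented by a permutation of a finite set of points, some of which carry
    the labels while the others are to be forgotten ([pres]).  A contraction multiplies
    the permutation by a transposition and forgets two labels ([pres_contract]),
    components are orbits ([pres_comp]), and objects with the same presentation are
    isomorphic compatibly with gaps ([pres_uniq]).  The isomorphisms required by
    the axioms then exist because disjoint transpositions commute. *)

Set Implicit Arguments.
Unset Strict Implicit.
Unset Printing Implicit Defensive.

(** * Gaps under contraction *)
Section Gaps.
Context (K : eqType).
Implicit Types S T : mcyc K.

(** The gap preceding a label, named, as every gap of a nonempty circle, by the
    label that it follows. *)
Definition pregap S (a : K) : gap S := inr (last a (after S a)).

Lemma pregap_cat S x y p q :
  after S x = p ++ y :: q -> pregap S y = inr (last x p).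
Proof. by move=> /after_cat E; rewrite /pregap E last_cat. Qed.

Lemma after_mid S (i : cpnt S) a p q : cyc i = p ++ a :: q -> after S a = q ++ p.
Proof.
move=> E; apply: (@after_rot _ _ i (size p)).
by rewrite E rot_size_cat.
Qed.

Lemma notin_after S x : x \notin after S x.
Proof.
have [/labP[i xi]|/after_notin->//] := boolP (x \in lab S).
by rewrite (mem_after _ xi) eqxx.
Qed.

Lemma neq_after S x y : y \in after S x -> y != x.
Proof. by apply: contraTneq => ->; apply: notin_after. Qed.

Lemma mem_lab S (i : cpnt S) x : x \in cyc i -> x \in lab S.
Proof. by move=> xi; apply/labP; exists i. Qed.

Lemma after_lab S x y : y \in after S x -> y \in lab S.
Proof. by case/after_sub => i _ /mem_lab. Qed.

Lemma after_last S (i : cpnt S) x : x \in cyc i -> last x (after S x) \in cyc i.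
Proof.
move=> xi; have := mem_last x (after S x).
by rewrite inE => /orP[/eqP->//|]; rewrite (mem_after _ xi) => /andP[].
Qed.

Lemma start_gap_last S (i : cpnt S) x s : s != [::] -> start_gap i s = inr (last x s).
Proof. by case: s. Qed.

Lemma is_start_gap S (i : cpnt S) s : perm_eq s (cyc i) -> is_gap (start_gap i s).
Proof.
case: s => [|x s] /= E; first by rewrite /nilp -(perm_size E).
by apply: (@mem_lab _ i); rewrite -(perm_mem E) mem_last.
Qed.

Section ContractGaps.
Context (S : mcyc K) (u v : K) (uv : u != v).
Hypotheses (uS : u \in lab S) (vS : v \in lab S).

(** The circles produced by a contraction, when the two labels share a circle and
    when they do not. *)
Lemma contract_cases :
  (exists p q, [/\ after S u = p ++ v :: q, after S v = q ++ u :: p,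
                   walk S u v = p, walk S v u = q & v \in after S u]) \/
  [/\ v \notin after S u, u \notin after S v,
      walk S u v = after S u ++ after S v & walk S v u = after S v ++ after S u].
Proof.
case: (boolP (v \in after S u)) => vu; [left|right].
  have [p [q E]] : exists p q, after S u = p ++ v :: q.
    by case/splitPr: vu => p q; exists p, q.
  have F := after_cat E; exists p, q; split=> //; rewrite /walk.
    rewrite E mem_cat mem_head orbT index_cat /= eqxx.
    have := after_uniq S u; rewrite E uniq_catC /= mem_cat => /andP[/norP[_ /negbTE->]] _.
    by rewrite addn0 take_size_cat.
  rewrite F mem_cat mem_head orbT index_cat /= eqxx.
  have := after_uniq S v; rewrite F uniq_catC /= mem_cat => /andP[/norP[_ /negbTE->]] _.
  by rewrite addn0 take_size_cat.
have uv' : u \notin after S v by apply: contra vu => /walk_split[].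
by rewrite /walk (negbTE vu) (negbTE uv').
Qed.

Local Notation C := (mccontract S uv).
Local Notation c0 := (contracted S uv).
Local Notation c1 := (insubd c0 (inr true) : cpnt C).
Local Notation gx := (@gapx K S u v uv).

Lemma gapx_other x : x != u -> x != v -> gx (inr x) = inr x.
Proof. by rewrite /gapx => /negbTE-> /negbTE->. Qed.

Lemma gapxu : gx (inr u) = start_gap c0 (walk S u v).
Proof. by rewrite /gapx eqxx. Qed.

Lemma gapxv : gx (inr v) = start_gap c1 (walk S v u).
Proof. by rewrite /gapx eqxx eq_sym (negbTE uv). Qed.

Lemma c1_in : v \in after S u -> val c1 = inr true.
Proof. by move=> h; rewrite val_insubd /= h. Qed.

Lemma c1_out : v \notin after S u -> c1 = c0.
Proof. by move=> h; apply: val_inj; rewrite val_insubd /= (negbTE h). Qed.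

Lemma cyc_c1 : v \in after S u -> cyc c1 = walk S v u.
Proof. by move=> /c1_in E; rewrite /= /contract_cyc E. Qed.

(** Contracting glues the end of the arc before [u] to the beginning of the arc
    after [v], whence this identification of gaps and the next one; [gapx_ker] says
    that there is no other. *)
Lemma gapx_pre_u : gx (pregap S u) = gx (inr v).
Proof.
rewrite gapxv; case: contract_cases => [[p [q [E F W1 W2 vu]]]|[vu uv' W1 W2]].
  rewrite /pregap W2 E last_cat; case: q E F W2 => [|y q] E F W2.
    by rewrite [last _ _]/= gapxv W2.
  have lq : last y q \in y :: q by apply: mem_last.
  rewrite [last _ _]/= gapx_other //.
    by apply: (@neq_after S); rewrite E mem_cat inE lq !orbT.
  by apply: (@neq_after S); rewrite F mem_cat lq.
rewrite W2 /pregap (c1_out vu); case E : (after S u) => [|y q].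
  by rewrite cats0 [last _ _]/= gapxu W1 E.
rewrite (start_gap_last _ v) ?last_cat; last by case: (after S v).
have lq : last y q \in after S u by rewrite E; apply: mem_last.
rewrite [last _ (_ :: _)]/= gapx_other //; first exact: (@neq_after S).
by apply: contraNneq vu => <-.
Qed.

Lemma gapx_pre_v : gx (pregap S v) = gx (inr u).
Proof.
rewrite gapxu; case: contract_cases => [[p [q [E F W1 W2 vu]]]|[vu uv' W1 W2]].
  rewrite /pregap W1 F last_cat; case: p E F W1 => [|y p] E F W1.
    by rewrite [last _ _]/= gapxu W1.
  have lp : last y p \in y :: p by apply: mem_last.
  rewrite [last _ _]/= gapx_other //.
    by apply: (@neq_after S); rewrite E mem_cat lp.
  by apply: (@neq_after S); rewrite F mem_cat inE lp !orbT.
rewrite W1 /pregap; case E : (after S v) => [|y q].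
  by rewrite cats0 [last _ _]/= gapxv (c1_out vu) W2 E.
rewrite (start_gap_last _ u) ?last_cat; last by case: (after S u).
have lq : last y q \in after S v by rewrite E; apply: mem_last.
rewrite [last _ (_ :: _)]/= gapx_other //; last exact: (@neq_after S).
by apply: contraNneq uv' => <-.
Qed.

(** If [p] is nonempty then [a] keeps its predecessor; otherwise the label [x]
    preceding it disappears, and [gapx] sends the gap of [x] to the new one. *)
Lemma gapx_pre_aux x (c : cpnt C) s p a :
  after C a = s ++ p -> (p = [::] -> gx (inr x) = inr (last a s)) ->
  {in p, forall y, (y != u) && (y != v)} ->
  gx (inr (last x p)) = pregap C a.
Proof.
move=> cE p0 pn; rewrite /pregap cE.
case: p => [|y p] in cE p0 pn *; first by rewrite cats0 p0.
have /andP[lu lv] := pn _ (mem_last y p).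
by rewrite [last _ _]/= gapx_other // last_cat.
Qed.

Lemma gapx_pre a : a \in lab S -> a != u -> a != v ->
  gx (pregap S a) = pregap C a.
Proof.
move=> /labP[i ai] au av.
have [/andP[ui vi]|ni] := boolP ((u \notin cyc i) && (v \notin cyc i)).
  have hi : contract_index u v (inl i : cpnt S + bool) by rewrite /= ui vi.
  pose j : cpnt C := exist _ (inl i) hi.
  have [p [q E]] : exists p q, cyc i = p ++ a :: q by case/splitPr: ai => p q; exists p, q.
  have E' : cyc j = p ++ a :: q by [].
  rewrite /pregap (after_mid E) (after_mid E') gapx_other //.
    by apply: contraNneq ui => <-; rewrite -(after_mid E); apply: after_last.
  by apply: contraNneq vi => <-; rewrite -(after_mid E); apply: after_last.
have split x s : x \in s -> exists p q, s = p ++ x :: q.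
  by case/splitPr => p q; exists p, q.
have aS : (a \in after S u) || (a \in after S v).
  case/labP: uS => iu ui; case/labP: vS => iv vi.
  rewrite (mem_after _ ui) (mem_after _ vi) au av /=.
  by move: ni; rewrite negb_and !negbK => /orP[] xi;
    rewrite ?(cyc_disj ui xi) ?(cyc_disj vi xi) ai ?orbT.
case: contract_cases => [[p [q [E F W1 W2 vu]]]|[vu uv' W1 W2]].
  have pn : {in p, forall y, (y != u) && (y != v)}.
    move=> y yp; apply/andP; split; apply: (@neq_after S).
      by rewrite E mem_cat yp.
    by rewrite F mem_cat inE yp !orbT.
  have qn : {in q, forall y, (y != u) && (y != v)}.
    move=> y yp; apply/andP; split; apply: (@neq_after S).
      by rewrite E mem_cat inE yp !orbT.
    by rewrite F mem_cat yp.
  have cE : cyc c0 = p by [].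
  have cF : cyc c1 = q by rewrite cyc_c1.
  have : (a \in p) || (a \in q).
    by move: aS; rewrite E F !mem_cat !inE (negbTE au) (negbTE av) /= => /orP[]/orP[]->; rewrite ?orbT.
  case/orP => /split[p1 [p2 aE]].
    rewrite aE -catA in E; rewrite (pregap_cat E).
    apply: (@gapx_pre_aux u c0 p2); first by apply: (@after_mid _ c0); rewrite cE.
      by move=> p0; rewrite gapxu W1 aE p0.
    by move=> y yp; apply: pn; rewrite aE mem_cat yp.
  rewrite aE -catA in F; rewrite (pregap_cat F).
  apply: (@gapx_pre_aux v c1 p2); first by apply: (@after_mid _ c1); rewrite cF.
    by move=> p0; rewrite gapxv W2 aE p0.
  by move=> y yp; apply: qn; rewrite aE mem_cat yp.
have cE : cyc c0 = after S u ++ after S v by [].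
case/orP: aS => /split[p1 [p2 aE]].
  rewrite (pregap_cat aE); apply: (@gapx_pre_aux u c0 (p2 ++ after S v)).
  - by apply: (@after_mid _ c0); rewrite cE aE -catA.
  - by move=> p0; rewrite gapxu W1 aE p0.
  - move=> y yp; have yu : y \in after S u by rewrite aE mem_cat yp.
    by rewrite (neq_after yu) /=; apply: contraTneq yu => ->.
rewrite (pregap_cat aE); apply: (@gapx_pre_aux v c0 (p2 ++ after S u)).
- by rewrite -catA; apply: (@after_mid _ c0); rewrite cE aE catA.
- by move=> p0; rewrite gapxv (c1_out vu) W2 aE p0.
- move=> y yp; have yu : y \in after S v by rewrite aE mem_cat yp.
  by rewrite (neq_after yu) andbT; apply: contraTneq yu => ->.
Qed.

Lemma gapx_onto (P : gap C) : is_gap P -> exists2 R : gap S, is_gap R & gx R = P.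
Proof.
case: P => [j|x] /= hP; last first.
  move: hP; rewrite lab_contract // => /and3P[xu xv xS].
  by exists (inr x); rewrite ?gapx_other.
case: j hP => [[i|[]] hj] /= hP.
- by exists (inl i) => //=; congr inl; apply: val_inj; rewrite val_insubd hj.
- exists (inr v) => //; rewrite gapxv.
  rewrite (_ : walk S v u = [::]) /=; last exact/nilP.
  by congr inl; apply: val_inj; rewrite c1_in.
- exists (inr u) => //; rewrite gapxu.
  rewrite (_ : walk S u v = [::]) /=; last exact/nilP.
  by congr inl; apply: val_inj.
Qed.

Lemma is_gapx (P : gap S) : is_gap P -> is_gap (gx P).
Proof.
case: P => [i|x] hP.
  rewrite /= /contract_cyc val_insubd /=.
  move: hP; rewrite /is_gap => /nilP E.
  by rewrite E /= E.
have [->|xu] := eqVneq x u; first by rewrite gapxu; apply: is_start_gap.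
have [->|xv] := eqVneq x v.
  rewrite gapxv; apply: is_start_gap.
  have [vu|vu] := boolP (v \in after S u); first by rewrite cyc_c1.
  rewrite c1_out //; case: contract_cases => [[p [q [_ _ _ _]]]|[_ _ W1 W2]].
    by rewrite (negbTE vu).
  by rewrite W2 [cyc _]W1 perm_catC.
by rewrite gapx_other //= lab_contract // xu xv.
Qed.

(** [rep] below chooses a representative for each fibre of [gapx], and every gap is
    joined to the representative of its image by the two basic identifications. *)
Lemma gapx_ker (Q : gap S -> Prop) :
  (Q (pregap S u) <-> Q (inr v)) -> (Q (pregap S v) <-> Q (inr u)) ->
  forall P R : gap S, is_gap P -> is_gap R -> gx P = gx R -> Q P -> Q R.
Proof.
move=> Qu Qv.
pose rep (P : gap C) : gap S := match P with
  | inl j => match val j with inl i => inl i | inr b => if b then inr v else inr u end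
  | inr x => inr x end.
have repP (P : gap S) : is_gap P -> Q P <-> Q (rep (gx P)).
  case: P => [i|x] hP.
    rewrite /= val_insubd ifT //=.
    by move: hP => /= /nilP ->.
  have [->|xu] := eqVneq x u.
    rewrite gapxu; case: contract_cases => [[p [q [E F W1 W2 vu]]]|[vu uv' W1 W2]].
      by rewrite -Qv /pregap F W1 last_cat; case: (p).
    rewrite W1; case E2 : (after S v) Qv => [|y q].
      rewrite cats0; case E1 : (after S u) Qu => [|y p] //.
      by rewrite /pregap E1 E2 /= => -> <-.
    by rewrite (start_gap_last _ u) ?last_cat; [rewrite /pregap E2 /= => <-|case: (after S u)].
  have [->|xv] := eqVneq x v; last by rewrite gapx_other.
  rewrite gapxv; case: contract_cases => [[p [q [E F W1 W2 vu]]]|[vu uv' W1 W2]].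
    by rewrite -Qu /pregap E W2 last_cat; case: (q) => //=; rewrite c1_in.
  rewrite W2 (c1_out vu); case E1 : (after S u) Qu => [|y p].
    rewrite cats0; case E2 : (after S v) Qv => [|y q].
      by rewrite /pregap E2 /= => ->.
    by rewrite /pregap E1 E2 /= => -> <-.
  by rewrite (start_gap_last _ v) ?last_cat; [rewrite /pregap E1 /= => <-|case: (after S v)].
by move=> P R hP hR E; rewrite (repP P) // (repP R) // E.
Qed.
End ContractGaps.
End Gaps.

(** * Isomorphisms and their action on gaps *)
Section Orbits.
Context (G : finType) (s : {perm G}).

Lemma porbit_step x : porbit s (s x) = porbit s x.
Proof. by have := porbit_perm s 1 x; rewrite expg1. Qed.

Lemma porbit_ind (Q : G -> Prop) x y : (forall z, Q z -> Q (s z)) ->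
  porbit s x = porbit s y -> Q x -> Q y.
Proof.
move=> Qs /eqP; rewrite eq_porbit_mem porbit_sym => /porbitP[n ->] Qx.
elim: n => [|n IH]; first by rewrite perm1.
by rewrite expgSr permM; apply: Qs.
Qed.
End Orbits.

Section Isos.
Context (K : eqType).
Implicit Types S T : mcyc K.

Definition cpnt0 S : cpnt S := enum_val (Ordinal (cpnt_gt0 S)).

Definition comp_of S (P : gap S) : cpnt S := match P with
  | inl i => i
  | inr a => odflt (cpnt0 S) [pick i | a \in cyc i]
  end.

Lemma comp_of_inr S (i : cpnt S) a : a \in cyc i -> comp_of (inr a : gap S) = i.
Proof.
move=> ai /=; case: pickP => [j aj|/(_ i)]; last by rewrite ai.
by rewrite /= (cyc_disj ai aj).
Qed.

Lemma comp_of_pregap S a : a \in lab S ->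
  comp_of (pregap S a) = comp_of (inr a : gap S).
Proof.
move=> /labP[i ai]; rewrite (comp_of_inr ai) /pregap.
exact: comp_of_inr (after_last ai).
Qed.

Lemma comp_of_onto S (i : cpnt S) : exists2 P : gap S, is_gap P & comp_of P = i.
Proof.
case E : (cyc i) => [|a l]; first by exists (inl i); rewrite //= E.
have ai : a \in cyc i by rewrite E mem_head.
by exists (inr a); [apply: mem_lab ai|apply: comp_of_inr].
Qed.

Lemma iso_mem S T (r : iso S T) i b :
  (b \in cyc (on_comp r i)) = (b \in map (on_lab r) (cyc i)).
Proof. by have [n ->] := iso_rot r i; rewrite mem_rot. Qed.

Lemma iso_lab S T (r : iso S T) a : a \in lab S -> on_lab r a \in lab T.
Proof. by move=> /labP[i ai]; apply: (@mem_lab _ _ (on_comp r i)); rewrite iso_mem map_f. Qed.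

Lemma map_uniq_inj (X Y : eqType) (f : X -> Y) (l : seq X) :
  uniq (map f l) -> {in l &, injective f}.
Proof.
elim: l => // a l IH /= /andP[fa /IH inj] x y; rewrite !inE.
move=> /predU1P[->|xl] /predU1P[->|yl] //; last exact: inj.
  by move=> E; rewrite E map_f in fa.
by move=> E; rewrite -E map_f in fa.
Qed.

Lemma iso_inj S T (r : iso S T) : {in lab S &, injective (on_lab r)}.
Proof.
move=> a b /labP[i ai] /labP[j bj] E.
have Ei : on_lab r a \in cyc (on_comp r i) by rewrite iso_mem map_f.
have Ej : on_lab r a \in cyc (on_comp r j) by rewrite E iso_mem map_f.
have ij := bij_inj (on_comp_bij r) (cyc_disj Ei Ej); subst j.
have := cyc_uniq (on_comp r i); have [n ->] := iso_rot r i.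
by rewrite rot_uniq => /map_uniq_inj; apply.
Qed.

Lemma rot_inv (X : eqType) n (t : seq X) : exists m, t = rot m (rot n t).
Proof. by exists (size (rot n t) - n); rewrite -[LHS](rotK n). Qed.

Lemma iso_after S T (r : iso S T) a : a \in lab S ->
  after T (on_lab r a) = map (on_lab r) (after S a).
Proof.
move=> /labP[i ai]; have [n l E] := rot_to ai.
have [m Em] := iso_rot r i; have [m' Em'] := rot_inv m (map (on_lab r) (cyc i)).
rewrite (after_rot E) -[RHS]/(behead (on_lab r a :: _)) -map_cons -E map_rot Em' -Em.
rewrite rot_rot_add; set k := rot_add _ _ _.
apply: (@after_rot _ _ (on_comp r i) k).
by rewrite /k -rot_rot_add Em -Em' -map_rot E.
Qed.

Lemma iso_pregap S T (r : iso S T) a : a \in lab S ->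
  pregap T (on_lab r a) = act_gap r (pregap S a).
Proof. by move=> aS; rewrite /pregap iso_after // last_map. Qed.

Lemma iso_nil S T (r : iso S T) i : nilp (cyc (on_comp r i)) = nilp (cyc i).
Proof. by have [n ->] := iso_rot r i; rewrite /nilp size_rot size_map. Qed.

Lemma iso_is_gap S T (r : iso S T) P : is_gap P -> is_gap (act_gap r P).
Proof. by case: P => [i|a] /=; [rewrite iso_nil|apply: iso_lab]. Qed.

Lemma iso_gap_inj S T (r : iso S T) P R : is_gap P -> is_gap R ->
  act_gap r P = act_gap r R -> P = R.
Proof.
case: P R => [i|a] [j|b] //= hP hR [].
  by move=> /(bij_inj (on_comp_bij r)) ->.
by move=> /iso_inj->.
Qed.

Lemma iso_gap_onto S T (r : iso S T) R : is_gap R ->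
  exists2 P, is_gap P & act_gap r P = R.
Proof.
case: R => [j|b] /=.
  case: (on_comp_bij r) => h _ hK; rewrite -(hK j) iso_nil => hi.
  by exists (inl (h j)).
case: (on_comp_bij r) => h _ hK /labP[j]; rewrite -(hK j) iso_mem => /mapP[a ai ->].
by exists (inr a) => //=; apply: mem_lab ai.
Qed.

(** The image of a nonempty component is determined by any of its labels, so that
    gaps control an isomorphism entirely. *)
Lemma iso_ext S T (r r' : iso S T) :
  (forall P, is_gap P -> act_gap r P = act_gap r' P) -> iso_eq r r'.
Proof.
move=> h.
have hl a : a \in lab S -> on_lab r a = on_lab r' a.
  by move=> aS; have /= [] := h (inr a) aS.
split=> // i; case E : (cyc i) => [|a l].
  by have /= := h (inl i); rewrite E => /(_ isT)[].
have ai : a \in cyc i by rewrite E mem_head.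
have ri : on_lab r a \in cyc (on_comp r i) by rewrite iso_mem map_f.
apply: cyc_disj ri _; rewrite hl ?(mem_lab ai) //.
by rewrite iso_mem map_f.
Qed.
End Isos.

(** * Presenting objects by permutations *)
Section Presentations.
Context (K : eqType).
Implicit Types (S T : mcyc K) (G : finType).

(** [G] is a set of points placed on the circles of [S], [s] goes to the next point
    of the circle, [lam] names the points which are labels, and [p x] is the gap
    which contains [x], or which follows it when [x] is a label.  The unlabelled
    points are marks without meaning for [S]: several may lie in one gap, and an
    empty circle carries at least one.  By [pres_ker], two points have the same
    image only if one reaches the other by moving through unlabelled points.  Since
    nothing is ever removed from [G], the objects obtained from one another by
    contractions and merges are all presented by the same points. *)
Record pres G (s : {perm G}) (lam : G -> option K) S (p : G -> gap S) : Prop := Pres {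
  pres_gap : forall x, is_gap (p x);
  pres_onto : forall P, is_gap P -> exists x, p x = P;
  pres_lab : forall x a, lam x = Some a -> p x = inr a;
  pres_all : forall a, a \in lab S -> exists x, lam x = Some a;
  pres_inj : forall x y a, lam x = Some a -> lam y = Some a -> x = y;
  pres_none : forall x, lam (s x) = None -> p (s x) = p x;
  pres_some : forall x a, lam (s x) = Some a -> p x = pregap S a;
  pres_ker : forall Q : G -> Prop,
    (forall x, lam (s x) = None -> (Q (s x) <-> Q x)) ->
    forall x y, p x = p y -> Q x -> Q y
}.

Lemma pres_in G (s : {perm G}) lam S (p : G -> gap S) x a :
  pres s lam p -> lam x = Some a -> a \in lab S.
Proof. by move=> H E; have := pres_gap H x; rewrite (pres_lab H E). Qed.

(** Components are orbits: moving to the next point stays in the component, and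
    conversely the labels of a circle are linked by the successive gaps. *)
Lemma pres_comp G (s : {perm G}) lam S (p : G -> gap S) : pres s lam p ->
  forall x y, comp_of (p x) = comp_of (p y) <-> porbit s x = porbit s y.
Proof.
move=> H x y; split; last first.
  move=> E; apply: (@porbit_ind _ s (fun z => comp_of (p x) = comp_of (p z))) E _ => // z ->.
  case E : (lam (s z)) => [a|]; last by rewrite (pres_none H E).
  by rewrite (pres_some H E) (pres_lab H E) comp_of_pregap // (pres_in H E).
have W z w : p z = p w -> porbit s z = porbit s w.
  move=> E; apply: (pres_ker H (Q := fun w => porbit s z = porbit s w)) E _ => // t _.
  by rewrite porbit_step.
have L a l1 l2 z w : after S a = l1 ++ l2 -> lam z = Some a -> lam w = Some (last a l1) ->
    porbit s z = porbit s w.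
  elim/last_ind: l1 l2 w => [|l1 c IH] l2 w.
    by move=> _ hz hw; rewrite (pres_inj H hz hw).
  rewrite last_rcons -cats1 -catA => E hz hw.
  have [t wE] : exists t, w = s t by exists (s^-1 w)%g; rewrite permKV.
  rewrite wE in hw; have := pres_some H hw; rewrite (pregap_cat E) => pt.
  have lS : last a l1 \in lab S by have := pres_gap H t; rewrite pt.
  have [t' t'l] := pres_all H lS.
  rewrite (IH _ t' E hz t'l) wE porbit_step; apply: W.
  by rewrite pt (pres_lab H t'l).
have [] : is_gap (p x) /\ is_gap (p y) by split; apply: pres_gap H _.
case px : (p x) => [i|a]; case py : (p y) => [j|b] /= hi hj.
- by move=> ij; apply: W; rewrite px py ij.
- case/labP: hj => j bj; rewrite -/(comp_of (inr b : gap S)) (comp_of_inr bj) => ij; subst j.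
  by move: bj; rewrite (nilP hi).
- case/labP: hi => i ai; rewrite -/(comp_of (inr a : gap S)) (comp_of_inr ai) => ij; subst j.
  by move: ai; rewrite (nilP hj).
rewrite -/(comp_of (inr a : gap S)) -/(comp_of (inr b : gap S)) => ij.
have [xa xaE] := pres_all H hi; have [xb xbE] := pres_all H hj.
rewrite (W x xa) ?px ?(pres_lab H xaE) // (W y xb) ?py ?(pres_lab H xbE) //.
case/labP: (hi) => i ai; case/labP: (hj) => j bj.
rewrite (comp_of_inr ai) (comp_of_inr bj) in ij; subst j.
have [ab|ab] := eqVneq b a; first by rewrite ab in xbE; rewrite (pres_inj H xaE xbE).
have [l1 [l2 E]] : exists l1 l2, after S a = l1 ++ b :: l2.
  have : b \in after S a by rewrite (mem_after _ ai) ab.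
  by case/splitPr => l1 l2; exists l1, l2.
by apply: (L a (rcons l1 b) l2) => //; rewrite ?cat_rcons ?last_rcons.
Qed.

Lemma pres_card G (s : {perm G}) lam S (p : G -> gap S) : pres s lam p ->
  #|cpnt S| = #|porbits s|.
Proof.
move=> H; have /choice[w wE] : forall i : cpnt S, exists x, comp_of (p x) = i.
  move=> i; have [P hP <-] := comp_of_onto i.
  by have [x <-] := pres_onto H hP; exists x.
rewrite -(card_imset (f := fun i => porbit s (w i))) //; last first.
  by move=> i j /(pres_comp H); rewrite !wE.
apply: eq_card => O; apply/imsetP/imsetP => [[i _ ->]|[x _ ->]].
  by exists (w i).
by exists (comp_of (p x)) => //; apply/(pres_comp H); rewrite wE.
Qed.

Lemma pres_ext G (s : {perm G}) lam lam' S (p : G -> gap S) p' :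
  lam =1 lam' -> p =1 p' -> pres s lam p -> pres s lam' p'.
Proof. by move=> /funext -> /funext ->. Qed.

(** A presentation determines the object, up to the renaming [f] of the labels: gaps
    and components are the classes of points for relations which only involve [s]
    and [lam], and each circle is recovered by reading it backwards with
    [pregap]. *)
Lemma pres_uniq G (s : {perm G}) lam (f : K -> K) S T (p : G -> gap S) (q : G -> gap T) :
  pres s lam p -> pres s (omap f \o lam) q ->
  exists r : iso S T, forall x, act_gap r (p x) = q x.
Proof.
move=> Hp Hq.
have W x y : p x = p y -> q x = q y.
  move=> E; apply: (pres_ker Hp (Q := fun w => q x = q w)) E _ => // z hz.
  by rewrite (pres_none Hq) //= hz.
have W' x y : q x = q y -> p x = p y.
  move=> E; apply: (pres_ker Hq (Q := fun w => p x = p w)) E _ => // z /= hz.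
  by rewrite (pres_none Hp) //=; case: (lam _) hz.
have ql x a : lam x = Some a -> q x = inr (f a) by move=> h; rewrite (@pres_lab _ _ _ _ _ Hq x (f a)) //= h.
have fl a : a \in lab S -> f a \in lab T.
  by move=> /(pres_all Hp)[x] /ql E; have := pres_gap Hq x; rewrite E.
have finj a b : a \in lab S -> b \in lab S -> f a = f b -> a = b.
  move=> /(pres_all Hp)[x xa] /(pres_all Hp)[y yb] E.
  by have := W' x y; rewrite (ql _ _ xa) (ql _ _ yb) E (pres_lab Hp xa) (pres_lab Hp yb) => /(_ erefl)[].
have fpre a : a \in lab S -> last (f a) (after T (f a)) = f (last a (after S a)).
  move=> /(pres_all Hp)[x xa].
  have [y xE] : exists y, x = s y by exists (s^-1 x)%g; rewrite permKV.
  rewrite xE in xa; have py := pres_some Hp xa.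
  have := @pres_some _ _ _ _ _ Hq y (f a); rewrite /= xa => /(_ erefl) qy.
  have lS : last a (after S a) \in lab S by have := pres_gap Hp y; rewrite py.
  have [z zl] := pres_all Hp lS.
  have := W y z; rewrite py (pres_lab Hp zl) qy (ql _ _ zl) => /(_ erefl).
  by rewrite /pregap => -[].
have fafter a : a \in lab S -> after T (f a) = map f (after S a).
  move=> aS.
  (* Reading backwards: a common final segment extends by one label to the left,
     until [a] is reached on both sides. *)
  have claim t l1 : after S a = l1 ++ t -> exists l1', after T (f a) = l1' ++ map f t.
    elim: t l1 => [|b t IH] l1 E; first by exists (after T (f a)); rewrite cats0.
    have [|l1' E'] := IH (rcons l1 b); first by rewrite cat_rcons.
    have bS : b \in lab S by apply: (@after_lab _ _ a); rewrite E mem_cat mem_head orbT.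
    have [d [dS dE dE']] : exists d, [/\ d \in lab S, last d (after S d) = b &
        last (f d) (after T (f d)) = last (f a) l1'].
      case: t E E' {IH} => [|d t] E E'.
        by exists a; rewrite E E' last_cat /= cats0.
      exists d; split.
      - by apply: (@after_lab _ _ a); rewrite E mem_cat !inE eqxx !orbT.
      - by have := @pregap_cat _ S a d (rcons l1 b) t; rewrite cat_rcons last_rcons => /(_ E)[].
      - by have := @pregap_cat _ T (f a) (f d) l1' (map f t) E' => -[].
    have := fpre d dS; rewrite dE' dE; case/lastP: l1' E' {dE'} => [|l1' c] E'.
      move=> /finj ab; have {}ab := ab aS bS.
      by have := notin_after S a; rewrite E -ab mem_cat mem_head orbT.
    by rewrite last_rcons => cE; subst c; exists l1'; rewrite E' cat_rcons.
  have [l1' E'] := claim _ [::] erefl; rewrite E'.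
  case/lastP: l1' E' => // l1' c E'.
  have [d [dS dE dE']] : exists d, [/\ d \in lab S, last d (after S d) = a &
        last (f d) (after T (f d)) = c].
    case E : (after S a) E' => [|d t] E'.
      by exists a; rewrite E E' last_cat /= last_rcons.
    exists d; split.
    - by apply: (@after_lab _ _ a); rewrite E mem_head.
    - by have := @pregap_cat _ S a d [::] t E => -[].
    - have := @pregap_cat _ T (f a) (f d) (rcons l1' c) (map f t) E'.
      by rewrite last_rcons => -[].
  have := fpre d dS; rewrite dE' dE => cE.
  by have := notin_after T (f a); rewrite E' cE mem_cat mem_rcons mem_head.
have /choice[w wE] : forall i : cpnt S, exists x, comp_of (p x) = i.
  move=> i; have [P hP <-] := comp_of_onto i.
  by have [x <-] := pres_onto Hp hP; exists x.
have /choice[w' wE'] : forall i : cpnt T, exists x, comp_of (q x) = i.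
  move=> i; have [P hP <-] := comp_of_onto i.
  by have [x <-] := pres_onto Hq hP; exists x.
pose c i := comp_of (q (w i)).
have cE x : c (comp_of (p x)) = comp_of (q x).
  by apply/(pres_comp Hq)/(pres_comp Hp); rewrite wE.
have cbij : bijective c.
  exists (fun j => comp_of (p (w' j))) => [i|j]; last by rewrite cE wE'.
  by rewrite -{2}(wE i); apply/(pres_comp Hp)/(pres_comp Hq); rewrite wE'.
have crot i : is_rot (map f (cyc i)) (cyc (c i)).
  case E : (cyc i) => [|a l].
    have [x px] : exists x, p x = inl i by apply: (pres_onto Hp); rewrite /= E.
    exists 0; rewrite rot0 /=; have ci := cE x; rewrite px /= in ci; rewrite ci.
    have := pres_gap Hq x; case qx : (q x) => [j|b] /= => [/nilP//|].
    move=> /(pres_all Hq)[y /= hy]; case yE : (lam y) hy => [b'|] //= [bE].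
    have := W' x y; rewrite qx (ql _ _ yE) bE => /(_ erefl).
    by rewrite px (pres_lab Hp yE).
  have ai : a \in cyc i by rewrite E mem_head.
  have aS := mem_lab ai; have [x xa] := pres_all Hp aS.
  have ci := cE x; rewrite (pres_lab Hp xa) (ql _ _ xa) (comp_of_inr ai) in ci.
  have /labP[j fj] := fl _ aS; rewrite (comp_of_inr fj) in ci; rewrite ci.
  have [n l' El'] := rot_to fj; have := after_rot El'; rewrite fafter //.
  rewrite (@after_mid _ _ i a [::] l E) cats0 => l'E.
  have [m mE] := rot_inv n (cyc j); exists m.
  by rewrite mE El' -l'E.
exists (Iso cbij crot) => x.
case px : (p x) => [i|a] /=.
  have := cE x; rewrite px /= => ->.
  case qx : (q x) => [j|b] //=; have := pres_gap Hq x; rewrite qx /=.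
  move=> /(pres_all Hq)[y /= hy]; case yE : (lam y) hy => [b'|] //= [bE].
  have := W' x y; rewrite qx (ql _ _ yE) bE => /(_ erefl).
  by rewrite px (pres_lab Hp yE).
have [|y yE] := pres_all Hp (_ : a \in lab S); first by have := pres_gap Hp x; rewrite px.
by rewrite -(ql _ _ yE); apply: W; rewrite px (pres_lab Hp yE).
Qed.

Lemma pres_iso G (s : {perm G}) lam S T (p : G -> gap S) (r : iso S T) :
  pres s lam p -> pres s (omap (on_lab r) \o lam) (act_gap r \o p).
Proof.
move=> H; split.
- by move=> x; apply: iso_is_gap; apply: pres_gap H x.
- move=> R /(iso_gap_onto r)[P hP <-]; have [x <-] := pres_onto H hP; by exists x.
- by move=> x a /=; case E : (lam x) => [b|] //= [<-]; rewrite (pres_lab H E).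
- move=> b bT; have [[i|a] //= aS [<-]] := iso_gap_onto r (bT : is_gap (inr b : gap T)).
  by have [x xa] := pres_all H aS; exists x; rewrite xa.
- move=> x y b /=; case E : (lam x) => [a|] //= [<-]; case E' : (lam y) => [a'|] //= [].
  move=> /(iso_inj (pres_in H E') (pres_in H E)) aE; rewrite aE in E'.
  exact: (pres_inj H E E').
- by move=> x /=; case E : (lam (s x)) => //= _; rewrite (pres_none H E).
- move=> x b /=; case E : (lam (s x)) => [a|] //= [<-].
  by rewrite (pres_some H E) iso_pregap // (pres_in H E).
- move=> Q hQ x y /= /iso_gap_inj E; apply: (pres_ker H) => [z zE|].
    by apply: hQ; rewrite /= zE.
  by apply: E; apply: pres_gap H _.
Qed.

Definition erase2 G (lam : G -> option K) x y := fun z =>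
  if (z == x) || (z == y) then None else lam z.

(** Gluing two labels exchanges the arcs that arrive at them, that is, multiplies the
    permutation by a transposition.  This covers at once the case where two circles
    merge and the case where one splits. *)
Lemma pres_contract G (s : {perm G}) lam S (p : G -> gap S) x y u v (uv : u != v) :
  pres s lam p -> lam x = Some u -> lam y = Some v ->
  pres (s * tperm x y)%g (erase2 lam x y) (@gapx K S u v uv \o p).
Proof.
move=> H xu yv; have uS := pres_in H xu; have vS := pres_in H yv.
have xy : x != y by apply: contraNneq uv => E; move: xu; rewrite E yv => -[->].
have px := pres_lab H xu; have py := pres_lab H yv.
have ne a z : lam z = Some a -> z != x -> z != y -> (a != u) && (a != v).
  move=> za zx zy; apply/andP; split.
    by apply: contraNneq zx => E; rewrite E in za; rewrite (pres_inj H za xu).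
  by apply: contraNneq zy => E; rewrite E in za; rewrite (pres_inj H za yv).
have step z : [\/ [/\ s z = x, (s * tperm x y)%g z = y & p z = pregap S u],
    [/\ s z = y, (s * tperm x y)%g z = x & p z = pregap S v] |
    [/\ s z != x, s z != y & (s * tperm x y)%g z = s z]].
  rewrite permM; case: tpermP => [E|E|/eqP E /eqP E'].
  - by constructor 1; rewrite (@pres_some _ _ _ _ _ H z u) ?E.
  - by constructor 2; rewrite (@pres_some _ _ _ _ _ H z v) ?E.
  - by constructor 3.
split.
- by move=> z; apply: is_gapx => //; apply: pres_gap H z.
- move=> R /(gapx_onto uS vS)[P hP <-]; have [z <-] := pres_onto H hP; by exists z.
- move=> z a; rewrite /erase2; case: eqVneq => //= zx; case: eqVneq => //= zy za.
  by have /andP[au av] := ne _ _ za zx zy; rewrite (pres_lab H za) gapx_other.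
- move=> a; rewrite lab_contract // => /and3P[au av /(pres_all H)[z za]].
  exists z; rewrite /erase2.
  case: eqVneq => [E|_]; first by rewrite E xu in za; case: za au => ->; rewrite eqxx.
  case: eqVneq => [E|_] //=; by rewrite E yv in za; case: za av => ->; rewrite eqxx.
- move=> z w a; rewrite /erase2; case: ifP => // _ za; case: ifP => // _; move=> wa; exact: (pres_inj H za wa).
- move=> z; case: (step z) => -[E1 E2 E3]; rewrite ?E2 ?E3 /=.
  + by rewrite E3 py gapx_pre_u.
  + by rewrite E3 px gapx_pre_v.
  + by rewrite /erase2 (negbTE E1) (negbTE E2) => /(pres_none H) ->.
- move=> z a; case: (step z) => -[E1 E2 E3]; rewrite ?E2 ?E3 /= /erase2 ?eqxx ?orbT //.
  rewrite (negbTE E1) (negbTE E2) => za; have /andP[au av] := ne _ _ za E1 E2.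
  by rewrite (pres_some H za) gapx_pre // (pres_in H za).
- move=> Q hQ.
  have Qker z w : p z = p w -> Q z -> Q w.
    apply: (pres_ker H) => t ht; case: (step t) => -[E1 E2 E3].
    + by move: ht; rewrite E1 xu.
    + by move: ht; rewrite E1 yv.
    + by rewrite -E3; apply: hQ; rewrite E3 /erase2 ht if_same.
  have [zx zxE] : exists z, s z = x by exists (s^-1 x)%g; rewrite permKV.
  have [zy zyE] : exists z, s z = y by exists (s^-1 y)%g; rewrite permKV.
  have pzx : p zx = pregap S u by apply: (pres_some H); rewrite zxE.
  have pzy : p zy = pregap S v by apply: (pres_some H); rewrite zyE.
  pose Q' (P : gap S) := exists2 z, p z = P & Q z.
  have QE z : Q z <-> Q' (p z).
    by split=> [qz|[w /Qker]]; [exists z|apply].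
  have h1 : Q' (pregap S u) <-> Q' (inr v).
    rewrite -pzx -py -!QE; have := hQ zx; rewrite permM zxE tpermL => h.
    by symmetry; apply: h; rewrite /erase2 eqxx orbT.
  have h2 : Q' (pregap S v) <-> Q' (inr u).
    rewrite -pzy -px -!QE; have := hQ zy; rewrite permM zyE tpermR => h.
    by symmetry; apply: h; rewrite /erase2 eqxx.
  move=> z w E; rewrite !QE; exact: (gapx_ker (uv := uv) h1 h2 (pres_gap H z) (pres_gap H w) E).
Qed.
End Presentations.

(** * Counting components *)
Section OrbitCount.
Context (G : finType) (s : {perm G}).
Local Open Scope group_scope.

Lemma card_porbits_tperm x y : x != y ->
  (#|porbits (s * tperm x y)| + (porbit s x != porbit s y).*2 = #|porbits s|.+1)%N.
Proof.
move=> xy; have := porbits_mul_tperm s^-1 x y; rewrite /=.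
rewrite -{1}tpermV -invMg !porbitsV xy addn1 => <-.
by rewrite porbitV eq_porbit_mem.
Qed.
End OrbitCount.

(** * Existence of presentations and of presented objects *)
Section Base.
Context (K : eqType) (S : mcyc K).

(** The points of the smallest presentation of [S] are its gaps. *)
Definition gaps : seq {classic gap S} :=
  [seq inl i | i <- enum (cpnt S) & nilp (cyc i)] ++
  [seq inr a | a <- flatten [seq cyc i | i <- enum (cpnt S)]].

Lemma mem_gaps (P : gap S) : ((P : {classic gap S}) \in gaps) = is_gap P.
Proof.
rewrite mem_cat; case: P => [i|a] /=; apply/orP/idP.
- by case=> /mapP[j]; rewrite ?mem_filter => // /andP[hj _] [->].
- by move=> hi; left; apply/mapP; exists i; rewrite // mem_filter hi mem_enum.
- case=> /mapP[b] // /flatten_mapP[i _ bi] [->]; exact: mem_lab bi.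
- case/labP=> i ai; right; apply/mapP; exists a => //; apply/flatten_mapP.
  by exists i; rewrite ?mem_enum.
Qed.

Definition gapT : finType := seq_sub gaps.

Definition gap_val (x : gapT) : gap S := val x.

Lemma gap_valP x : is_gap (gap_val x).
Proof. by rewrite -mem_gaps; apply: (valP x). Qed.

Lemma gap_val_onto P : is_gap P -> exists x, gap_val x = P.
Proof. by rewrite -mem_gaps => hP; exists (SeqSub hP). Qed.

Lemma gap_val_inj : injective gap_val.
Proof. exact: val_inj. Qed.

Definition next_gap (P : gap S) : gap S :=
  if P is inr a then inr (head a (after S a)) else P.

Lemma next_is_gap P : is_gap P -> is_gap (next_gap P).
Proof.
case: P => [//|a] aS /=; case E : (after S a) => [//|b l] /=.
by apply: (@after_lab _ _ a); rewrite E mem_head.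
Qed.

Lemma pregap_next a : pregap S (head a (after S a)) = inr a.
Proof.
case E : (after S a) => [|b l] /=; first by rewrite /pregap E.
exact: (@pregap_cat _ S a b [::] l).
Qed.

Lemma next_pregap a : next_gap (pregap S a) = inr a.
Proof.
rewrite /pregap; case/lastP E : (after S a) => [|l b] /=; first by rewrite E.
by rewrite last_rcons (@after_cat _ _ a b l [::]) ?cats1.
Qed.

Definition gap_next (x : gapT) : gapT := insubd x (next_gap (gap_val x) : {classic gap S}).

Lemma gap_nextE x : gap_val (gap_next x) = next_gap (gap_val x).
Proof. by rewrite /gap_val val_insubd mem_gaps next_is_gap //; apply: gap_valP. Qed.

Lemma gap_next_inj : injective gap_next.
Proof.
move=> x y /(congr1 gap_val); rewrite !gap_nextE => E; apply: gap_val_inj.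
case: (gap_val x) (gap_val y) E => [i|a] [j|b] //= [E].
by have := pregap_next b; rewrite -E pregap_next => -[->].
Qed.

Definition gap_perm : {perm gapT} := perm gap_next_inj.

Definition gap_lab (x : gapT) : option K := if gap_val x is inr a then Some a else None.

Lemma pres_base : pres gap_perm gap_lab gap_val.
Proof.
split.
- exact: gap_valP.
- exact: gap_val_onto.
- by move=> x a; rewrite /gap_lab; case: (gap_val x) => // b [->].
- move=> a aS; have [x xE] := gap_val_onto (aS : is_gap (inr a : gap S)).
  by exists x; rewrite /gap_lab xE.
- move=> x y a; rewrite /gap_lab => hx hy; apply: gap_val_inj.
  by case: (gap_val x) (gap_val y) hx hy => [//|b] [//|c] [->] [->].
- by move=> x; rewrite permE /gap_lab gap_nextE; case: (gap_val x).
- move=> x b; rewrite permE /gap_lab gap_nextE; case: (gap_val x) => // a [<-].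
  by rewrite pregap_next.
- by move=> Q _ x y /gap_val_inj->.
Qed.
End Base.

(** Conversely any permutation with a partial injective labelling presents an
    object: its components are the orbits, read through the labelling. *)
Section Realize.
Context (K : eqType) (G : finType) (s : {perm G}) (lam : G -> option K).
Hypothesis lam_inj : forall x y a, lam x = Some a -> lam y = Some a -> x = y.
Hypothesis G_gt0 : 0 < #|G|.

Let si : injective s := @perm_inj _ s.

Lemma orbit_cons x : fingraph.orbit s x = x :: behead (fingraph.orbit s x).
Proof. by rewrite /fingraph.orbit -orderSpred. Qed.

Lemma orbit_rot x y : fconnect s x y -> exists n, fingraph.orbit s y = rot n (fingraph.orbit s x).
Proof.
move=> xy; have cx := cycle_orbit si x.
have yx : y \in fingraph.orbit s x by rewrite -fconnect_orbit.
by have [i ->] := orbit_rot_cycle cx (orbit_uniq s x) yx; exists i.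
Qed.

Lemma orbit_next x : fingraph.orbit s (s x) = rcons (behead (fingraph.orbit s x)) x.
Proof.
have oE : fingraph.order s (s x) = fingraph.order s x by apply: eq_card => y; rewrite !inE -(same_fconnect1 si).
have := iter_order si x; rewrite /fingraph.orbit oE -orderSpred.
by rewrite trajectSr -iterSr => ->.
Qed.

Lemma pmap_rot n (t : seq G) : exists m, pmap lam (rot n t) = rot m (pmap lam t).
Proof.
exists (size (pmap lam (take n t))); rewrite /rot pmap_cat.
have -> : pmap lam t = pmap lam (take n t) ++ pmap lam (drop n t).
  by rewrite -pmap_cat cat_take_drop.
by rewrite drop_size_cat // take_size_cat.
Qed.

Lemma pmap_uniq_lam (t : seq G) : uniq t -> uniq (pmap lam t).
Proof.
elim: t => //= x t IH /andP[xt /IH u]; case E : (lam x) => [a|] //=.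
rewrite u andbT mem_pmap; apply/mapP => -[y yt aE].
by move: xt; rewrite (lam_inj E (esym aE)) yt.
Qed.

Definition realize_cpnt : finType := {x : G | x \in froots s}.
Definition realize_comp (x : G) : realize_cpnt := Sub (froot s x) (roots_root (fconnect_sym si) x).
Definition realize_cyc (i : realize_cpnt) := pmap lam (fingraph.orbit s (val i)).

Lemma realize_gt0 : 0 < #|realize_cpnt|.
Proof. by case/card_gt0P: G_gt0 => x _; apply/card_gt0P; exists (realize_comp x). Qed.

Lemma realize_uniq i : uniq (realize_cyc i).
Proof. exact/pmap_uniq_lam/orbit_uniq. Qed.

Lemma realize_mem i a : a \in realize_cyc i -> exists2 x, lam x = Some a & i = realize_comp x.
Proof.
rewrite mem_pmap => /mapP[x]; rewrite -fconnect_orbit => xi aE; exists x => //.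
apply: val_inj => /=; rewrite -(eqP (valP i)).
by apply/eqP; rewrite root_connect //; apply: fconnect_sym.
Qed.

Lemma realize_disj i j a : a \in realize_cyc i -> a \in realize_cyc j -> i = j.
Proof.
by move=> /realize_mem[x xa ->] /realize_mem[y ya ->]; rewrite (lam_inj xa ya).
Qed.

Definition realize : mcyc K := MCyc realize_gt0 realize_uniq realize_disj.

(** The orbit is read from the successor of [x], so that the last label met is the one
    at or before [x]. *)
Definition realize_gap (x : G) : gap realize :=
  @start_gap K realize (realize_comp x) (pmap lam (fingraph.orbit s (s x))).

Lemma realize_rot x : exists m, pmap lam (fingraph.orbit s (s x)) = rot m (realize_cyc (realize_comp x)).
Proof.
have [|n E] := @orbit_rot (froot s x) (s x).
  rewrite fconnect_sym // -(same_fconnect1 si); first exact: connect_root.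
by have [m Em] := pmap_rot n (fingraph.orbit s (froot s x)); exists m; rewrite E Em.
Qed.

Lemma realize_comp_next x : realize_comp (s x) = realize_comp x.
Proof.
apply: val_inj => /=; apply/eqP; rewrite root_connect; last exact: fconnect_sym.
by rewrite fconnect_sym // fconnect1.
Qed.

Lemma pres_realize : pres s lam realize_gap.
Proof.
have labE x a : lam x = Some a -> realize_gap x = inr a.
  rewrite /realize_gap orbit_next -cats1 pmap_cat /= => ->.
  by rewrite (@start_gap_last _ _ _ a) ?last_cat //; case: (pmap _ _).
have noneE x : lam (s x) = None -> realize_gap (s x) = realize_gap x.
  rewrite /realize_gap orbit_next (orbit_cons (s x)) -cats1 pmap_cat /= => ->.
  by rewrite cats0 realize_comp_next.
have someE x a : lam (s x) = Some a -> realize_gap x = pregap realize a.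
  rewrite /realize_gap => E; have [m] := realize_rot x.
  rewrite orbit_cons /= E /= => /esym Em; congr inr.
  by rewrite (@after_rot _ realize _ _ _ _ Em).
split=> //.
- move=> x; apply: is_start_gap; have [m ->] := realize_rot x.
  by rewrite perm_rot.
- case=> [i|a] /= hP.
    exists (val i); have iE : realize_comp (val i) = i by apply: val_inj; apply/eqP/(valP i).
    rewrite /realize_gap iE; have [m ->] := realize_rot (val i).
    by rewrite iE (nilP hP).
  by case/labP: hP => i /realize_mem[x /labE xE _]; exists x.
- by move=> a /labP[i /realize_mem[x xE _]]; exists x.
- move=> Q hQ.
  have lin z n a : lam z = Some a -> realize_gap (iter n s z) = inr a -> Q z <-> Q (iter n s z).
    move=> za; elim: n => [//|n IH] /=; case E : (lam (s (iter n s z))) => [b|].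
      by rewrite (labE _ _ E) => -[bE]; rewrite bE in E; rewrite (lam_inj E za).
    by rewrite noneE // => /IH ->; symmetry; apply: hQ.
  have lin0 z n i : realize_gap z = inl i -> Q z <-> Q (iter n s z).
    move=> zi; have : realize_gap (iter n s z) = inl i /\ (Q z <-> Q (iter n s z)).
      elim: n => [//|n [IH1 IH2]] /=; case E : (lam (s (iter n s z))) => [b|].
        by have := someE _ _ E; rewrite IH1.
      by rewrite noneE // IH2; split=> //; symmetry; apply: hQ.
    by case.
  have conn x a : realize_gap x = inr a -> exists2 z, lam z = Some a & (Q z <-> Q x).
    move=> xa; have [m] := realize_rot x; rewrite /realize_gap in xa.
    case E : (pmap lam (fingraph.orbit s (s x))) xa => [//|b l] /= [lE] _.
    have : a \in pmap lam (fingraph.orbit s (s x)) by rewrite E -lE mem_last.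
    rewrite mem_pmap => /mapP[z zx za]; exists z => //.
    have : fconnect s z x.
      by rewrite fconnect_sym // (same_fconnect1 si) fconnect_orbit.
    move=> /iter_findex nE; rewrite -nE; apply: (lin _ _ a) => //.
    by rewrite nE /realize_gap E /= lE.
  move=> x y; case px : (realize_gap x) => [i|a] py.
    have : fconnect s x y.
      have ci z j : realize_gap z = inl j -> j = realize_comp z.
        by rewrite /realize_gap; case: (pmap _ _) => //= -[].
      have := ci _ _ (esym py); rewrite (ci _ _ px) => /(congr1 val)/= /eqP.
      by rewrite root_connect //; apply: fconnect_sym.
    by move=> /iter_findex <- Qx; apply/(lin0 _ _ _ px).
  have [z za <-] := conn x a px; have [w wa <-] := conn y a (esym py).
  by rewrite (lam_inj za wa).
Qed.
End Realize.

(** * Adding unlabelled points *)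
Section Arcs.
Implicit Types G : finType.
Local Open Scope group_scope.

(** [f] embeds the points of [G0] among those of [G1] in such a way that [s0] is the
    first return map of [s1]; [h] sends a point to the last point of the image of
    [f] at or before it. *)
Record arcs (G0 G1 : finType) (s0 : {perm G0}) (s1 : {perm G1})
    (f : G0 -> G1) (h : G1 -> G0) : Prop := Arcs {
  arcsK : cancel f h;
  arcs_next : forall y, h (s1 y) = if f (h (s1 y)) == s1 y then s0 (h y) else h y;
  arcs_conn : forall y, exists z, porbit s1 (f z) = porbit s1 y
}.

Lemma arcs_ind G0 G1 (s0 : {perm G0}) (s1 : {perm G1}) f h :
  arcs s0 s1 f h -> forall Q : G1 -> Prop,
  (forall z, Q (f z)) -> (forall y, f (h (s1 y)) != s1 y -> Q y -> Q (s1 y)) ->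
  forall y, Q y.
Proof.
move=> A Q Q0 Q1 y; have [z zy] := arcs_conn A y.
apply: (porbit_ind _ zy) => // w Qw.
by have [<-//|nE] := eqVneq (f (h (s1 w))) (s1 w); apply: Q1.
Qed.

(** First return maps are compatible with gluing at old points. *)
Lemma arcs_tperm G0 G1 (s0 : {perm G0}) (s1 : {perm G1}) f h x y :
  arcs s0 s1 f h -> arcs (s0 * tperm x y) (s1 * tperm (f x) (f y)) f h.
Proof.
move=> A; have fK := arcsK A; split=> //.
  move=> w; rewrite !permM; have E := arcs_next A w.
  case: (tpermP (f x)) => [xE|yE|/eqP nx /eqP ny].
  - by move: E; rewrite xE !fK !eqxx => <-; rewrite tpermL.
  - by move: E; rewrite yE !fK !eqxx => <-; rewrite tpermR.
  - rewrite {1}E; case: eqP => // hw; rewrite -hw in nx ny.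
    have xE : x != s0 (h w) by rewrite E hw eqxx in nx; apply: contraNneq nx => ->.
    have yE : y != s0 (h w) by rewrite E hw eqxx in ny; apply: contraNneq ny => ->.
    by rewrite tpermD.
apply: (arcs_ind A) => [z|w]; first by exists z.
move=> nE [z zE]; exists z; rewrite zE -(porbit_step _ w) permM tpermD //.
  by apply: contraNneq nE => <-; rewrite fK.
by apply: contraNneq nE => <-; rewrite fK.
Qed.

Lemma arcs_orbit G0 G1 (s0 : {perm G0}) (s1 : {perm G1}) f h : arcs s0 s1 f h ->
  forall x y, porbit s1 x = porbit s1 y -> porbit s0 (h x) = porbit s0 (h y).
Proof.
move=> A x y E; apply: (porbit_ind (Q := fun y => porbit s0 (h x) = porbit s0 (h y)) _ E) => // z ->.
by rewrite (arcs_next A); case: ifP => // _; rewrite porbit_step.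
Qed.

(** A fresh unlabelled point is inserted after each point. *)
Definition dbl_fun G (s : {perm G}) (x : G * bool) : G * bool :=
  if x.2 then (s x.1, false) else (x.1, true).

Lemma dbl_inj G (s : {perm G}) : injective (dbl_fun s).
Proof. by move=> [x []] [y []] //= [] => [/perm_inj->|->]. Qed.

Definition dbl G (s : {perm G}) : {perm G * bool} := perm (@dbl_inj G s).

Lemma dbl_step G (s : {perm G}) x b : porbit (dbl s) (x, b) = porbit (dbl s) (x, false).
Proof. by case: b => //; rewrite -(porbit_step _ (x, false)) permE. Qed.

Lemma arcs_dbl G (s : {perm G}) : arcs s (dbl s) (fun x => (x, false)) fst.
Proof.
split=> // [[x []]|[x b]]; rewrite ?permE /dbl_fun /= ?xpair_eqE ?eqxx //.
by exists x; rewrite dbl_step.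
Qed.

Lemma dbl_arcs G0 G1 (s0 : {perm G0}) (s1 : {perm G1}) f h : arcs s0 s1 f h ->
  arcs (dbl s0) (dbl s1) (fun x => (f x.1, x.2))
    (fun y => (h y.1, y.2 || (f (h y.1) != y.1))).
Proof.
move=> A; have fK := arcsK A; split.
- by move=> [x b]; rewrite /= fK eqxx orbF.
- move=> [y []]; rewrite !permE /dbl_fun /= !xpair_eqE /=.
    have := arcs_next A y; case: eqP => [_ ->|_ ->] //=.
  by rewrite andbT; case: eqP.
- move=> [y b]; have [z zy] := arcs_conn A y; exists (z, false) => /=.
  rewrite dbl_step.
  apply: (porbit_ind (Q := fun y => porbit (dbl s1) (f z, false) = porbit (dbl s1) (y, false)) _ zy) => // w ->.
  by rewrite -(dbl_step _ w true) -porbit_step permE.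
Qed.

Context (K : eqType).
Implicit Types S T : mcyc K.

(** Points without a label may be added to a presentation without changing the object
    which it presents. *)
Lemma arcs_pres G0 G1 (s0 : {perm G0}) (s1 : {perm G1}) f h lam lam' S (p : G0 -> gap S) :
  arcs s0 s1 f h -> (forall x, lam' (f x) = lam x) ->
  (forall y, f (h y) != y -> lam' y = None) ->
  pres s0 lam p -> pres s1 lam' (p \o h).
Proof.
move=> A lf ln H; have fK := arcsK A.
have labE y a : lam' y = Some a -> f (h y) = y /\ lam (h y) = Some a.
  have [E|/ln->//] := eqVneq (f (h y)) y; by rewrite -lf E.
split.
- by move=> y; apply: pres_gap H _.
- by move=> P /(pres_onto H)[x <-]; exists (f x); rewrite /= fK.
- by move=> y a /labE[_]; apply: pres_lab H _ _.
- by move=> a /(pres_all H)[x xa]; exists (f x); rewrite lf.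
- by move=> x y a /labE[xE xa] /labE[yE ya]; rewrite -xE -yE (pres_inj H xa ya).
- move=> y E /=; rewrite (arcs_next A); case: eqP => // yE.
  apply: (pres_none H); rewrite -lf; have := arcs_next A y; rewrite yE eqxx => <-.
  by rewrite yE.
- move=> y a /labE[yE]; have := arcs_next A y; rewrite yE eqxx => ->.
  exact: pres_some H _ _.
- move=> Q hQ.
  have QE y : Q (f (h y)) <-> Q y.
    move: y; apply: (arcs_ind A) => [z|y nE]; first by rewrite fK.
    by rewrite (arcs_next A) (negbTE nE) => ->; symmetry; apply/hQ/ln.
  have Qf : forall x y, p x = p y -> Q (f x) -> Q (f y).
    apply: (pres_ker H) => x xn.
    have [y yE] : exists y, s1 y = f (s0 x) by exists (s1^-1 (f (s0 x))); rewrite permKV.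
    have hy : h y = x.
      by have := arcs_next A y; rewrite yE fK eqxx => /perm_inj.
    by rewrite -{2}hy QE -yE; apply: hQ; rewrite yE lf.
  by move=> x y E; rewrite -(QE x) -(QE y); apply: Qf.
Qed.

(** Every presentation of [S] contains the smallest one.  An empty component has no
    distinguished point, and any point of its circle will do. *)
Lemma arcs_base G (s : {perm G}) lam S (p : G -> gap S) : pres s lam p ->
  exists f h, [/\ arcs (gap_perm S) s f h, forall y, gap_val (h y) = p y,
    forall x, lam (f x) = gap_lab x & forall y, f (h y) != y -> lam y = None].
Proof.
move=> H.
have /choice[f fP] : forall x : gapT S, exists y, p y = gap_val x /\ lam y = gap_lab x.
  move=> x; have hx := gap_valP x; rewrite /gap_lab; case: (gap_val x) hx => [i|a] hx.
    have [y yE] := pres_onto H hx; exists y; split=> //.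
    by case E : (lam y) => [a|] //; have := pres_lab H E; rewrite yE.
  by have [y yE] := pres_all H hx; exists y; rewrite (pres_lab H yE).
have /choice[h hP] : forall y, exists x : gapT S, gap_val x = p y.
  by move=> y; apply: gap_val_onto; apply: pres_gap H _.
have fK : cancel f h by move=> x; apply: gap_val_inj; rewrite hP (proj1 (fP x)).
exists f, h; split=> //; first last.
- move=> y; case E : (lam y) => [a|] // /eqP[]; apply: (pres_inj H _ E).
  by rewrite (proj2 (fP _)) /gap_lab hP (pres_lab H E).
- by move=> x; case: (fP x).
split=> //.
  move=> y; apply: gap_val_inj; rewrite hP; case E : (lam (s y)) => [a|].
    have -> : f (h (s y)) = s y.
      apply: (pres_inj H _ E); rewrite (proj2 (fP _)) /gap_lab hP (pres_lab H E) //.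
    by rewrite eqxx permE gap_nextE hP (pres_some H E) next_pregap (pres_lab H E).
  rewrite (pres_none H E); case: eqP => // sE.
  have : gap_lab (h (s y)) = None by rewrite -(proj2 (fP _)) sE.
  rewrite permE gap_nextE /gap_lab !hP (pres_none H E).
  by case: (p y).
move=> y; exists (h y); apply/(pres_comp H); rewrite (proj1 (fP _)) hP //.
Qed.
End Arcs.

(** * Disjoint unions and merges *)
Section Sums.
Context (K : eqType).
Implicit Types (S T : mcyc K) (G : finType).
Local Open Scope group_scope.

Section Sum.
Context S T (d : mdisj S T).

Definition sum_cyc (c : cpnt S + cpnt T) := match c with inl i => cyc i | inr j => cyc j end.

Lemma sum_gt0 : (0 < #|{: cpnt S + cpnt T}|)%N.
Proof. by rewrite card_sum addn_gt0 cpnt_gt0. Qed.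

Lemma sum_uniq c : uniq (sum_cyc c).
Proof. by case: c => i; apply: cyc_uniq. Qed.

Lemma sum_disj c c' x : x \in sum_cyc c -> x \in sum_cyc c' -> c = c'.
Proof.
case: c c' => [i|j] [i'|j'] /= xc xc'.
- by rewrite (cyc_disj xc xc').
- by case: (mdisjP d xc xc').
- by case: (mdisjP d xc' xc).
- by rewrite (cyc_disj xc xc').
Qed.

Definition mcsum : mcyc K := MCyc sum_gt0 sum_uniq sum_disj.

Definition suml (P : gap S) : gap mcsum := match P with inl i => inl (inl i) | inr a => inr a end.
Definition sumr (P : gap T) : gap mcsum := match P with inl i => inl (inr i) | inr a => inr a end.

Lemma lab_sum a : (a \in lab mcsum) = (a \in lab S) || (a \in lab T).
Proof.
apply/labP/orP => [[[i|j]] /= h|[]/labP[i ai]]; [left|right|exists (inl i)|exists (inr i)] => //.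
  exact: mem_lab h.
exact: mem_lab h.
Qed.

Lemma after_suml a : a \in lab S -> after mcsum a = after S a.
Proof.
case/labP => i ai; have [p [q E]] : exists p q, cyc i = p ++ a :: q by case/splitPr: ai => p q; exists p, q.
by rewrite (after_mid E) (@after_mid _ mcsum (inl i) _ _ _ E).
Qed.

Lemma after_sumr a : a \in lab T -> after mcsum a = after T a.
Proof.
case/labP => i ai; have [p [q E]] : exists p q, cyc i = p ++ a :: q by case/splitPr: ai => p q; exists p, q.
by rewrite (after_mid E) (@after_mid _ mcsum (inr i) _ _ _ E).
Qed.

Lemma mdisj_lab a : a \in lab S -> a \in lab T -> False.
Proof. by case/labP => i ai /labP[j aj]; apply: (mdisjP d ai aj). Qed.

(** Merging two objects is contracting their disjoint union, so that the results on
    contractions apply to merges. *)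
Section MergeContract.
Context (u v : K) (uv : u != v) (uS : u \in lab S) (vT : v \in lab T).

Lemma sum_vu : v \notin after mcsum u.
Proof. by rewrite after_suml //; apply/negP => /after_lab vS; apply: mdisj_lab vT. Qed.

Lemma sum_walk : walk mcsum u v = after S u ++ after T v.
Proof. by rewrite /walk (negbTE sum_vu) (after_suml uS) (after_sumr vT). Qed.

Lemma sum_walk' : walk mcsum v u = after T v ++ after S u.
Proof.
rewrite /walk (after_suml uS) (after_sumr vT) ifF //; apply/negP => /after_lab uT.
exact: mdisj_lab uS uT.
Qed.

Lemma merge_of_valid (c : cpnt (mccontract mcsum uv)) :
  merge_index (S := S) (T := T) u v (if val c is inl c' then Some c' else None).
Proof. by case: c => [[[i|j]|b]] //= /andP[]. Qed.

Definition merge_of (c : cpnt (mccontract mcsum uv)) : cpnt (mcmerge d u v) :=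
  exist (fun c => is_true (merge_index u v c)) _ (merge_of_valid c).

Lemma merge_of_bij : bijective merge_of.
Proof.
apply: inj_card_bij.
  move=> c c' /(congr1 val) /= E; apply: val_inj; move: E.
  case: c c' => [[c|b] hb] [[c'|b'] hb'] //= => [[->] //|_].
  have nb b0 : contract_index (S := mcsum) u v (inr b0) -> b0 = false.
    by case: b0 => //=; rewrite (negbTE sum_vu).
  by rewrite (nb _ hb) (nb _ hb').
have := card_merge d uS vT; have := @card_contract _ mcsum u v uv.
rewrite !lab_sum uS vT orbT (negbTE sum_vu) => /(_ isT isT) E1 E2.
have E3 : #|cpnt mcsum| = (#|cpnt S| + #|cpnt T|)%N by rewrite /= card_sum.
by rewrite E1 E3 -E2.
Qed.

Lemma merge_of_rot c : is_rot (map id (cyc c)) (cyc (merge_of c)).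
Proof.
exists 0%N; rewrite rot0 map_id; case: c => [[[i|j]|b] hb] //=; rewrite /merge_cyc /contract_cyc /=.
by case: b hb => /= [|_]; [rewrite (negbTE sum_vu)|rewrite sum_walk].
Qed.

Definition merge_iso : iso (mccontract mcsum uv) (mcmerge d u v) := Iso merge_of_bij merge_of_rot.

Lemma merge_iso_start c c' t : merge_of c = c' ->
  act_gap merge_iso (start_gap c t) = start_gap c' t.
Proof. by case: t => [|x t] //= ->. Qed.

Lemma merge_iso_l (P : gap S) : is_gap P ->
  act_gap merge_iso (@gapx _ mcsum u v uv (suml P)) = gapl d u v P.
Proof.
case: P => [i|x] hP.
  congr inl; apply: val_inj; rewrite /= val_insubd /= !val_insubd /=.
  by move: hP => /= /nilP ->.
have xv : x != v by apply/eqP => E; apply: (@mdisj_lab v) => //; rewrite -E.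
rewrite /suml; have [->|xu] := eqVneq x u.
  by rewrite gapxu /gapl eqxx sum_walk; apply: merge_iso_start; apply: val_inj.
by rewrite gapx_other // /gapl (negbTE xu).
Qed.

Lemma merge_iso_r (P : gap T) : is_gap P ->
  act_gap merge_iso (@gapx _ mcsum u v uv (sumr P)) = gapr d u v P.
Proof.
case: P => [i|x] hP.
  congr inl; apply: val_inj; rewrite /= val_insubd /= !val_insubd /=.
  by move: hP => /= /nilP ->.
have xu : x != u by apply/eqP => E; apply: (@mdisj_lab u) => //; rewrite -E.
rewrite /sumr; have [->|xv] := eqVneq x v.
  rewrite gapxv /gapr eqxx sum_walk'; apply: merge_iso_start; apply: val_inj.
  by rewrite /= (c1_out _ sum_vu).
by rewrite gapx_other // /gapr (negbTE xv).
Qed.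
End MergeContract.

Lemma sum_gap_cases (P : gap mcsum) : is_gap P ->
  (exists2 R : gap S, is_gap R & P = suml R) \/ (exists2 R : gap T, is_gap R & P = sumr R).
Proof.
case: P => [[i|j]|a] hP; [left; exists (inl i)|right; exists (inl j)|] => //.
by move: hP; rewrite /is_gap lab_sum => /orP[h|h]; [left|right]; exists (inr a).
Qed.

Lemma is_suml P : is_gap P -> is_gap (suml P).
Proof. by case: P => [i|a] //= aS; rewrite lab_sum aS. Qed.

Lemma is_sumr P : is_gap P -> is_gap (sumr P).
Proof. by case: P => [i|a] //= aS; rewrite lab_sum aS orbT. Qed.

Lemma suml_pregap a : a \in lab S -> pregap mcsum a = suml (pregap S a).
Proof. by move=> aS; rewrite /pregap after_suml. Qed.

Lemma sumr_pregap a : a \in lab T -> pregap mcsum a = sumr (pregap T a).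
Proof. by move=> aS; rewrite /pregap after_sumr. Qed.

Lemma suml_inj : injective suml.
Proof. by move=> [i|a] [j|b] //= [->]. Qed.

Lemma sumr_inj : injective sumr.
Proof. by move=> [i|a] [j|b] //= [->]. Qed.

Lemma sum_neq P R : is_gap P -> is_gap R -> suml P = sumr R -> False.
Proof. by case: P R => [i|a] [j|b] //= aS bT [E]; apply: (mdisj_lab aS); rewrite E. Qed.

End Sum.

Definition sum_fun G1 G2 (s1 : {perm G1}) (s2 : {perm G2}) (x : G1 + G2) : G1 + G2 :=
  match x with inl y => inl (s1 y) | inr y => inr (s2 y) end.

Lemma sum_fun_inj G1 G2 (s1 : {perm G1}) (s2 : {perm G2}) : injective (sum_fun s1 s2).
Proof. by move=> [x|x] [y|y] //= [/perm_inj->]. Qed.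

Definition sump G1 G2 (s1 : {perm G1}) (s2 : {perm G2}) : {perm G1 + G2} :=
  perm (@sum_fun_inj _ _ s1 s2).

Definition sum_case (X G1 G2 : Type) (f : G1 -> X) (g : G2 -> X) (x : G1 + G2) :=
  match x with inl y => f y | inr y => g y end.

Lemma sump_tperm G1 G2 (s1 : {perm G1}) (s2 : {perm G2}) x y :
  sump (s1 * tperm x y) s2 = sump s1 s2 * tperm (inl x) (inl y).
Proof.
have E t (z : G1 + G2) : sump t s2 z = sum_fun t s2 z by rewrite permE.
apply/permP => -[z|z]; rewrite permM !E /= ?permM.
  by apply: (inj_tperm (f := inl)) => ? ? [].
by rewrite tpermD.
Qed.

Lemma pres_sum G1 G2 (s1 : {perm G1}) (s2 : {perm G2}) lam1 lam2 S T (d : mdisj S T)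
    (p : G1 -> gap S) (q : G2 -> gap T) :
  pres s1 lam1 p -> pres s2 lam2 q ->
  pres (sump s1 s2) (sum_case lam1 lam2) (sum_case (suml d \o p) (sumr d \o q)).
Proof.
move=> H1 H2; split.
- by move=> [x|x] /=; [apply/is_suml/(pres_gap H1)|apply/is_sumr/(pres_gap H2)].
- move=> P /sum_gap_cases[[R hR ->]|[R hR ->]].
    by have [x <-] := pres_onto H1 hR; exists (inl x).
  by have [x <-] := pres_onto H2 hR; exists (inr x).
- by move=> [x|x] a /=; [move=> /(pres_lab H1) ->|move=> /(pres_lab H2) ->].
- move=> a; rewrite lab_sum => /orP[/(pres_all H1)|/(pres_all H2)] [x xa].
    by exists (inl x).
  by exists (inr x).
- move=> [x|x] [y|y] a /= xa ya.
  + by rewrite (pres_inj H1 xa ya).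
  + by case: (mdisj_lab d (pres_in H1 xa) (pres_in H2 ya)).
  + by case: (mdisj_lab d (pres_in H1 ya) (pres_in H2 xa)).
  + by rewrite (pres_inj H2 xa ya).
- by move=> [x|x]; rewrite permE /=; [move=> /(pres_none H1) ->|move=> /(pres_none H2) ->].
- move=> [x|x] a; rewrite permE /= => h.
    by rewrite (pres_some H1 h) suml_pregap // (pres_in H1 h).
  by rewrite (pres_some H2 h) sumr_pregap // (pres_in H2 h).
- move=> Q hQ [x|x] [y|y] /=.
  + move=> /suml_inj; apply: (pres_ker H1 (Q := Q \o inl)) => z zn.
    by have := hQ (inl z); rewrite permE /=; apply.
  + by move=> /(sum_neq (pres_gap H1 x) (pres_gap H2 y)).
  + by move=> /esym/(sum_neq (pres_gap H1 y) (pres_gap H2 x)).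
  + move=> /sumr_inj; apply: (pres_ker H2 (Q := Q \o inr)) => z zn.
    by have := hQ (inr z); rewrite permE /=; apply.
Qed.

Definition gap_merge S T (d : mdisj S T) u v (P : gap (mcsum d)) : gap (mcmerge d u v) :=
  match P with
  | inl (inl i) => gapl d u v (inl i)
  | inl (inr j) => gapr d u v (inl j)
  | inr a => if a \in lab S then gapl d u v (inr a) else gapr d u v (inr a)
  end.

Lemma gap_mergel S T (d : mdisj S T) u v P : is_gap P ->
  gap_merge u v (suml d P) = gapl d u v P.
Proof. by case: P => [i|a] //= ->. Qed.

Lemma gap_merger S T (d : mdisj S T) u v P : is_gap P ->
  gap_merge u v (sumr d P) = gapr d u v P.
Proof.
case: P => [i|a] //= aT; case: ifPn => // aS.
by case: (mdisj_lab d aS aT).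
Qed.

Lemma pres_merge G (s : {perm G}) lam S T (d : mdisj S T) (p : G -> gap (mcsum d)) x y u v :
  pres s lam p -> lam x = Some u -> lam y = Some v -> u \in lab S -> v \in lab T ->
  pres (s * tperm x y) (erase2 lam x y) (gap_merge u v \o p).
Proof.
move=> H xu yv uS vT; have uv : u != v.
  by apply/eqP => E; apply: (mdisj_lab d uS); rewrite E.
have := pres_iso (merge_iso d uv uS vT) (pres_contract uv H xu yv).
apply: pres_ext => z /=; first by case: (erase2 _ _ _ _).
have := pres_gap H z => /sum_gap_cases[[R hR ->]|[R hR ->]].
  by rewrite merge_iso_l // gap_mergel.
by rewrite merge_iso_r // gap_merger.
Qed.

Lemma disc_gt0 : (0 < #|{: unit}|)%N. Proof. by rewrite card_unit. Qed.

Definition disc (l : seq K) (ul : uniq l) : mcyc K :=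
  @MCyc K unit (fun _ => l) disc_gt0 (fun _ => ul) (fun i j _ _ _ => match i, j with tt, tt => erefl end).

Lemma disc_comp l (ul : uniq l) : #|cpnt (disc ul)| == 1%N.
Proof. by rewrite card_unit. Qed.

(** Used for the annulus, which is cut by two arcs into two discs. *)
Lemma split_two S (i0 j0 : cpnt S) : i0 != j0 -> #|cpnt S| = 2 ->
  exists d : mdisj (disc (cyc_uniq i0)) (disc (cyc_uniq j0)),
  exists r : iso S (mcsum d), on_lab r = id.
Proof.
move=> ij c2.
have d : mdisj (disc (cyc_uniq i0)) (disc (cyc_uniq j0)).
  apply/forallP => -[] /=; apply/hasPn => x xi; apply/negP => /labP[[] /= xj].
  by rewrite (cyc_disj xi xj) eqxx in ij.
have two (i : cpnt S) : (i == i0) || (i == j0).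
  apply: contraT => ni; have : (#|[:: i; i0; j0]| <= #|cpnt S|)%N by apply: max_card.
  by rewrite c2 (card_uniqP _) //= !inE ij ni.
pose c (i : cpnt S) : cpnt (mcsum d) := if i == i0 then inl tt else inr tt.
have cb : bijective c.
  exists (fun z => if z is inl _ then i0 else j0) => [i|[[]|[]]]; rewrite /c ?eqxx //.
    by have := two i; case: eqVneq => [->|_ /eqP->].
  by rewrite eq_sym (negbTE ij).
have cr i : is_rot (map id (cyc i)) (cyc (c i)).
  exists 0%N; rewrite rot0 map_id /c; have := two i; case: eqVneq => [->|_ /eqP->] //.
by exists d, (Iso cb cr).
Qed.
End Sums.

(** * Marking points with labels *)
Section Marks.
Context (K : eqType) (G : finType).
Implicit Types (lam : G -> option K).

Definition mark2 lam (x y : G) (u v : K) : G -> option K := fun z =>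
  if z == x then Some u else if z == y then Some v else lam z.

Lemma mark2l lam x y u v : mark2 lam x y u v x = Some u.
Proof. by rewrite /mark2 eqxx. Qed.

Lemma mark2r lam x y u v : x != y -> mark2 lam x y u v y = Some v.
Proof. by rewrite /mark2 eqxx eq_sym => /negbTE->. Qed.

Lemma mark2_out lam x y u v z : z != x -> z != y -> mark2 lam x y u v z = lam z.
Proof. by rewrite /mark2 => /negbTE-> /negbTE->. Qed.

Lemma mark2K lam x y u v : lam x = None -> lam y = None ->
  erase2 (mark2 lam x y u v) x y =1 lam.
Proof.
move=> xn yn z; rewrite /erase2; case: eqVneq => [->|zx] //=.
by case: eqVneq => [->|zy] //; rewrite mark2_out.
Qed.

Definition lab_inj lam := forall x y a, lam x = Some a -> lam y = Some a -> x = y.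

Lemma mark2_inj lam x y u v : lab_inj lam -> u != v ->
  (forall z, lam z != Some u) -> (forall z, lam z != Some v) ->
  lab_inj (mark2 lam x y u v).
Proof.
move=> inj uv nu nv z w a; rewrite /mark2.
case: (eqVneq z x) => [->|zx].
  move=> [<-]; case: (eqVneq w x) => [->//|_].
  case: (eqVneq w y) => [_ [vu]|_ wu]; first by rewrite vu eqxx in uv.
  by have := nu w; rewrite wu eqxx.
case: (eqVneq z y) => [->|zy].
  move=> [<-]; case: (eqVneq w x) => [_ [vu]|_]; first by rewrite vu eqxx in uv.
  by case: (eqVneq w y) => [->//|_ wv]; have := nv w; rewrite wv eqxx.
move=> za; case: (eqVneq w x) => [_ [ua]|_]; first by have := nu z; rewrite za ua eqxx.
case: (eqVneq w y) => [_ [ua]|_]; first by have := nv z; rewrite za ua eqxx.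
exact: inj za.
Qed.
End Marks.

Lemma tpermKK (G : finType) (s : {perm G}) x y : (s * tperm x y * tperm x y = s)%g.
Proof. by rewrite -mulgA tperm2 mulg1. Qed.

Lemma tperm_comm (G : finType) (x y z w : G) : uniq [:: x; y; z; w] ->
  (tperm x y * tperm z w = tperm z w * tperm x y)%g.
Proof.
rewrite /= !inE !negb_or => /and4P[/and3P[xy xz xw] /andP[yz yw] zw _].
have E : (tperm z w ^ tperm x y = tperm z w)%g by rewrite tpermJ !tpermD.
by rewrite -{1}E conjgE mulKVg.
Qed.

(** * Fresh labels *)
Section Fresh.
Context (K : eqType) (Kinf : infinite_set [set: K]).

Definition labs (S : mcyc K) : seq K := flatten [seq cyc i | i <- enum (cpnt S)].

Lemma mem_labs S a : (a \in labs S) = (a \in lab S).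
Proof.
apply/flatten_mapP/labP => [[i _ ai]|[i ai]]; first by exists i.
by exists i; rewrite ?mem_enum.
Qed.

Lemma fresh (l : seq K) : exists a, a \notin l.
Proof.
apply: contrapT => h; apply: Kinf; apply/finite_seqP; exists l.
apply/seteqP; split=> // a _ /=; apply: contrapT => /negP al.
by apply: h; exists a.
Qed.

Lemma fresh2 (l : seq K) S : exists u v,
  [/\ u != v, u \notin l, v \notin l, u \notin lab S & v \notin lab S].
Proof.
have notin_cat a (l1 l2 : seq K) : a \notin l1 ++ l2 -> a \notin l1 /\ a \notin l2.
  by rewrite mem_cat negb_or => /andP[].
have [u /notin_cat[ul]] := fresh (l ++ labs S); rewrite mem_labs => uS.
have [v /notin_cat[vl]] := fresh ((u :: l) ++ labs S); rewrite mem_labs => vS.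
move: vl; rewrite inE negb_or => /andP[vu vl].
by exists u, v; rewrite eq_sym.
Qed.
End Fresh.

(** * Arithmetic of genus and boundary components *)

Definition geomn (b g : nat) := (b <= g.+1) && ~~ odd (g.+1 - b).

(** In the next lemmas a chord is added, and [e] says whether its endpoints lie on
    different circles: if so the number of circles decreases by one, if not it
    increases by one. *)
Lemma geomn_cut n n1 g (e : bool) :
  geomn n1 g.+1 -> n + e.*2 = n1.+1 -> n <= g.+1 -> geomn n g.
Proof. by rewrite /geomn; case: e => /=; lia. Qed.

Lemma geomn_stuck n n1 g (e : bool) :
  geomn n1 g.+1 -> n + e.*2 = n1.+1 -> g.+1 < n -> 1 < n1.
Proof. by rewrite /geomn; case: e => /=; lia. Qed.

Lemma geomn_separated n m k g (e : bool) :
  geomn n g.+1 -> m + e.*2 = k.+1 -> m + true.*2 = n.+1 -> geomn m g /\ geomn k g.+1.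
Proof. by rewrite /geomn; case: e => /=; lia. Qed.

Lemma geomn_first b m g (e : bool) :
  geomn b g.+1 -> m + e.*2 = b.+1 -> 0 < m -> 0 < b -> (1 < b -> e) -> geomn m g.
Proof.
rewrite /geomn; case: (ltnP 1 b) => [b1|b1]; case: e => /=; lia.
Qed.

Lemma geometricE (K : eqType) (S : mcyc K) g : geometric S g = geomn #|cpnt S| g.
Proof. by []. Qed.

Definition dlam (K : eqType) (G : finType) (lam : G -> option K) (x : G * bool) :=
  if x.2 then None else lam x.1.

Lemma pres_dbl (K : eqType) (G : finType) (s : {perm G}) lam (S : mcyc K) (p : G -> gap S) :
  pres s lam p -> pres (dbl s) (dlam lam) (p \o fst).
Proof.
move=> H; apply: (arcs_pres (arcs_dbl s) _ _ H) => //.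
by move=> [x []] //=; rewrite eqxx.
Qed.

Lemma porbits_gt0 (G : finType) (s : {perm G}) : G -> 0 < #|porbits s|.
Proof. by move=> x; apply/card_gt0P; exists (porbit s x); apply: imset_f. Qed.

Lemma porbits_two (G : finType) (s : {perm G}) : 1 < #|porbits s| ->
  exists x y, porbit s x != porbit s y.
Proof.
case/card_gt1P => O1 [O2 [/imsetP[x _ ->] /imsetP[y _ ->] xy]].
by exists x, y.
Qed.

(** Two nontrivial equivalence relations separate a common pair: given [x, y]
    separated by the first one and [z'] separated from [x] by the second one, either
    [x, y] or [z', x] or [z', y] is such a pair. *)
Lemma porbits_two_both (G : finType) (s t : {perm G}) :
  1 < #|porbits s| -> 1 < #|porbits t| ->
  exists x y, porbit s x != porbit s y /\ porbit t x != porbit t y.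
Proof.
move=> /porbits_two[x [y xy]] /porbits_two[z [w zw]].
have [E|] := eqVneq (porbit t x) (porbit t y); last by exists x, y.
have [z' z'E] : exists z', porbit t z' != porbit t x.
  have [E'|] := eqVneq (porbit t z) (porbit t x); last by exists z.
  by exists w; rewrite eq_sym -E'.
have [Ex|nx] := eqVneq (porbit s z') (porbit s x); last by exists z', x.
by exists z', y; rewrite Ex -E.
Qed.

(** * Contractions of discs *)

Section Good.
Context (K : eqType) (Kinf : infinite_set [set: K]).
Context (P : mcyc K -> nat -> Type) (O : modop_ops P) (A : modop_axioms O).
Context (m : forall C : cycl K, P C 0).
Hypothesis m_act : forall (C D : cycl K) (r : iso C D), mact O r erefl (m C) = m D.
Hypothesis m_comp : forall (C D : cycl K) (d : mdisj C D) u v (uC : u \in lab C)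
  (vD : v \in lab D), mcomp O d uC vD (m C) (m D) = m (cmerge d uC vD).
Implicit Types (S T : mcyc K) (G : finType).

(** The elements forced by the [m C]: what a morphism out of the linear span of the
    terminal operad can reach.  Compositions are not among the constructors; that
    they preserve these elements is [good_comp]. *)
Inductive good : forall S g, P S g -> Prop :=
| good_m (C : cycl K) : @good C 0 (m C)
| good_xi S u v (uv : u != v) (uS : u \in lab S) (vS : v \in lab S) g (x : P S g) :
    good x -> good (mxi O uv uS vS x)
| good_act S T g h (r : iso S T) (e : g = h) (x : P S g) : good x -> good (mact O r e x).

Lemma good_geometric S g (x : P S g) : good x -> geometric S g.
Proof.
elim=> {S g x} [C|S u v uv uS vS g x _ IH|S T g h r e x _ IH].
- by rewrite geometricE (eqP (cycl_comp C)).
- exact: geometric_contract.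
- exact: geometric_iso r e IH.
Qed.

Lemma act_gap_comp S T U (r' : iso T U) (r : iso S T) R :
  act_gap (comp_iso r' r) R = act_gap r' (act_gap r R).
Proof. by case: R. Qed.

Lemma act_gap_id S R : act_gap (id_iso S) R = R.
Proof. by case: R. Qed.

Lemma mact_pres G (s : {perm G}) lam S (p : G -> gap S) T (r r' : iso S T) g h (e e' : g = h) x :
  pres s lam p -> (forall t, act_gap r (p t) = act_gap r' (p t)) ->
  mact O r e x = mact O r' e' x.
Proof.
move=> H rr'; apply: (mact_ext A); apply: iso_ext => R /(pres_onto H)[t <-]; exact: rr'.
Qed.

(** The isomorphism of [pres_uniq] in the other direction undoes [r]. *)
Lemma good_act_inv G (s : {perm G}) lam S T (p : G -> gap S) (q : G -> gap T)
    (r : iso S T) g h (e : g = h) (x : P S g) :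
  pres s lam p -> pres s lam q -> (forall t, act_gap r (p t) = q t) ->
  good (mact O r e x) -> good x.
Proof.
move=> Hp Hq rE gx.
have [|r' r'E] := pres_uniq (f := id) Hq (_ : pres s _ p).
  by apply: pres_ext Hp => // t /=; case: (lam t).
have -> : x = mact O r' (esym e) (mact O r e x).
  rewrite -(mact_comp A) -[LHS](mact_id A); apply: (mact_pres _ _ _ Hp) => t.
  by rewrite act_gap_id act_gap_comp rE r'E.
exact: good_act.
Qed.

Lemma pres_uniq_id G (s : {perm G}) lam S T (p : G -> gap S) (q : G -> gap T) :
  pres s lam p -> pres s lam q -> exists r : iso S T, forall t, act_gap r (p t) = q t.
Proof.
move=> Hp Hq; apply: (pres_uniq (f := id) Hp).
by apply: pres_ext Hq => // t /=; case: (lam t).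
Qed.

Lemma mxi_act_eq S S' (r : iso S S') u v u' v' (uv : u != v) (uv' : u' != v')
    (uS : u \in lab S) (vS : v \in lab S) (uS' : u' \in lab S') (vS' : v' \in lab S')
    g (x : P S g) (t : iso (mccontract S uv) (mccontract S' uv')) :
  on_lab r u = u' -> on_lab r v = v' ->
  same_gaps t (gapx uv) (gapx uv' \o act_gap r) ->
  mact O t erefl (mxi O uv uS vS x) = mxi O uv' uS' vS' (mact O r erefl x).
Proof. by move=> E E'; subst; apply: (mxi_act A). Qed.

Lemma good0 S g (x : P S g) : good x -> forall (h : #|cpnt S| == 1) (e : 0 = g),
  x = mact O (id_iso S) e (m (Cycl h)).
Proof.
elim=> {S g x} [C|S u v uv uS vS g x _ _|S T g h r e x _ IH] hc e0 //.
  rewrite (eq_irrelevance e0 erefl) (mact_id A).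
  by case: C hc => C hC /= hc; rewrite (eq_irrelevance hC hc).
have hS : #|cpnt S| == 1 by rewrite (bij_eq_card (on_comp_bij r)).
subst h; rewrite (IH hS e0); subst g; rewrite (mact_id A).
by rewrite [RHS](mact_id A); apply: (m_act (C := Cycl hS) (D := Cycl hc)).
Qed.

Lemma good0_m S (x : P S 0) (h : #|cpnt S| == 1) : good x -> x = m (Cycl h).
Proof. by move=> /good0/(_ h erefl); rewrite (mact_id A). Qed.

Lemma good_geom0 S (x : P S 0) : good x -> #|cpnt S| == 1.
Proof. by move=> /good_geometric; rewrite geometricE /geomn; have := cpnt_gt0 S; lia. Qed.

Lemma good_contract S g (x : P S g) : good x -> forall g0 (e : g0.+1 = g),
  exists S' u v (uv : u != v) (uS : u \in lab S') (vS : v \in lab S') (z : P S' g0)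
    (r : iso (mccontract S' uv) S), good z /\ x = mact O r e (mxi O uv uS vS z).
Proof.
elim=> {S g x} [C|S u v uv uS vS g x gx _|S T g h r e x _ IH] g0 e0 //.
  case: e0 (e0) => E; subst g0 => e0; exists S, u, v, uv, uS, vS, x, (id_iso _); split=> //.
  by rewrite (eq_irrelevance e0 erefl) (mact_id A).
subst h; have [S' [u [v [uv [uS [vS [z [r' [gz ->]]]]]]]]] := IH _ e0.
exists S', u, v, uv, uS, vS, z, (comp_iso r r'); split=> //.
by rewrite -(mact_comp A); apply: (mact_ext A).
Qed.

(** * Cutting along chords *)
Section Chords.
Context (g : nat) (S : mcyc K).

(** A chord is a pair [x, y] of unlabelled points on the boundary of the surface
    presented by [s]: cutting along it gives the surface presented by
    [s * tperm x y], on whose boundary the two sides of the cut are labelled [u] and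
    [v].  The values of the chord are the elements obtained by gluing them back
    together. *)
Definition chord_val G (s : {perm G}) lam (p : G -> gap S) x y u v (w : P S g.+1) : Prop :=
  exists S' (uv : u != v) (uS : u \in lab S') (vS : v \in lab S') (z : P S' g)
    (p' : G -> gap S') (r : iso (mccontract S' uv) S),
  [/\ good z, pres (s * tperm x y)%g (mark2 lam x y u v) p',
      forall t, act_gap r (gapx uv (p' t)) = p t &
      w = mact O r erefl (mxi O uv uS vS z)].

Lemma chord_good G (s : {perm G}) lam (p : G -> gap S) x y u v w :
  chord_val s lam p x y u v w -> good w.
Proof.
by case=> S' [uv [uS [vS [z [p' [r [gz _ _ ->]]]]]]]; apply/good_act/good_xi.
Qed.

Lemma chord_geom G (s : {perm G}) lam (p : G -> gap S) x y u v w :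
  chord_val s lam p x y u v w -> geomn #|porbits (s * tperm x y)%g| g.
Proof.
case=> S' [uv [uS [vS [z [p' [r [gz H _ _]]]]]]].
by have := good_geometric gz; rewrite geometricE (pres_card H).
Qed.

Lemma chord_ext G (s : {perm G}) lam (p p' : G -> gap S) x y u v w :
  p =1 p' -> chord_val s lam p x y u v w -> chord_val s lam p' x y u v w.
Proof. by move=> /funext ->. Qed.

Lemma chord_arcs G0 G1 (s0 : {perm G0}) (s1 : {perm G1}) f h lam lam' (p : G0 -> gap S) x y u v w :
  arcs s0 s1 f h -> (forall x, lam' (f x) = lam x) ->
  (forall y, f (h y) != y -> lam' y = None) ->
  chord_val s0 lam p x y u v w -> chord_val s1 lam' (p \o h) (f x) (f y) u v w.
Proof.
move=> Ar lf ln [S' [uv [uS [vS [z [p' [r [gz H rE ->]]]]]]]].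
have fI := can_inj (arcsK Ar).
exists S', uv, uS, vS, z, (p' \o h), r; split=> //; last by move=> t /=; rewrite rE.
apply: (arcs_pres (arcs_tperm x y Ar) _ _ H) => [t|t nt].
  by rewrite /mark2 !(inj_eq fI) lf.
rewrite mark2_out; first exact: ln.
  by apply: contraNneq nt => ->; rewrite (arcsK Ar).
by apply: contraNneq nt => ->; rewrite (arcsK Ar).
Qed.

Lemma contract_mark G (s : {perm G}) lam T (q : G -> gap T) x y u v (uv : u != v) :
  pres (s * tperm x y)%g (mark2 lam x y u v) q ->
  x != y -> lam x = None -> lam y = None ->
  pres s lam (gapx uv \o q).
Proof.
move=> H xy xn yn; have := pres_contract uv H (mark2l _ _ _ _ _) (mark2r _ _ _ xy).
by rewrite tpermKK; apply: pres_ext => //; apply: mark2K.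
Qed.

Section OneChord.
Context G (s : {perm G}) lam (p : G -> gap S) (Hp : pres s lam p).
Context (x y : G) (xy : x != y) (xn : lam x = None) (yn : lam y = None).
Context (u v : K) (uv : u != v) (uS : u \notin lab S) (vS : v \notin lab S).

Lemma lab_fresh a : a \notin lab S -> forall z, lam z != Some a.
Proof. by move=> aS z; apply: contraNneq aS => /(pres_in Hp). Qed.

Lemma mark2_fresh_inj : lab_inj (mark2 lam x y u v).
Proof. apply: mark2_inj => //; [exact: (pres_inj Hp)|exact: lab_fresh|exact: lab_fresh]. Qed.

Lemma chord_ex :
  (forall T, geometric T g -> exists z : P T g, good z) ->
  geomn #|porbits (s * tperm x y)%g| g -> exists w, chord_val s lam p x y u v w.
Proof.
move=> ex gm; have G0 : 0 < #|G| by apply/card_gt0P; exists x.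
have H := pres_realize (s * tperm x y)%g mark2_fresh_inj G0.
set T := realize _ _ _ in H; have [|z gz] := ex T; first by rewrite geometricE (pres_card H).
have uT := pres_in H (mark2l _ _ _ _ _); have vT := pres_in H (mark2r _ _ _ xy).
have [r rE] := pres_uniq_id (contract_mark uv H xy xn yn) Hp.
by exists (mact O r erefl (mxi O uv uT vT z)), T, uv, uT, vT, z,
  (realize_gap (s * tperm x y)%g mark2_fresh_inj G0), r.
Qed.

(** Only the class of the cut surface matters, because good elements of the genus
    below are unique. *)
Lemma chord_valE w T (q : G -> gap T) (uT : u \in lab T) (vT : v \in lab T) (Z : P T g) :
  (forall T (z z' : P T g), good z -> good z' -> z = z') ->
  chord_val s lam p x y u v w ->
  pres (s * tperm x y)%g (mark2 lam x y u v) q -> good Z ->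
  exists r : iso (mccontract T uv) S, (forall t, act_gap r (gapx uv (q t)) = p t) /\
    w = mact O r erefl (mxi O uv uT vT Z).
Proof.
move=> un [S' [uv' [uS' [vS' [z [p' [r [gz H rE ->]]]]]]]] Hq gZ.
rewrite (eq_irrelevance uv' uv) in r rE *.
have [r1 r1E] := pres_uniq_id Hq H.
have HT := contract_mark uv Hq xy xn yn; have HS := contract_mark uv H xy xn yn.
have [t tE] := pres_uniq_id HT HS.
have -> : z = mact O r1 erefl Z by apply: un => //; apply: good_act.
have onr a c : mark2 lam x y u v c = Some a -> on_lab r1 a = a.
  by move=> ca; have := r1E c; rewrite (pres_lab Hq ca) (pres_lab H ca) => -[].
exists (comp_iso r t); split.
  by move=> c; rewrite act_gap_comp [act_gap t _]tE /= rE.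
rewrite -(mxi_act_eq (t := t) uT vT uS' vS' Z) ?(onr u x) ?(onr v y) ?mark2l ?mark2r //.
  by rewrite -(mact_comp A); apply: (mact_ext A).
by move=> R /(pres_onto Hq)[c <-]; rewrite [LHS]tE /= r1E.
Qed.
End OneChord.

Lemma chord_sym G (s : {perm G}) lam (p : G -> gap S) x y u v w :
  pres s lam p -> x != y -> lam x = None -> lam y = None ->
  chord_val s lam p x y u v w -> chord_val s lam p y x v u w.
Proof.
move=> Hp xy xn yn [S' [uv [uS [vS [z [p' [r [gz H rE ->]]]]]]]].
have vu : v != u by rewrite eq_sym.
have H' : pres (s * tperm y x)%g (mark2 lam y x v u) p'.
  rewrite tpermC; apply: pres_ext H => // t; rewrite /mark2.
  by case: eqVneq => [->|//]; rewrite (negbTE xy).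
have C1 := contract_mark uv H xy xn yn.
have C2 : pres s lam (gapx vu \o p') by apply: contract_mark H' _ _ _ => //; rewrite eq_sym.
have [r' r'E] := pres_uniq_id C2 Hp; have [t tE] := pres_uniq_id C1 C2.
exists S', vu, vS, uS, z, p', r'; split=> //.
rewrite -(mxi_sym A uS vS z (r := t)); last by move=> R /(pres_onto H)[c <-]; apply: tE.
rewrite -(mact_comp A); apply: (mact_pres _ _ _ C1) => c.
by rewrite act_gap_comp tE r'E /= rE.
Qed.

Section TwoChords.
Context G (s : {perm G}) lam (p : G -> gap S) (Hp : pres s lam p).
Context (x1 x2 x3 x4 : G) (xu : uniq [:: x1; x2; x3; x4]).
Hypothesis xn : forall x, x \in [:: x1; x2; x3; x4] -> lam x = None.
Context (u1 v1 u2 v2 : K) (uu : uniq [:: u1; v1; u2; v2]).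
Hypothesis uS : forall a, a \in [:: u1; v1; u2; v2] -> a \notin lab S.
Hypothesis un : forall T (z z' : P T g), good z -> good z' -> z = z'.

Local Notation t12 := (tperm x1 x2).
Local Notation t34 := (tperm x3 x4).
Local Notation lam4 := (mark2 (mark2 lam x1 x2 u1 v1) x3 x4 u2 v2).

Let ne : [/\ x1 != x2, x3 != x4 & [/\ x1 != x3, x1 != x4, x2 != x3 & x2 != x4]].
Proof. by move: xu; rewrite /= !inE !negb_or => /and4P[/and3P[-> -> ->] /andP[-> ->] ->]. Qed.

Let nu : [/\ u1 != v1, u2 != v2 & [/\ u1 != u2, u1 != v2, v1 != u2 & v1 != v2]].
Proof. by move: uu; rewrite /= !inE !negb_or => /and4P[/and3P[-> -> ->] /andP[-> ->] ->]. Qed.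

Let xn1 : lam x1 = None. Proof. by apply: xn; rewrite !inE eqxx ?orbT. Qed.
Let xn2 : lam x2 = None. Proof. by apply: xn; rewrite !inE eqxx ?orbT. Qed.
Let xn3 : lam x3 = None. Proof. by apply: xn; rewrite !inE eqxx ?orbT. Qed.
Let xn4 : lam x4 = None. Proof. by apply: xn; rewrite !inE eqxx ?orbT. Qed.

Lemma lam4E : lam4 =1 mark2 (mark2 lam x3 x4 u2 v2) x1 x2 u1 v1.
Proof.
case: ne => n12 n34 [n13 n14 n23 n24] t; rewrite /mark2.
case: (eqVneq t x3) => [->|_]; first by rewrite eq_sym (negbTE n13) eq_sym (negbTE n23).
case: (eqVneq t x4) => [->|_] //; by rewrite eq_sym (negbTE n14) eq_sym (negbTE n24).
Qed.

Lemma lam4_inj : lab_inj lam4.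
Proof.
case: nu => m12 m34 [m13 m14 m23 m24].
have nl := lab_fresh Hp.
apply: mark2_inj => //.
- apply: mark2_inj => //; first exact: (pres_inj Hp).
    by apply: nl; apply: uS; rewrite !inE eqxx.
  by apply: nl; apply: uS; rewrite !inE eqxx orbT.
- move=> t; rewrite /mark2; case: ifP => _; first by apply: contra_neq m13 => -[].
  case: ifP => _; first by apply: contra_neq m23 => -[].
  by apply: nl; apply: uS; rewrite !inE eqxx !orbT.
- move=> t; rewrite /mark2; case: ifP => _; first by apply: contra_neq m14 => -[].
  case: ifP => _; first by apply: contra_neq m24 => -[].
  by apply: nl; apply: uS; rewrite !inE eqxx !orbT.
Qed.

Lemma lam4_vals : [/\ lam4 x1 = Some u1, lam4 x2 = Some v1, lam4 x3 = Some u2 & lam4 x4 = Some v2].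
Proof.
case: ne => n12 n34 [n13 n14 n23 n24].
by split; [rewrite lam4E mark2l|rewrite lam4E mark2r|exact: mark2l|exact: mark2r].
Qed.

Lemma erase34 : erase2 lam4 x3 x4 =1 mark2 lam x1 x2 u1 v1.
Proof.
by case: ne => n12 n34 [n13 n14 n23 n24]; apply: mark2K; rewrite mark2_out // eq_sym.
Qed.

Lemma erase12 : erase2 lam4 x1 x2 =1 mark2 lam x3 x4 u2 v2.
Proof.
case: ne => n12 n34 [n13 n14 n23 n24] t.
by rewrite -(mark2K (lam := mark2 lam x3 x4 u2 v2) u1 v1 (x := x1) (y := x2)) ?mark2_out //
  /erase2 lam4E.
Qed.

Lemma t12_34 : (s * t34 = s * t12 * t34 * t12)%g.
Proof. by rewrite -!mulgA (mulgA t12) (tperm_comm xu) -mulgA tperm2 mulg1. Qed.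

(** [Z] and [Z'] live on the surfaces cut along the first and along the second chord.
    In both uses of this lemma the equation between them is an operad axiom, applied
    to the surface cut along both chords. *)
Lemma two_chords (uv1 : u1 != v1) (uv2 : u2 != v2) w w' D D' (Z : P D g) (Z' : P D' g) (pD : G -> gap D) (pD' : G -> gap D')
    (u1D : u1 \in lab D) (v1D : v1 \in lab D) (u2D : u2 \in lab D') (v2D : v2 \in lab D') :
  chord_val s lam p x1 x2 u1 v1 w -> chord_val s lam p x3 x4 u2 v2 w' ->
  good Z -> good Z' ->
  pres (s * t12)%g (mark2 lam x1 x2 u1 v1) pD -> pres (s * t34)%g (mark2 lam x3 x4 u2 v2) pD' ->
  (forall r : iso (mccontract D uv1) (mccontract D' uv2),
     (forall t, act_gap r (gapx uv1 (pD t)) = gapx uv2 (pD' t)) ->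
     mact O r erefl (mxi O uv1 u1D v1D Z) = mxi O uv2 u2D v2D Z') ->
  w = w'.
Proof.
case: ne => n12 n34 _ c1 c2 gZ gZ' H1 H2 rel.
have [r1 [r1E ->]] := chord_valE n12 xn1 xn2 uv1 u1D v1D un c1 H1 gZ.
have [r2 [r2E ->]] := chord_valE n34 xn3 xn4 uv2 u2D v2D un c2 H2 gZ'.
have C1 := contract_mark uv1 H1 n12 xn1 xn2.
have C2 := contract_mark uv2 H2 n34 xn3 xn4.
have [r rE] := pres_uniq_id C1 C2.
rewrite -(rel r rE) -(mact_comp A); apply: (mact_pres _ _ _ C1) => t.
by rewrite act_gap_comp rE /= r1E r2E.
Qed.
End TwoChords.
End Chords.

Section Disjoint.
Context (S : mcyc K) (G : finType) (s : {perm G}) (lam : G -> option K)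
  (p : G -> gap S) (Hp : pres s lam p).
Context (x1 x2 x3 x4 : G) (xu : uniq [:: x1; x2; x3; x4]).
Hypothesis xn : forall x, x \in [:: x1; x2; x3; x4] -> lam x = None.
Context (u1 v1 u2 v2 : K) (uu : uniq [:: u1; v1; u2; v2]).
Hypothesis uS : forall a, a \in [:: u1; v1; u2; v2] -> a \notin lab S.

(** Two chords which together do not disconnect the surface: both values come from
    one element of the surface cut twice, and contractions commute. *)
Lemma disjoint_chords g (w w' : P S g.+2) :
  (forall T (z z' : P T g.+1), good z -> good z' -> z = z') ->
  (forall T, geometric T g -> exists z : P T g, good z) ->
  geomn #|porbits (s * tperm x1 x2 * tperm x3 x4)%g| g ->
  chord_val s lam p x1 x2 u1 v1 w -> chord_val s lam p x3 x4 u2 v2 w' -> w = w'.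
Proof.
move=> un ex gm c1 c2.
have G0 : 0 < #|G| by apply/card_gt0P; exists x1.
have [T [pT H]] : exists T (q : G -> gap T), pres (s * tperm x1 x2 * tperm x3 x4)%g
    (mark2 (mark2 lam x1 x2 u1 v1) x3 x4 u2 v2) q.
  by have H := pres_realize _ (lam4_inj Hp uu uS) G0; eexists; eexists; apply: H.
have [|z gz] := ex T; first by rewrite geometricE (pres_card H).
have [l1 l2 l3 l4] := lam4_vals lam xu u1 v1 u2 v2.
have uv1 : u1 != v1 by move: uu; rewrite /= !inE !negb_or => /and3P[/andP[]].
have uv2 : u2 != v2 by move: uu; rewrite /= !inE => /and4P[].
have H1 : pres (s * tperm x1 x2)%g (mark2 lam x1 x2 u1 v1) (gapx uv2 \o pT).
  have := pres_contract uv2 H l3 l4; rewrite tpermKK.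
  by apply: pres_ext => //; apply: erase34.
have H2 : pres (s * tperm x3 x4)%g (mark2 lam x3 x4 u2 v2) (gapx uv1 \o pT).
  have := pres_contract uv1 H l1 l2; rewrite -(t12_34 s xu).
  by apply: pres_ext => //; apply: erase12.
have n12 : x1 != x2 by move: xu; rewrite /= !inE !negb_or => /and3P[/andP[]].
have n34 : x3 != x4 by move: xu; rewrite /= !inE => /and4P[].
have u1D := pres_in H1 (mark2l _ _ _ _ _); have v1D := pres_in H1 (mark2r _ _ _ n12).
have u2D := pres_in H2 (mark2l _ _ _ _ _); have v2D := pres_in H2 (mark2r _ _ _ n34).
have u1T := pres_in H l1; have v1T := pres_in H l2.
have u2T := pres_in H l3; have v2T := pres_in H l4.
apply: (@two_chords _ _ _ _ _ _ _ _ _ _ xu xn _ _ _ _ un uv1 uv2 _ _ _ _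
  (mxi O uv2 u2T v2T z) (mxi O uv1 u1T v1T z) _ _ u1D v1D u2D v2D c1 c2 _ _ H1 H2).
- exact: good_xi.
- exact: good_xi.
move=> r rE; apply: (mxiC A) => //.
by move=> R /(pres_onto H)[t <-]; have := rE t.
Qed.

(** On an annulus the two chords cut out two discs, and composing these along one
    chord and contracting along the other does not depend on the order.  Here the
    first sides of the two chords lie on the same disc. *)
Lemma annulus_chords_aux (w w' : P S 1) :
  chord_val s lam p x1 x2 u1 v1 w -> chord_val s lam p x3 x4 u2 v2 w' ->
  #|porbits (s * tperm x1 x2 * tperm x3 x4)%g| = 2 ->
  porbit (s * tperm x1 x2 * tperm x3 x4)%g x3 = porbit (s * tperm x1 x2 * tperm x3 x4)%g x1 ->
  w = w'.
Proof.
move=> c1 c2 card2 x31.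
have un T (z z' : P T 0) : good z -> good z' -> z = z'.
  move=> gz gz'; have hT := good_geom0 gz.
  by rewrite (good0_m hT gz) (good0_m hT gz').
have G0 : 0 < #|G| by apply/card_gt0P; exists x1.
have [T [pT H]] : exists T (q : G -> gap T), pres (s * tperm x1 x2 * tperm x3 x4)%g
    (mark2 (mark2 lam x1 x2 u1 v1) x3 x4 u2 v2) q.
  by have H := pres_realize _ (lam4_inj Hp uu uS) G0; eexists; eexists; apply: H.
have uv1 : u1 != v1 by move: uu; rewrite /= !inE !negb_or => /and3P[/andP[]].
have uv2 : u2 != v2 by move: uu; rewrite /= !inE => /and4P[].
have n12 : x1 != x2 by move: xu; rewrite /= !inE !negb_or => /and3P[/andP[]].
have n34 : x3 != x4 by move: xu; rewrite /= !inE => /and4P[].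
have [l1 l2 l3 l4] := lam4_vals lam xu u1 v1 u2 v2.
set s2 := (s * tperm x1 x2 * tperm x3 x4)%g in card2 x31 H.
have geom1 (x y : G) u v (z : P S 1) : chord_val s lam p x y u v z -> #|porbits (s * tperm x y)%g| = 1.
  by move=> /chord_geom; rewrite /geomn; have := porbits_gt0 (s * tperm x y)%g x; lia.
have sep12 : porbit s2 x1 != porbit s2 x2.
  have := card_porbits_tperm s2 n12; rewrite card2 -(t12_34 s xu) (geom1 _ _ _ _ _ c2).
  by case: (_ != _).
have sep34 : porbit s2 x3 != porbit s2 x4.
  have := card_porbits_tperm s2 n34; rewrite card2 tpermKK (geom1 _ _ _ _ _ c1).
  by case: (_ != _).
pose i0 := comp_of (pT x1); pose j0 := comp_of (pT x2).
have ij : i0 != j0 by apply: contraNneq sep12 => /(pres_comp H) ->.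
have cT : #|cpnt T| = 2 by rewrite (pres_card H).
have two (i : cpnt T) : (i == i0) || (i == j0).
  apply: contraT => ni; have : #|[:: i; i0; j0]| <= #|cpnt T| by apply: max_card.
  by rewrite cT (card_uniqP _) //= !inE ij ni.
have c3 : comp_of (pT x3) = i0 by apply/(pres_comp H).
have c4 : comp_of (pT x4) = j0.
  have := two (comp_of (pT x4)); case/orP => /eqP // c4.
  by move: sep34; rewrite x31 (_ : porbit s2 x4 = porbit s2 x1) ?eqxx //; apply/(pres_comp H).
pose T1 := disc (cyc_uniq i0); pose T2 := disc (cyc_uniq j0).
have [d [r rid]] : exists (d : mdisj T1 T2) (r : iso T (mcsum d)), on_lab r = id.
  exact: split_two ij cT.
have Hd : pres s2 (mark2 (mark2 lam x1 x2 u1 v1) x3 x4 u2 v2) (act_gap r \o pT).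
  by apply: pres_ext (pres_iso r H) => // t /=; rewrite rid; case: (mark2 _ _ _ _ _ t).
have incomp x a : mark2 (mark2 lam x1 x2 u1 v1) x3 x4 u2 v2 x = Some a -> a \in cyc (comp_of (pT x)).
  move=> xa; have := pres_in H xa; rewrite (pres_lab H xa) => /labP[i ai].
  by rewrite (comp_of_inr ai).
have u1T : u1 \in lab T1 by apply: (@mem_lab _ T1 tt); have := incomp _ _ l1.
have v1T : v1 \in lab T2 by apply: (@mem_lab _ T2 tt); have := incomp _ _ l2.
have u2T : u2 \in lab T1 by apply: (@mem_lab _ T1 tt); have := incomp _ _ l3; rewrite c3.
have v2T : v2 \in lab T2 by apply: (@mem_lab _ T2 tt); have := incomp _ _ l4; rewrite c4.
pose C1 : cycl K := Cycl (disc_comp (cyc_uniq i0)).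
pose C2 : cycl K := Cycl (disc_comp (cyc_uniq j0)).
pose Z : P (mcmerge d u2 v2) 0 := mcomp O (S := C1) (T := C2) d u2T v2T (m C1) (m C2).
pose Z' : P (mcmerge d u1 v1) 0 := mcomp O (S := C1) (T := C2) d u1T v1T (m C1) (m C2).
have gZ : good Z.
  have := good_m (cmerge (C := C1) (D := C2) d u2T v2T).
  by rewrite -m_comp.
have gZ' : good Z'.
  have := good_m (cmerge (C := C1) (D := C2) d u1T v1T).
  by rewrite -m_comp.
have H1 : pres (s * tperm x1 x2)%g (mark2 lam x1 x2 u1 v1) (gap_merge u2 v2 \o (act_gap r \o pT)).
  have := pres_merge Hd l3 l4 u2T v2T; rewrite tpermKK.
  by apply: pres_ext => //; apply: erase34.
have H2 : pres (s * tperm x3 x4)%g (mark2 lam x3 x4 u2 v2) (gap_merge u1 v1 \o (act_gap r \o pT)).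
  have := pres_merge Hd l1 l2 u1T v1T; rewrite -(t12_34 s xu).
  by apply: pres_ext => //; apply: erase12.
have u1D := pres_in H1 (mark2l _ _ _ _ _); have v1D := pres_in H1 (mark2r _ _ _ n12).
have u2D := pres_in H2 (mark2l _ _ _ _ _); have v2D := pres_in H2 (mark2r _ _ _ n34).
apply: (@two_chords _ _ _ _ _ _ _ _ _ _ xu xn _ _ _ _ un uv1 uv2 _ _ _ _
  Z Z' _ _ u1D v1D u2D v2D c1 c2 gZ gZ' H1 H2).
move=> q qE; have [u12 v12] : u1 != u2 /\ v1 != v2.
  by move: uu; rewrite /= !inE !negb_or => /and3P[/and3P[_ -> _] /andP[_ ->] _].
apply: (@mxi_mcomp _ _ _ A T1 T2 d u1 v1 u2 v2 u1T v1T u2T v2T uv1 uv2 u12 v12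
  u1D v1D u2D v2D 0 0 (m C1) (m C2) q) => R hR /=.
  have [t tE] := pres_onto Hd (is_suml d hR); have := qE t; rewrite /= in tE *.
  by rewrite tE !gap_mergel.
have [t tE] := pres_onto Hd (is_sumr d hR); have := qE t; rewrite /= in tE *.
by rewrite tE !gap_merger.
Qed.
End Disjoint.

Lemma annulus_chords S (G : finType) (s : {perm G}) (lam : G -> option K) (p : G -> gap S)
    (Hp : pres s lam p) x1 x2 x3 x4 u1 v1 u2 v2 (w w' : P S 1) :
  uniq [:: x1; x2; x3; x4] -> (forall x, x \in [:: x1; x2; x3; x4] -> lam x = None) ->
  uniq [:: u1; v1; u2; v2] -> (forall a, a \in [:: u1; v1; u2; v2] -> a \notin lab S) ->
  chord_val s lam p x1 x2 u1 v1 w -> chord_val s lam p x3 x4 u2 v2 w' -> w = w'.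
Proof.
move=> xu xn uu uS c1 c2.
have geom1 (x y : G) u v (z : P S 1) : chord_val s lam p x y u v z -> #|porbits (s * tperm x y)%g| = 1.
  by move=> /chord_geom; rewrite /geomn; have := porbits_gt0 (s * tperm x y)%g x; lia.
have n12 : x1 != x2 by move: xu; rewrite /= !inE !negb_or => /and3P[/andP[]].
have n34 : x3 != x4 by move: xu; rewrite /= !inE => /and4P[].
have [xn3 xn4] : lam x3 = None /\ lam x4 = None by split; apply: xn; rewrite !inE eqxx ?orbT.
set s2 := (s * tperm x1 x2 * tperm x3 x4)%g.
have card2 : #|porbits s2| = 2.
  have := card_porbits_tperm (s * tperm x1 x2)%g n34; rewrite -/s2 (geom1 _ _ _ _ _ c1).
  by have := porbits_gt0 s2 x1; case: (_ != _) => /=; lia.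
have sep34 : porbit s2 x3 != porbit s2 x4.
  have := card_porbits_tperm s2 n34; rewrite card2 tpermKK (geom1 _ _ _ _ _ c1).
  by case: (_ != _).
have [x31|x31] := eqVneq (porbit s2 x3) (porbit s2 x1).
  exact: (annulus_chords_aux Hp xu xn uu uS c1 c2 card2 x31).
have x41 : porbit s2 x4 = porbit s2 x1.
  have in2 x : porbit s2 x \in porbits s2 by apply: imset_f.
  apply/eqP; apply: contraT => x41.
  have : #|[:: porbit s2 x1; porbit s2 x3; porbit s2 x4]| <= #|porbits s2|.
    by apply: subset_leq_card; apply/fintype.subsetP => O'; rewrite !inE => /or3P[]/eqP->.
  rewrite card2 (card_uniqP _) //= !inE negb_or sep34 andbT.
  by rewrite eq_sym x31 eq_sym x41.
have c2' := chord_sym Hp n34 xn3 xn4 c2.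
have s2E : (s * tperm x1 x2 * tperm x4 x3)%g = s2 by rewrite (tpermC x4).
have perm34 (X : eqType) (a b c d : X) : perm_eq [:: a; b; d; c] [:: a; b; c; d].
  by rewrite !perm_cons (perm_catC [:: d] [:: c]).
apply: (annulus_chords_aux Hp (x3 := x4) (x4 := x3) (u2 := v2) (v2 := u2) _ _ _ _ c1 c2').
- by rewrite (perm_uniq (perm34 _ _ _ _ _)).
- by move=> x; rewrite (perm_mem (perm34 _ _ _ _ _)); apply: xn.
- by rewrite (perm_uniq (perm34 _ _ _ _ _)).
- by move=> x; rewrite (perm_mem (perm34 _ _ _ _ _)); apply: uS.
- by rewrite s2E.
- by rewrite s2E.
Qed.

(** If the two chords disconnect a surface other than an annulus, both are compared
    with a third one whose endpoints lie on different circles both after the first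
    cut and after the second one; such a chord disconnects neither cut surface.  Its
    endpoints are taken among the new points of a doubled presentation. *)
Lemma chord_indep g S (G : finType) (s : {perm G}) (lam : G -> option K) (p : G -> gap S)
    (Hp : pres s lam p) x1 x2 x3 x4 u1 v1 u2 v2 (w w' : P S g.+1) :
  (forall T (z z' : P T g), good z -> good z' -> z = z') ->
  (forall g0, g0 <= g -> forall T, geometric T g0 -> exists z : P T g0, good z) ->
  uniq [:: x1; x2; x3; x4] -> (forall x, x \in [:: x1; x2; x3; x4] -> lam x = None) ->
  uniq [:: u1; v1; u2; v2] -> (forall a, a \in [:: u1; v1; u2; v2] -> a \notin lab S) ->
  chord_val s lam p x1 x2 u1 v1 w -> chord_val s lam p x3 x4 u2 v2 w' -> w = w'.
Proof.
case: g w w' => [|g] w w' un ex xu xn uu uS c1 c2.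
  exact: (annulus_chords Hp xu xn uu uS c1 c2).
have n12 : x1 != x2 by move: xu; rewrite /= !inE !negb_or => /and3P[/andP[]].
have n34 : x3 != x4 by move: xu; rewrite /= !inE => /and4P[].
have g1 := chord_geom c1; have g2 := chord_geom c2.
have e2 := card_porbits_tperm (s * tperm x1 x2)%g n34.
have e1 := card_porbits_tperm (s * tperm x3 x4)%g n12.
have comm : (s * tperm x3 x4 * tperm x1 x2 = s * tperm x1 x2 * tperm x3 x4)%g.
  by rewrite -!mulgA (tperm_comm xu).
rewrite comm in e1.
case: (leqP #|porbits (s * tperm x1 x2 * tperm x3 x4)%g| g.+1) => big.
  apply: (disjoint_chords Hp xu xn uu uS un (ex g _) _ c1 c2) => //.
  exact: geomn_cut g1 e2 big.
have [||y [z [yz1 yz2]]] := @porbits_two_both _ (s * tperm x1 x2)%g (s * tperm x3 x4)%g.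
- exact: geomn_stuck g1 e2 big.
- exact: geomn_stuck g2 e1 big.
have Hd := pres_dbl Hp.
have dc x x' u v (z' : P S g.+2) : chord_val s lam p x x' u v z' ->
    chord_val (dbl s) (dlam lam) (p \o fst) (x, false) (x', false) u v z'.
  apply: (chord_arcs (arcs_dbl s)) => // -[t []] //=; by rewrite eqxx.
have {}c1 := dc _ _ _ _ _ c1; have {}c2 := dc _ _ _ _ _ c2.
have [u3 [v3 [uv3 u3n v3n u3S v3S]]] := fresh2 Kinf [:: u1; v1; u2; v2] S.
have yz : y != z by apply: contraNneq yz1 => ->.
pose Y := (y, true); pose Z := (z, true); have YZ : Y != Z by rewrite xpair_eqE eqxx andbT.
have count c d : c != d -> porbit (s * tperm c d)%g y != porbit (s * tperm c d)%g z ->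
    geomn #|porbits (dbl s * tperm (c, false) (d, false))%g| g.+1 ->
    geomn #|porbits (dbl s * tperm (c, false) (d, false) * tperm Y Z)%g| g /\
    geomn #|porbits (dbl s * tperm Y Z)%g| g.+1.
  move=> cd sep gcd.
  have sep' : porbit (dbl s * tperm (c, false) (d, false))%g Y !=
      porbit (dbl s * tperm (c, false) (d, false))%g Z.
    apply: contraNneq sep => E; apply/eqP.
    exact: (arcs_orbit (arcs_tperm c d (arcs_dbl s)) E).
  have eYZ := card_porbits_tperm (dbl s * tperm (c, false) (d, false))%g YZ.
  have cd' : (c, false) != (d, false) by rewrite xpair_eqE eqxx andbT.
  have ecd := card_porbits_tperm (dbl s * tperm Y Z)%g cd'.
  rewrite -mulgA (@tperm_comm _ Y Z (c, false) (d, false)) ?mulgA in ecd; last first.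
    by rewrite /Y /Z /= !inE !xpair_eqE /= !andbT !andbF !orbF yz cd.
  rewrite sep' in eYZ; exact: geomn_separated gcd ecd eYZ.
have [gm1 gm3] := count _ _ n12 yz1 (chord_geom c1).
have [gm2 _] := count _ _ n34 yz2 (chord_geom c2).
have [w3 c3] := chord_ex Hd YZ erefl erefl uv3 u3S v3S (ex _ (leqnn _)) gm3.
have uu3 a b : a != b -> a \in [:: u1; v1; u2; v2] -> b \in [:: u1; v1; u2; v2] ->
    uniq [:: a; b; u3; v3].
  move=> ab ain bin; rewrite /= !inE !negb_or ab uv3 !andbT /=.
  by apply/andP; split; apply/andP; split;
    [apply: contraNneq u3n => <-|apply: contraNneq v3n => <-
    |apply: contraNneq u3n => <-|apply: contraNneq v3n => <-].
have uS3 a b : a \in [:: u1; v1; u2; v2] -> b \in [:: u1; v1; u2; v2] ->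
    forall c, c \in [:: a; b; u3; v3] -> c \notin lab S.
  move=> ain bin c; rewrite !inE => /or4P[]/eqP-> //; exact: uS.
have xu3 a b : a != b -> uniq [:: (a, false); (b, false); Y; Z].
  by move=> ab; rewrite /Y /Z /= !inE !xpair_eqE /= !andbT !andbF !orbF ab yz.
have xn3 a b : a \in [:: x1; x2; x3; x4] -> b \in [:: x1; x2; x3; x4] ->
    forall c, c \in [:: (a, false); (b, false); Y; Z] -> dlam lam c = None.
  by move=> ain bin c; rewrite !inE => /or4P[]/eqP-> //; apply: xn.
have uv1 : u1 != v1 by move: uu; rewrite /= !inE !negb_or => /and3P[/andP[]].
have uv2 : u2 != v2 by move: uu; rewrite /= !inE => /and4P[].
have ex' : forall T, geometric T g -> exists z : P T g, good z by apply: ex.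
transitivity w3.
  apply: (disjoint_chords Hd (xu3 _ _ n12) (xn3 _ _ _ _) (uu3 _ _ uv1 _ _) (uS3 _ _ _ _) un ex' gm1 c1 c3);
    by rewrite !inE eqxx ?orbT.
symmetry; apply: (disjoint_chords Hd (xu3 _ _ n34) (xn3 _ _ _ _) (uu3 _ _ uv2 _ _) (uS3 _ _ _ _) un ex' gm2 c2 c3);
  by rewrite !inE eqxx ?orbT.
Qed.

(** A chord which depends only on [S], with endpoints among the new points of the
    smallest presentation doubled twice.  One doubling would not do: on a single
    circle with a single gap both endpoints have to follow the same point. *)
Section BaseChord.
Context (S : mcyc K) (g : nat) (gS : geometric S g.+1).

Definition gap_perm4 := dbl (dbl (gap_perm S)).
Definition gap_lab4 : gapT S * bool * bool -> option K := dlam (dlam (@gap_lab K S)).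
Definition gap_val4 (x : gapT S * bool * bool) : gap S := gap_val x.1.1.

Lemma pres_base4 : pres gap_perm4 gap_lab4 gap_val4.
Proof. exact: pres_dbl (pres_dbl (pres_base S)). Qed.

Definition pos1 (y : gapT S) := (y, true, false).
Definition pos2 (y : gapT S) := (y, true, true).

Lemma pos_neq y z : pos1 y != pos2 z.
Proof. by rewrite !xpair_eqE andbF. Qed.

Lemma base_chord : exists y z, geomn #|porbits (gap_perm4 * tperm (pos1 y) (pos2 z))%g| g.
Proof.
have := gS; rewrite geometricE (pres_card pres_base4) => gc.
have c4 : #|porbits gap_perm4| = #|porbits (gap_perm S)|.
  by rewrite -(pres_card pres_base4) (pres_card (pres_base S)).
suff [y [z yz]] : exists y z, 1 < #|porbits gap_perm4| ->
    porbit gap_perm4 (pos1 y) != porbit gap_perm4 (pos2 z).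
  exists y, z; apply: geomn_first gc (card_porbits_tperm gap_perm4 (pos_neq y z)) _ _ yz.
    exact: porbits_gt0 (pos1 y).
  exact: porbits_gt0 (pos1 y).
rewrite c4; have [two|one] := ltnP 1 #|porbits (gap_perm S)|.
  have [y [z yz]] := porbits_two two; exists y, z => _.
  apply: contraNneq yz => /(arcs_orbit (arcs_dbl _))/(arcs_orbit (arcs_dbl _)) /= ->.
  exact: eqxx.
have /card_gt0P[_ /imsetP[y _ _]] : 0 < #|porbits (gap_perm S)|.
  by rewrite -c4 -(pres_card pres_base4) cpnt_gt0.
by exists y, y.
Qed.
End BaseChord.

Lemma good_exists g S : geometric S g -> exists x : P S g, good x.
Proof.
elim: g S => [|g IH] S gS.
  have hS : #|cpnt S| == 1 by move: gS; rewrite geometricE /geomn; have := cpnt_gt0 S; lia.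
  by exists (m (Cycl hS)); apply: (good_m (Cycl hS)).
have [y [z yz]] := base_chord gS; have [u [v [uv _ _ uS vS]]] := fresh2 Kinf [::] S.
have [w cw] := chord_ex (pres_base4 S) (pos_neq y z) erefl erefl uv uS vS IH yz.
by exists w; apply: chord_good cw.
Qed.

(** The last contraction in the construction of a good element is a chord in a
    presentation of [S]; renaming the contracted labels makes them fresh. *)
Lemma good_chord g S (w : P S g.+1) u v : good w -> u != v -> u \notin lab S -> v \notin lab S ->
  exists G (s : {perm G}) lam (p : G -> gap S) x y,
    [/\ pres s lam p, x != y, lam x = None, lam y = None & chord_val s lam p x y u v w].
Proof.
move=> gw uv uS vS.
have [S0 [u0 [v0 [uv0 [uS0 [vS0 [z0 [r0 [gz ->]]]]]]]]] := good_contract gw erefl.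
have H0 := pres_base S0.
have [x xu] := pres_all H0 uS0; have [y yv] := pres_all H0 vS0.
have xy : x != y.
  apply/eqP => E; move: xu; rewrite E yv => -[vu].
  by move: (uv0); rewrite vu eqxx.
have C0 := pres_contract uv0 H0 xu yv; have Hp := pres_iso r0 C0.
set s := (gap_perm S0 * tperm x y)%g in C0 Hp.
set lam := omap _ \o _ in Hp; set p := act_gap r0 \o _ in Hp.
have xn : lam x = None by rewrite /lam /= /erase2 eqxx.
have yn : lam y = None by rewrite /lam /= /erase2 eqxx orbT.
exists (gapT S0), s, lam, p, x, y; split=> //.
have [T [q Hq]] : exists T (q : gapT S0 -> gap T), pres (gap_perm S0) (mark2 lam x y u v) q.
  have G0 : 0 < #|gapT S0| by apply/card_gt0P; exists x.
  have H := pres_realize (gap_perm S0) (mark2_fresh_inj Hp (x := x) (y := y) uv uS vS) G0.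
  by eexists; eexists; apply: H.
have [uT vT] : u \in lab T /\ v \in lab T.
  by split; [apply: pres_in Hq (mark2l _ _ _ _ _)|apply: pres_in Hq (mark2r _ _ _ xy)].
pose f a := if a == u0 then u else if a == v0 then v else on_lab r0 a.
have Hqf : pres (gap_perm S0) (omap f \o @gap_lab K S0) q.
  apply: pres_ext Hq => // t; rewrite /mark2 /f /=.
  case: (eqVneq t x) => [->|tx]; first by rewrite xu /= eqxx.
  case: (eqVneq t y) => [->|ty]; first by rewrite yv /= eq_sym (negbTE uv0) eqxx.
  rewrite /lam /= /erase2 (negbTE tx) (negbTE ty); case E : (gap_lab t) => [a|] //=.
  rewrite ifF; last by apply/negbTE; apply: contraNneq tx => au; rewrite au in E; rewrite (pres_inj H0 xu E).
  by rewrite ifF //; apply/negbTE; apply: contraNneq ty => av; rewrite av in E; rewrite (pres_inj H0 yv E).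
have [r1 r1E] := pres_uniq H0 Hqf.
have Hq' : pres (s * tperm x y)%g (mark2 lam x y u v) q by rewrite tpermKK.
have CT := contract_mark uv Hq' xy xn yn.
have [r rE] := pres_uniq_id CT Hp.
have [t tE] := pres_uniq C0 CT.
exists T, uv, uT, vT, (mact O r1 erefl z0), q, r; split=> //; first exact: good_act.
have r1x : on_lab r1 u0 = u.
  by have := r1E x; rewrite (pres_lab H0 xu) (pres_lab Hq (mark2l _ _ _ _ _)) => -[].
have r1y : on_lab r1 v0 = v.
  by have := r1E y; rewrite (pres_lab H0 yv) (pres_lab Hq (mark2r _ _ _ xy)) => -[].
rewrite -(mxi_act_eq (t := t) uS0 vS0 uT vT z0) //.
  rewrite -(mact_comp A); apply: (mact_pres _ _ _ C0) => c.
  by rewrite act_gap_comp tE rE.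
by move=> R /(pres_onto H0)[c <-] /=; rewrite [LHS]tE /= r1E.
Qed.

(** Any chord of any presentation is compared with the fixed chord of [base_chord],
    after both have been transported to a common presentation. *)
Lemma good_unique g S (w w' : P S g) : good w -> good w' -> w = w'.
Proof.
elim: g S w w' => [|g IH] S w w' gw gw'.
  have hS := good_geom0 gw; by rewrite (good0_m hS gw) (good0_m hS gw').
have gS := good_geometric gw; have [y [z yz]] := base_chord gS.
have [u1 [v1 [uv1 _ _ u1S v1S]]] := fresh2 Kinf [::] S.
have [u2 [v2 [uv2 u2n v2n u2S v2S]]] := fresh2 Kinf [:: u1; v1] S.
have [w0 c0] := chord_ex (pres_base4 S) (pos_neq y z) erefl erefl uv2 u2S v2S (@good_exists g) yz.
suff main (t : P S g.+1) : good t -> t = w0 by rewrite (main w) // (main w').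
move=> gt; have [G [s [lam [p [x [x' [Hp xx' xn xn' ct]]]]]]] := good_chord gt uv1 u1S v1S.
have [f [h [Ar hE lf ln]]] := arcs_base Hp.
have H4 := pres_dbl (pres_dbl Hp).
have c4 : chord_val (dbl (dbl s)) (dlam (dlam lam)) ((p \o fst) \o fst)
    (x, false, false) (x', false, false) u1 v1 t.
  have off (X : finType) (mu : X -> option K) : forall t, (t.1, false) != t -> dlam mu t = None.
    by case=> c [] //=; rewrite eqxx.
  have c2 : chord_val (dbl s) (dlam lam) (p \o fst) (x, false) (x', false) u1 v1 t.
    by apply: (chord_arcs (arcs_dbl s)) ct => //; apply: off.
  by apply: (chord_arcs (arcs_dbl (dbl s))) c2 => //; apply: off.
have c04 : chord_val (dbl (dbl s)) (dlam (dlam lam)) ((p \o fst) \o fst)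
    (f y, true, false) (f z, true, true) u2 v2 w0.
  apply: (chord_ext _ (chord_arcs (dbl_arcs (dbl_arcs Ar)) _ _ c0)).
  - by move=> c /=; rewrite /gap_val4 /= hE.
  - by move=> [[c []] []] //=; rewrite /dlam /= lf.
  - move=> [[c []] []]; rewrite /dlam //= => nc; apply: ln.
    by apply: contraNneq nc => ->; rewrite !(eqxx, xpair_eqE).
apply: (chord_indep H4 _ _ _ _ _ _ c4 c04).
- exact: IH.
- by move=> g0 _ T; apply: good_exists.
- by rewrite /= !inE !xpair_eqE !andbF !andbT /= orbF xx'.
- move=> c; rewrite !inE => /or4P[]/eqP-> //=; by rewrite /dlam.
- rewrite /= !inE !negb_or uv1 uv2 !andbT.
  move: u2n v2n; rewrite !inE !negb_or => /andP[a b] /andP[c d].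
  by rewrite !(eq_sym u1) !(eq_sym v1) a b c d.
- by move=> c; rewrite !inE => /or4P[]/eqP->.
Qed.

(** * Compositions of good elements *)

Section Composition.

(** The contracted labels are made to avoid [l], so that the object before the
    contraction can still be composed with one whose labels are in [l]. *)
Lemma good_peel g S (w : P S g.+1) (l : seq K) : good w ->
  exists S' c e (ce : c != e) (cS : c \in lab S') (eS : e \in lab S') (z : P S' g)
    (r : iso (mccontract S' ce) S),
  [/\ good z, w = mact O r erefl (mxi O ce cS eS z),
      (c \notin l) && (e \notin l), {in lab (mccontract S' ce), on_lab r =1 id} &
      forall a, a \in lab S' -> [|| a == c, a == e | a \in lab S]].
Proof.
move=> gw; have [c [e [ce cl el cS eS]]] := fresh2 Kinf l S.
have [G [s [lam [p [x [y [Hp xy xn yn]]]]]]] := good_chord gw ce cS eS.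
case=> S' [ce' [cS' [eS' [z [p' [r [gz H rE wE]]]]]]].
exists S', c, e, ce', cS', eS', z, r; split=> //; first by rewrite cl el.
  have C := contract_mark ce' H xy xn yn.
  move=> a /(pres_all C)[t ta]; have := rE t.
  by rewrite [gapx _ _](pres_lab C ta) (pres_lab Hp ta) => -[].
move=> a /(pres_all H)[t]; rewrite /mark2; case: eqP => _; first by case=> ->; rewrite eqxx.
case: eqP => _; first by case=> ->; rewrite eqxx orbT.
by move=> ta; rewrite (pres_in Hp ta) !orbT.
Qed.

Lemma mcomp_act_left S S' T (d : mdisj S T) (d' : mdisj S' T) (r : iso S S') u u' v
    (uS : u \in lab S) (vT : v \in lab T) (uS' : u' \in lab S') g h (x : P S g) (y : P T h)
    (t : iso (mcmerge d u v) (mcmerge d' u' v)) :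
  on_lab r u = u' ->
  same_gaps t (gapl d u v) (gapl d' u' v \o act_gap r) ->
  same_gaps t (gapr d u v) (gapr d' u' v) ->
  mact O t erefl (mcomp O d uS vT x y) = mcomp O d' uS' vT (mact O r erefl x) y.
Proof.
move=> E; subst => t1 t2; rewrite -[in RHS](mact_id A y).
apply: (mcomp_act A (s := id_iso T)) => // R hR.
by rewrite /= act_gap_id; apply: t2.
Qed.

(** A contraction may be postponed after a composition. *)
Lemma good_comp_peel g h S T (d : mdisj S T) u v (uS : u \in lab S) (vT : v \in lab T)
    (x : P S g.+1) (y : P T h) :
  (forall S' (d' : mdisj S' T) (uS' : u \in lab S') (z : P S' g),
     good z -> good (mcomp O d' uS' vT z y)) ->
  good x -> good (mcomp O d uS vT x y).
Proof.
move=> IH gx.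
have [S' [c [e [ce [cS [eS [z [r [gz -> ceT rid labS']]]]]]]]] := good_peel (labs T) gx.
move: ceT; rewrite !mem_labs => /andP[cT eT].
have d' : mdisj S' T.
  apply/forallP => i; apply/hasPn => a ai; apply/negP => aT.
  have /or3P[/eqP E|/eqP E|aS] := labS' a (mem_lab ai).
  - by move: cT; rewrite -E => /negP.
  - by move: eT; rewrite -E => /negP.
  - exact: (mdisj_lab d aS aT).
have [u' uC ru'] : exists2 u', u' \in lab (mccontract S' ce) & on_lab r u' = u.
  have [[i|u'] //= hu [uE]] := iso_gap_onto r (uS : is_gap (inr u : gap S)).
  by exists u'.
have u'E : u' = u by rewrite -ru' rid.
subst u'.
have d'' : mdisj (mccontract S' ce) T.
  apply/forallP => i; apply/hasPn => a /mem_lab; rewrite lab_contract // => /and3P[_ _ aS].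
  apply/negP => aT.
  exact: (mdisj_lab d' aS aT).
have := uC; rewrite lab_contract // => /and3P[uc ue uS'].
(* The four objects involved are presented by the points of S' and T. *)
have B1 := pres_base S'; have B2 := pres_base T.
have [xc xcE] := pres_all B1 cS; have [xe xeE] := pres_all B1 eS.
have [xu xuE] := pres_all B1 uS'; have [xv xvE] := pres_all B2 vT.
have C1 := pres_contract ce B1 xcE xeE.
have nuc : xu != xc.
  by apply/eqP => E; move: xuE; rewrite E xcE => -[cu]; move: uc; rewrite cu eqxx.
have nue : xu != xe.
  by apply/eqP => E; move: xuE; rewrite E xeE => -[cu]; move: ue; rewrite cu eqxx.
have nce : xc != xe.
  by apply/eqP => E; move: xcE; rewrite E xeE => -[cu]; move: (ce); rewrite cu eqxx.
have C1u : erase2 (@gap_lab K S') xc xe xu = Some u.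
  by rewrite /erase2 (negbTE nuc) (negbTE nue).
have D1 : pres (gap_perm S' * tperm xc xe)%g (erase2 (@gap_lab K S') xc xe)
    (act_gap r \o (gapx ce \o @gap_val K S')).
  apply: pres_ext (pres_iso r C1) => // t /=; case E : (erase2 _ _ _ t) => [a|] //=.
  by rewrite rid // (pres_in C1 E).
have M1 := pres_merge (pres_sum d'' C1 B2) (x := inl xu) (y := inr xv) C1u xvE uC vT.
have M2 := pres_merge (pres_sum d D1 B2) (x := inl xu) (y := inr xv) C1u xvE uS vT.
have M3 := pres_merge (pres_sum d' B1 B2) (x := inl xu) (y := inr xv) xuE xvE uS' vT.
set lam3 := erase2 _ _ _ in M3.
have l3c : lam3 (inl xc) = Some c.
  by rewrite /lam3 /erase2 /= -[inl xc == _]/(xc == xu) eq_sym (negbTE nuc).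
have l3e : lam3 (inl xe) = Some e.
  by rewrite /lam3 /erase2 /= -[inl xe == _]/(xe == xu) eq_sym (negbTE nue).
have M4 := pres_contract ce M3 l3c l3e.
have cM := pres_in M3 l3c; have eM := pres_in M3 l3e.
have {}M4 : pres (sump (gap_perm S' * tperm xc xe) (gap_perm T) * tperm (inl xu) (inr xv))%g
    (erase2 (sum_case (erase2 (@gap_lab K S') xc xe) (@gap_lab K T)) (inl xu) (inr xv))
    (gapx ce \o (gap_merge u v \o sum_case (suml d' \o @gap_val K S') (sumr d' \o @gap_val K T))).
  have sE : (sump (gap_perm S' * tperm xc xe) (gap_perm T) * tperm (inl xu) (inr xv) =
     sump (gap_perm S') (gap_perm T) * tperm (inl xu) (inr xv) * tperm (inl xc) (inl xe))%g.
    rewrite sump_tperm -!mulgA; congr (_ * _)%g; apply: tperm_comm.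
    rewrite /= !inE -[inl xc == _]/(xc == xe) -[inl xc == _]/(xc == xu) -[inl xe == _]/(xe == xu).
    by rewrite (negbTE nce) (eq_sym xc) (negbTE nuc) (eq_sym xe) (negbTE nue).
  rewrite sE; apply: pres_ext M4 => // -[t|t] //.
  rewrite /lam3 /erase2 /= -[inl t == _]/(t == xc) -[inl t == _]/(t == xe) -[inl t == _]/(t == xu).
  by case: (t == xu); case: (t == xc); case: (t == xe).
have [t tE] := pres_uniq_id M1 M2.
have [q qE] := pres_uniq_id M1 M4.
rewrite -(@mcomp_act_left _ _ _ d'' d r u u v uC vT uS _ _ (mxi O ce cS eS z) y t) //; first last.
- move=> R /(pres_onto B2)[b <-]; have := tE (inr b); rewrite /=.
  by rewrite !gap_merger //; exact: gap_valP.
- move=> R hR; have [b bE] := pres_onto C1 hR; have := tE (inl b); rewrite /= in bE *.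
  rewrite !gap_mergel ?bE //; first by rewrite -bE; apply: (pres_gap D1).
apply: good_act.
have e1 : g.+1 + h = (g + h).+1 by [].
apply: (good_act_inv (r := q) (e := e1) M1 M4 qE).
have -> : mact O q e1 (mcomp O d'' uC vT (mxi O ce cS eS z) y) =
    mxi O ce cM eM (mcomp O d' uS' vT z y).
  apply: (mcomp_mxi A) => //.
    move=> R /(pres_onto B1)[b <-]; have := qE (inl b); rewrite /=.
    by rewrite !gap_mergel //; by [exact: gap_valP|exact: (pres_gap C1 b)].
  move=> R /(pres_onto B2)[b <-]; have := qE (inr b); rewrite /=.
  by rewrite !gap_merger //; exact: gap_valP.
exact/good_xi/IH.
Qed.

Lemma mdisj_sym S T : mdisj S T -> mdisj T S.
Proof.
move=> d; apply/forallP => i; apply/hasPn => a ai; apply/negP => aS.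
exact: (mdisj_lab d aS (mem_lab ai)).
Qed.

Lemma good_comp_swap S T (d : mdisj S T) (d' : mdisj T S) u v (uS : u \in lab S) (vT : v \in lab T)
    g h (x : P S g) (y : P T h) :
  good (mcomp O d' vT uS y x) -> good (mcomp O d uS vT x y).
Proof.
have B1 := pres_base S; have B2 := pres_base T.
have [xu xuE] := pres_all B1 uS; have [xv xvE] := pres_all B2 vT.
have H := pres_sum d B1 B2.
pose c (z : cpnt (mcsum d)) : cpnt (mcsum d') := match z with inl i => inr i | inr j => inl j end.
have cb : bijective c by exists (fun z => match z with inl i => inr i | inr j => inl j end) => -[].
have cr i : is_rot (map id (cyc i)) (cyc (c i)) by exists 0; rewrite rot0 map_id; case: i.
pose r := Iso cb cr.
have H' := pres_iso r H.
have M1 := pres_merge H (x := inl xu) (y := inr xv) xuE xvE uS vT.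
have M2 := pres_merge H' (x := inr xv) (y := inl xu) (u := v) (v := u).
rewrite /= xvE xuE in M2; have {}M2 := M2 erefl erefl vT uS.
have {}M2 : pres (sump (gap_perm S) (gap_perm T) * tperm (inl xu) (inr xv))%g
   (erase2 (sum_case (@gap_lab K S) (@gap_lab K T)) (inl xu) (inr xv))
   (gap_merge v u \o (act_gap r \o sum_case (suml d \o @gap_val K S) (sumr d \o @gap_val K T))).
  rewrite tpermC; apply: pres_ext M2 => // t; rewrite /erase2 orbC /=.
  by case: ifP => // _; case: (sum_case _ _ t).
have [t tE] := pres_uniq_id M1 M2.
move=> gyx; apply: (good_act_inv (r := t) (e := addnC g h) M1 M2 tE).
rewrite (mcompC A uS vT x y (d' := d')) //.
- move=> R /(pres_onto B1)[b <-]; have := tE (inl b); rewrite /= gap_mergel; last exact: gap_valP.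
  move=> ->; rewrite -(gap_merger d'); last exact: gap_valP.
  by case: (gap_val b).
- move=> R /(pres_onto B2)[b <-]; have := tE (inr b); rewrite /= gap_merger; last exact: gap_valP.
  move=> ->; rewrite -(gap_mergel d'); last exact: gap_valP.
  by case: (gap_val b).
Qed.

(** Contractions are postponed in both arguments until two discs are composed. *)
Lemma good_comp S T (d : mdisj S T) u v (uS : u \in lab S) (vT : v \in lab T)
    g h (x : P S g) (y : P T h) : good x -> good y -> good (mcomp O d uS vT x y).
Proof.
have [n] := ubnP (g + h); elim: n => // n IH in S T d u v uS vT g h x y *.
case: g x => [|g] x.
  case: h y => [|h] y le gx gy.
    have hS := good_geom0 gx; have hT := good_geom0 gy.
    rewrite (good0_m hS gx) (good0_m hT gy).
    have := m_comp (C := Cycl hS) (D := Cycl hT) d uS vT; rewrite /= => ->.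
    exact: (good_m (cmerge (C := Cycl hS) (D := Cycl hT) d uS vT)).
  apply: (@good_comp_swap _ _ d (mdisj_sym d) _ _ uS vT 0 h.+1 x y); apply: good_comp_peel => // S' d' uS' z gz.
  by apply: IH => //; rewrite addn0 -ltnS.
move=> le gx gy; apply: good_comp_peel => // S' d' uS' z gz.
by apply: IH => //.
Qed.
End Composition.
End Good.

Local Open Scope ring_scope.

Definition mk_linear (k : comPzRingType) (U V : lmodType k) (f : U -> V) (lf : linear f) :
  {linear U -> V} := HB.pack f (GRing.isLinear.Build k U V *:%R f lf).

(** * The universal property *)

Section Morphisms.
Context (k : comPzRingType) (K : eqType).
Implicit Types P Q R : lmodop k K.

Lemma lin_id (U : lmodType k) : linear (@id U).
Proof. by []. Qed.

Lemma linear_comp (U V W : lmodType k) (f : {linear V -> W}) (g : {linear U -> V}) :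
  linear (fun x => f (g x)).
Proof. by move=> a x y; rewrite !linearP. Qed.

Definition id_mor P : mod_mor P P :=
  @ModMor k K P P (fun S g => mk_linear (@lin_id (lmcar P S g)))
    (fun _ _ _ _ _ _ _ => erefl) (fun _ _ _ _ _ _ _ _ _ _ _ => erefl)
    (fun _ _ _ _ _ _ _ _ => erefl).

Lemma comp_mor_exists P Q R (G : mod_mor Q R) (F : mod_mor P Q) : exists H : mod_mor P R,
  forall S g x, H S g x = G S g (F S g x).
Proof.
unshelve eexists (@ModMor k K P R (fun S g => mk_linear (linear_comp (G S g) (F S g))) _ _ _).
- by move=> * /=; rewrite !mfun_act.
- by move=> * /=; rewrite !mfun_comp.
- by move=> * /=; rewrite !mfun_xi.
by [].
Qed.
End Morphisms.

Section Envelope.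
Context (k : comPzRingType) (K : eqType) (Kinf : infinite_set [set: K]).
Local Notation Ass := (span_cycop k (term_cyc K)).
Local Notation SpanM := (span_modop k (term_mod K)).

Definition pt S g (h : @geometric K S g) : term_car S g := exist _ tt h.

Definition gen S g (h : @geometric K S g) : lmcar SpanM S g := fbasis k (pt h).

Lemma spanM_ext (V : lmodType k) S g (f f' : lmcar SpanM S g -> V) :
  linear f -> linear f' -> (forall h, f (gen h) = f' (gen h)) -> f =1 f'.
Proof.
move=> lf lf' E; apply: (freemod_ext lf lf') => y.
by rewrite (_ : y = pt (svalP y)); [apply: E|apply: unit_sig_eq].
Qed.

Lemma spanM_ext2 (V : lmodType k) S T g h (f f' : lmcar SpanM S g -> lmcar SpanM T h -> V) :
  (forall t, linear (f^~ t)) -> (forall s, linear (f s)) ->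
  (forall t, linear (f'^~ t)) -> (forall s, linear (f' s)) ->
  (forall a b, f (gen a) (gen b) = f' (gen a) (gen b)) -> forall s t, f s t = f' s t.
Proof.
move=> fl fr fl' fr' E s t; apply: (spanM_ext (fl t) (fl' t)) => a.
exact: (spanM_ext (fr _) (fr' _)).
Qed.

Lemma geometric_cycl (C : cycl K) : geometric C 0.
Proof. by rewrite geometricE (eqP (cycl_comp C)). Qed.

Definition ass_unit_fun (C : cycl K) : lccar Ass C -> lccar (box SpanM) C :=
  span1 (fun _ : unit => pt (geometric_cycl C)).

Lemma ass_unit_lin C : linear (@ass_unit_fun C).
Proof. exact: span1_lin. Qed.

Lemma ass_unit_act (C D : cycl K) (r : iso C D) x :
  ass_unit_fun (cact Ass r x) = cact (box SpanM) r (ass_unit_fun x).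
Proof.
rewrite /ass_unit_fun /= !span1_comp; apply: span1_eq => t; exact: unit_sig_eq.
Qed.

Lemma ass_unit_comp (C D : cycl K) (d : mdisj C D) u v (uC : u \in lab C) (vD : v \in lab D) x y :
  ass_unit_fun (ccomp Ass d uC vD x y) =
  ccomp (box SpanM) d uC vD (ass_unit_fun x) (ass_unit_fun y).
Proof.
rewrite /ass_unit_fun /= span12 span21; apply: span2_eq => s t; exact: unit_sig_eq.
Qed.

Definition ass_unit : cyc_mor Ass (box SpanM) :=
  @CycMor k K Ass (box SpanM) (fun C => mk_linear (@ass_unit_lin C)) ass_unit_act ass_unit_comp.

Section Universal.
Context (Q : lmodop k K) (f : cyc_mor Ass (box Q)).

Definition disc_elt (C : cycl K) : lmcar Q C 0 := f C (fbasis k tt).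

Lemma disc_elt_act (C D : cycl K) (r : iso C D) : mact Q r erefl (disc_elt C) = disc_elt D.
Proof.
have := cfun_act f r (fbasis k tt); rewrite /= span1_basis => E.
by rewrite /disc_elt E.
Qed.

Lemma disc_elt_comp (C D : cycl K) (d : mdisj C D) u v (uC : u \in lab C) (vD : v \in lab D) :
  mcomp Q d uC vD (disc_elt C) (disc_elt D) = disc_elt (cmerge d uC vD).
Proof.
have := cfun_comp f d uC vD (fbasis k tt) (fbasis k tt); rewrite /= span2_basis => E.
by rewrite /disc_elt E.
Qed.

Local Notation goodQ := (good (lmop Q) disc_elt).

Lemma goodQ_unique S g (x y : lmcar Q S g) : goodQ x -> goodQ y -> x = y.
Proof. exact: (good_unique Kinf (lmodop_ax Q) disc_elt_act disc_elt_comp). Qed.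

Lemma goodQ_exists S g : geometric S g -> exists x : lmcar Q S g, goodQ x.
Proof. exact: (good_exists Kinf (lmop Q) disc_elt). Qed.

Definition elt S g (y : term_car S g) : lmcar Q S g := sval (cid (goodQ_exists (svalP y))).

Lemma elt_good S g (y : term_car S g) : goodQ (elt y).
Proof. by rewrite /elt; case: cid. Qed.

Definition ext_fun S g : lmcar SpanM S g -> lmcar Q S g := flift (@elt S g).

Lemma ext_lin S g : linear (@ext_fun S g).
Proof. exact: flift_linear. Qed.

Lemma ext_act S T g h (r : iso S T) (e : g = h) x :
  ext_fun (mact SpanM r e x) = mact Q r e (ext_fun x).
Proof.
move: x; apply: spanM_ext => [||a].
- exact: (linear_comp_fun (@ext_lin _ _) (lmact_lin (l := SpanM) r e)).
- exact: (linear_comp_fun (lmact_lin (l := Q) r e) (@ext_lin _ _)).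
rewrite /= span1_basis /ext_fun !flift_basis; apply: goodQ_unique; first exact: elt_good.
by apply: good_act; apply: elt_good.
Qed.

Lemma ext_comp S T (d : mdisj S T) u v (uS : u \in lab S) (vT : v \in lab T) g h x y :
  ext_fun (mcomp SpanM d uS vT x y) =
  mcomp Q d uS vT (@ext_fun S g x) (@ext_fun T h y).
Proof.
apply: (@spanM_ext2 (lmcar Q (mcmerge d u v) (g + h)) S T g h
  (fun x y => ext_fun (mcomp SpanM d uS vT x y))
  (fun x y => mcomp Q d uS vT (ext_fun x) (ext_fun y))) => [{}y|{}x|{}y|{}x|a b].
- exact: (linear_comp_fun (@ext_lin _ _) (lmcomp_linl (l := SpanM) d uS vT y)).
- exact: (linear_comp_fun (@ext_lin _ _) (lmcomp_linr (l := SpanM) d uS vT x)).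
- exact: (linear_comp_fun (lmcomp_linl (l := Q) d uS vT _) (@ext_lin _ _)).
- exact: (linear_comp_fun (lmcomp_linr (l := Q) d uS vT _) (@ext_lin _ _)).
rewrite /= span2_basis /ext_fun !flift_basis; apply: goodQ_unique; first exact: elt_good.
apply: (good_comp Kinf (lmodop_ax Q) disc_elt_act disc_elt_comp); exact: elt_good.
Qed.

Lemma ext_xi S u v (uv : u != v) (uS : u \in lab S) (vS : v \in lab S) g (x : lmcar SpanM S g) :
  ext_fun (mxi SpanM uv uS vS x) = mxi Q uv uS vS (ext_fun x).
Proof.
move: x; apply: spanM_ext => [||a].
- exact: (linear_comp_fun (@ext_lin _ _) (lmxi_lin (l := SpanM) uv uS vS (g := g))).
- exact: (linear_comp_fun (lmxi_lin (l := Q) uv uS vS (g := g)) (@ext_lin _ _)).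
rewrite /= span1_basis /ext_fun !flift_basis; apply: goodQ_unique; first exact: elt_good.
by apply: good_xi; apply: elt_good.
Qed.

Definition ext_mor : mod_mor SpanM Q :=
  @ModMor k K SpanM Q (fun S g => mk_linear (@ext_lin S g)) ext_act ext_comp ext_xi.

Lemma ext_unit (C : cycl K) (x : lccar Ass C) : ext_mor C 0 (ass_unit C x) = f C x.
Proof.
move: x; apply: (@freemod_ext _ _ _ (fun x => ext_mor C 0 (ass_unit C x)) (f C)) => [||[]].
- exact: linear_comp.
- exact: linearP.
rewrite /= /ass_unit_fun span1_basis /ext_fun flift_basis.
by apply: goodQ_unique; [apply: elt_good|apply: (good_m _ disc_elt C)].
Qed.

(** Every generator of the span is obtained from those of the discs, which is what
    makes a morphism out of it unique. *)
Lemma good_pt S g (h : geometric S g) :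
  good (lmop SpanM) (fun C => ass_unit C (fbasis k tt)) (fbasis k (pt h) : lmcar SpanM S g).
Proof.
have [x gx] := good_exists Kinf (lmop SpanM) (fun C => ass_unit C (fbasis k tt)) h.
suff [h' xE] : exists h', x = fbasis k (pt h').
  by move: gx; rewrite xE (_ : pt h' = pt h) //; apply: unit_sig_eq.
elim: gx {h} => {S g x} [C|S u v uv uS vS g x _ [h ->]|S T g h r e x _ [h' ->]].
- by exists (geometric_cycl C); rewrite /= /ass_unit_fun span1_basis.
- by eexists; rewrite /= span1_basis.
- by eexists; rewrite /= span1_basis.
Qed.

Lemma ext_unique (F : mod_mor SpanM Q) :
  (forall (C : cycl K) (x : lccar Ass C), F C 0 (ass_unit C x) = f C x) ->
  forall S g x, F S g x = ext_mor S g x.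
Proof.
move=> Fe.
have goodF S g (x : lmcar SpanM S g) :
    good (lmop SpanM) (fun C => ass_unit C (fbasis k tt)) x -> goodQ (F S g x).
  elim=> {S g x} [C|S u v uv uS vS g x _ IH|S T g h r e x _ IH].
  - by rewrite Fe; apply: (good_m _ disc_elt C).
  - by rewrite mfun_xi; apply: good_xi.
  - by rewrite mfun_act; apply: good_act.
move=> S g; apply: spanM_ext => [||a]; [exact: linearP|exact: linearP|].
rewrite /= /ext_fun flift_basis; apply: goodQ_unique; last exact: elt_good.
exact/goodF/good_pt.
Qed.
End Universal.

Lemma ass_unit_envelope : is_mod_envelope ass_unit.
Proof.
move=> Q f; split; first by exists (ext_mor f) => C x; apply: ext_unit.
by move=> F G HF HG S g x; rewrite (ext_unique HF) (ext_unique HG).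
Qed.

(** The isomorphism of each geometric component with the ring of scalars. *)
Definition aug S g : lmcar SpanM S g -> k^o := flift (V := k^o) (fun _ => 1).

Lemma aug_lin S g : linear (@aug S g).
Proof. exact: flift_linear. Qed.

Lemma aug_bij S g : geometric S g -> bijective (@aug S g).
Proof.
move=> h; exists (fun c => c *: gen h).
  apply: (@spanM_ext (lmcar SpanM S g) S g (fun s => aug s *: gen h) id) => // [a x y|h'].
    by rewrite aug_lin scalerDl scalerA.
  by rewrite /aug flift_basis scale1r (eq_irrelevance h' h).
move=> c; rewrite -[aug _]/(mk_linear (@aug_lin S g) _) linearZ /= /aug flift_basis.
exact: mulr1.
Qed.

Lemma aug_act S T g h (r : iso S T) (e : g = h) (x : lmcar SpanM S g) :
  aug (mact SpanM r e x) = aug x.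
Proof.
move: x; apply: spanM_ext => [||a].
- exact: (linear_comp_fun (@aug_lin _ _) (lmact_lin (l := SpanM) r e)).
- exact: aug_lin.
by rewrite /= span1_basis /aug !flift_basis.
Qed.

Lemma aug_comp S T (d : mdisj S T) u v (uS : u \in lab S) (vT : v \in lab T) g h
    (x : lmcar SpanM S g) (y : lmcar SpanM T h) :
  aug (mcomp SpanM d uS vT x y) = aug x * aug y.
Proof.
apply: (@spanM_ext2 k^o S T g h (fun x y => aug (mcomp SpanM d uS vT x y))
  (fun x y => aug x * aug y)) => [{}y|{}x|{}y|{}x|a b].
- exact: (linear_comp_fun (@aug_lin _ _) (lmcomp_linl (l := SpanM) d uS vT y)).
- exact: (linear_comp_fun (@aug_lin _ _) (lmcomp_linr (l := SpanM) d uS vT x)).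
- by move=> a s t; rewrite aug_lin mulrDl; congr (_ + _); rewrite -[LHS]mulrA.
- by move=> a s t; rewrite aug_lin mulrDr; congr (_ + _); exact: mulrCA.
by rewrite /= span2_basis /aug !flift_basis mulr1.
Qed.

Lemma aug_xi S u v (uv : u != v) (uS : u \in lab S) (vS : v \in lab S) g (x : lmcar SpanM S g) :
  aug (mxi SpanM uv uS vS x) = aug x.
Proof.
move: x; apply: spanM_ext => [||a].
- exact: (linear_comp_fun (@aug_lin _ _) (lmxi_lin (l := SpanM) uv uS vS (g := g))).
- exact: aug_lin.
by rewrite /= span1_basis /aug !flift_basis.
Qed.
End Envelope.

Local Open Scope classical_set_scope.
Local Open Scope ring_scope.

Theorem theorem37 (k : comPzRingType) (K : eqType)
    (Kinf : infinite_set [set: K]) :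
  let Ass : lcycop k K := span_cycop k (term_cyc K) in
  let SpanM : lmodop k K := span_modop k (term_mod K) in
  (exists eta : cyc_mor Ass (box SpanM), is_mod_envelope eta) /\
  (forall (E : lmodop k K) (eta : cyc_mor Ass (box E)), is_mod_envelope eta ->
     mod_iso E SpanM /\
     exists phi : forall (S : mcyc K) (g : nat), {linear lmcar E S g -> k^o},
       (forall (S : mcyc K) (g : nat), geometric S g -> bijective (phi S g)) /\
       (forall (S : mcyc K) (g : nat), ~~ geometric S g ->
          forall x : lmcar E S g, x = 0) /\
       (forall (S T : mcyc K) (g h : nat) (r : iso S T) (e : g = h)
          (x : lmcar E S g),
          phi T h (mact E r e x) = phi S g x) /\
       (forall (S T : mcyc K) (d : mdisj S T) (u v : K)
          (uS : u \in lab S) (vT : v \in lab T) (g h : nat)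
          (x : lmcar E S g) (y : lmcar E T h),
          phi (mcmerge d u v) (g + h)%N (mcomp E d uS vT x y)
          = phi S g x * phi T h y) /\
       (forall (S : mcyc K) (u v : K) (uv : u != v)
          (uS : u \in lab S) (vS : v \in lab S) (g : nat) (x : lmcar E S g),
          phi (mccontract S uv) g.+1 (mxi E uv uS vS x) = phi S g x)).
Proof.
move=> Ass SpanM; split; first by exists (ass_unit k K); apply: ass_unit_envelope.
move=> E eta Eenv.
have [[F Feta] _] := Eenv SpanM (ass_unit k K).
have [[H Heta] _] := ass_unit_envelope Kinf eta.
have [HF HFE] := comp_mor_exists H F; have [FH FHE] := comp_mor_exists F H.
have FK S g : cancel (F S g) (H S g).
  move=> x; rewrite -HFE; have [_ un] := Eenv E eta.
  apply: (un HF (id_mor E)) => C y //.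
  by rewrite HFE Feta Heta.
have HK S g : cancel (H S g) (F S g).
  move=> x; rewrite -FHE; have [_ un] := ass_unit_envelope Kinf (ass_unit k K).
  apply: (un FH (id_mor SpanM)) => C y //.
  by rewrite FHE Heta Feta.
have Fbij S g : bijective (F S g) := Bijective (FK S g) (HK S g).
split; first by exists F.
exists (fun S g => mk_linear (linear_comp (mk_linear (@aug_lin k K S g)) (F S g))).
split=> [S g gS|]; first exact (bij_comp (aug_bij k gS) (Fbij S g)).
split=> [S g nS x|]; first by apply: contraNeq nS; apply: lmgeom.
split=> [S T g h r e x|]; first by rewrite /= mfun_act aug_act.
split=> [S T d u v uS vT g h x y|S u v uv uS vS g x].
  by rewrite /= mfun_comp aug_comp.
by rewrite /= mfun_xi aug_xi.
Qed.
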